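(* Let $N$ be a positive integer and let $\{\psi_j\}_{j=1}^N\subset H^1(SU(2))$ be a family that is orthonormal in $L^2(SU(2))$ and satisfies $\int_{SU(2)}\psi_j(x)\,dx=0$ for all $j$. Let $$\rho(x):=\sum_{j=1}^N|\psi_j(x)|^2,\qquad x\in SU(2).$$ Then $$\int_{SU(2)}\rho(x)^{\frac{5}{3}}\,dx\leq \frac{35}{18}\sqrt[3]{\frac{25}{6\pi^4}}\ \sum_{j=1}^N\|\nabla\psi_j\|_2^2 .$$
   Context: $SU(2)$ is identified with the unit sphere $\mathbb{S}^3\subset\mathbb{R}^4\cong\mathbb{C}^2$ with its standard round Riemannian metric, and $dx$ is the standard non-normalized Haar measure on $SU(2)$, with total mass $\mathrm{vol}(SU(2))=2\pi^2$ (i.e. the surface measure of $\mathbb{S}^3$); all $L^2$ inner products and norms are taken with respect to it. $H^1(SU(2))$ is the Sobolev space of order $1$ of (complex-valued) functions, $\nabla$ is the Riemannian gradient for the round metric, and $\|\nabla\psi\|_2^2=\int_{SU(2)}|\nabla\psi(x)|^2\,dx$. *)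

(* Defs.v *)
From HB Require Import structures.
From mathcomp Require Import all_boot all_order all_algebra.
From mathcomp Require Import complex.
From mathcomp Require Import all_classical all_reals all_analysis.
From mathcomp Require Import measurable_realfun.
Set Implicit Arguments.
Unset Strict Implicit.
Unset Printing Implicit Defensive.
Import Order.TTheory GRing.Theory Num.Theory.
Import numFieldNormedType.Exports.
Local Open Scope classical_set_scope.
Local Open Scope ring_scope.
Local Open Scope complex_scope.

(* R^4; only its Borel structure, topology and linear structure are used: the
   canonical product norm is the sup norm, so the Euclidean one is [enorm]. *)
Notation R4 R := (R * R * R * R)%type.

Section sphere.
Context {R : realType}.
Implicit Types (x : R4 R) (i : 'I_4) (f : R4 R -> R) (psi : R4 R -> R[i]).

Definition coord x i : R := tnth [tuple x.1.1.1; x.1.1.2; x.1.2; x.2] i.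

Definition axis i : R4 R :=
  ((i == 0 :> nat)%N%:R, (i == 1 :> nat)%N%:R,
   (i == 2 :> nat)%N%:R, (i == 3 :> nat)%N%:R).

Definition enorm x : R := Num.sqrt (\sum_i coord x i ^+ 2).

Definition normalize x : R4 R := (enorm x)^-1 *: x.

(* SU(2) as the unit sphere of R^4 = C^2: the point x stands for the matrix
   [[x0 + i x1, x2 + i x3], [- x2 + i x3, x0 - i x1]]. Functions on SU(2) are
   represented by functions on R^4 whose values off [SU2] are irrelevant. *)
Definition SU2 : set (R4 R) := [set x | enorm x = 1].

Definition lebesgue4 :=
  (@lebesgue_measure R \x @lebesgue_measure R \x @lebesgue_measure R
     \x @lebesgue_measure R)%E.

HB.instance Definition _ := Measure.on lebesgue4.

(* The (cone) surface measure of the unit sphere, of total mass 2 * pi ^+ 2: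
   4 times the volume of the part of the punctured unit ball above A. *)
Definition surface (A : set (R4 R)) : \bar R :=
  (4%:E * lebesgue4 [set x | [/\ 0 < enorm x, enorm x <= 1
                              & A (normalize x)]%R])%E.

Lemma measurable_coord i : measurable_fun [set: R4 R] (coord ^~ i).
Proof.
rewrite (_ : (coord ^~ i) = tnth [tuple fun x : R4 R => x.1.1.1;
    fun x => x.1.1.2; fun x => x.1.2; fun x => x.2] i); last first.
  by case: i => -[|[|[|[|//]]]] ?; apply/funext.
have m1 : measurable_fun [set: R4 R] (fun x => x.1) by exact: measurable_fst.
have m11 : measurable_fun [set: R4 R] (fun x => x.1.1).
  exact: measurableT_comp.
case: i => -[|[|[|[|//]]]] i4; rewrite /tnth /=.
- exact: measurableT_comp.
- exact: measurableT_comp.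
- exact: measurableT_comp.
- exact: measurable_snd.
Qed.

Lemma measurable_enorm : measurable_fun [set: R4 R] enorm.
Proof.
apply: measurableT_comp; 
  first by apply: continuous_measurable_fun; exact: sqrt_continuous.
apply: measurable_sum => i.
by apply: measurable_funX; exact: measurable_coord.
Qed.

Lemma measurable_normalize : measurable_fun [set: R4 R] normalize.
Proof.
have mi : measurable_fun [set: R4 R] (fun x => (enorm x)^-1).
  rewrite (_ : (fun x => _) = (fun x => enorm x `^ (-1))); last first.
    by apply/funext => x; rewrite powR_inv1// sqrtr_ge0.
  exact: measurableT_comp (@measurable_powR R (-1)) measurable_enorm.
have mc i : measurable_fun [set: R4 R] (fun x => (enorm x)^-1 * coord x i).
  by apply: measurable_funM => //; exact: measurable_coord.
rewrite (_ : normalize = fun x => ((enorm x)^-1 * coord x 0,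
  (enorm x)^-1 * coord x 1, (enorm x)^-1 * coord x 2%:R,
  (enorm x)^-1 * coord x 3%:R)); last by apply/funext => -[[[]]].
by do 3 (apply: measurable_fun_pair => //).
Qed.

Lemma measurable_cone (A : set (R4 R)) : measurable A ->
  measurable [set x | [/\ 0 < enorm x, enorm x <= 1 & A (normalize x)]].
Proof.
move=> mA.
rewrite (_ : [set x | _] = (enorm @^-1` `]0, 1]) `&` (normalize @^-1` A)).
  apply: measurableI; rewrite -[X in measurable X]setTI.
    exact: measurable_enorm.
  exact: measurable_normalize.
apply/seteqP; split=> x /=; rewrite in_itv /=; first by case=> -> ->.
by case=> /andP[].
Qed.

Lemma surface0 : surface set0 = 0%E.
Proof.
rewrite /surface (_ : [set x | _] = set0) ?measure0 ?mule0//.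
by apply/seteqP; split=> x // [].
Qed.

Lemma surface_ge0 A : (0 <= surface A)%E.
Proof. by rewrite mule_ge0 ?lee_fin. Qed.

Lemma surface_sigma_additive : semi_sigma_additive surface.
Proof.
move=> F mF tF mUF.
pose C n := [set x | [/\ 0 < enorm x, enorm x <= 1 & F n (normalize x)]].
have mC n : measurable (C n) by exact: measurable_cone.
have tC : trivIset setT C.
  apply/trivIsetP => i j _ _ ij.
  apply/seteqP; split=> x //= -[[_ _ Fi] [_ _ Fj]].
  have /trivIsetP/(_ i j I I ij) := tF.
  by move/seteqP => [/(_ (normalize x)) + _]; exact.
rewrite /surface (_ : [set x | _] = \bigcup_n C n); last first.
  apply/seteqP; split=> x /=; first by move=> [? ? [n _ ?]]; exists n.
  by move=> [n _ [? ? ?]]; split=> //; exists n.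
exact: (@measure_semi_sigma_additive _ _ _
  (mscale (NngNum (ler0n R 4)) lebesgue4) C mC tC (bigcupT_measurable _ mC)).
Qed.

HB.instance Definition _ := isMeasure.Build _ _ _ surface
  surface0 surface_ge0 surface_sigma_additive.

Definition cint psi : R[i] :=
  (\int[surface]_(x in SU2) complex.Re (psi x)) +i*
  (\int[surface]_(x in SU2) complex.Im (psi x)).

Definition sqmod (z : R[i]) : R := complex.Re z ^+ 2 + complex.Im z ^+ 2.

Definition inner2 psi phi : R[i] := cint (fun x => psi x * (phi x)^*).

Definition L2 psi : Prop :=
  [/\ measurable_fun SU2 (fun x => complex.Re (psi x)),
      measurable_fun SU2 (fun x => complex.Im (psi x)) &
      (\int[surface]_(x in SU2) (sqmod (psi x))%:E < +oo)%E].

Definition partial i f : R4 R -> R := fun x => 'D_(axis i) f x.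

(* C^infty on the open set U: all iterated partial derivatives exist and are
   continuous on U. *)
Definition smooth_on (U : set (R4 R)) f : Prop :=
  forall s : seq 'I_4, let g := foldr partial f s in
  forall x, U x -> {for x, continuous g} /\ forall i, derivable g x (axis i).

(* The extension to R^4 \ {0}, constant along rays, of a function on SU(2). *)
Definition radial f : R4 R -> R := fun x => f (normalize x).

Definition smooth f : Prop := smooth_on [set x | x != 0] (radial f).

(* Vector fields on SU(2), in the ambient coordinates of R^4. *)
Definition smooth_field (X : R4 R -> 'I_4 -> R) : Prop :=
  (forall i, smooth (X ^~ i)) /\
  (forall x, SU2 x -> \sum_i coord x i * X x i = 0).

(* The Riemannian divergence, at points x of SU(2), of a tangent field: the
   radial derivative of the extension vanishes, so that its Euclidean
   divergence is the trace over the tangent space. *)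
Definition divergence (X : R4 R -> 'I_4 -> R) x : R :=
  \sum_i partial i (radial (X ^~ i)) x.

(* G is the (distributional) Riemannian gradient of psi and lies in L^2: it is
   tangent to SU(2), the metric being the one induced by R^4, and satisfies
   int <G, X> = - int psi div X for all smooth vector fields X. *)
Definition is_gradient psi (G : R4 R -> 'I_4 -> R[i]) : Prop :=
  [/\ forall i, L2 (G ^~ i),
      forall x, SU2 x -> \sum_i (coord x i)%:C * G x i = 0 &
      forall X, smooth_field X ->
        cint (fun x => \sum_i G x i * (X x i)%:C) =
        - cint (fun x => psi x * (divergence X x)%:C)].

Definition H1 psi : Prop := L2 psi /\ exists G, is_gradient psi G.

(* Determined up to a null set when psi is in H^1, and 0 by convention
   otherwise. *)
Definition grad psi : R4 R -> 'I_4 -> R[i] :=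
  xget (fun _ _ => 0) [set G | is_gradient psi G].

Definition norm2_grad psi : \bar R :=
  (\int[surface]_(x in SU2) (\sum_i sqmod (grad psi x i))%:E)%E.

Definition density N (psi : 'I_N -> R4 R -> R[i]) x : R :=
  \sum_j sqmod (psi j x).

End sphere.
Arguments SU2 : clear implicits.
Arguments surface : clear implicits.

(* Main.v *)
From HB Require Import structures.
Require Import Defs.
From mathcomp Require Import all_boot all_order all_algebra.
From mathcomp Require Import complex ring lra.
From mathcomp Require Import all_classical all_reals all_analysis.
From mathcomp Require Import measurable_realfun.
Import Defs.
Import Order.TTheory GRing.Theory Num.Theory.
Import numFieldNormedType.Exports.
Local Open Scope classical_set_scope.
Local Open Scope ring_scope.
Set Implicit Arguments.
Unset Strict Implicit.
Unset Printing Implicit Defensive.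

(** Rumin's method on the three-sphere.

    Let P_n be the orthogonal projection onto the spherical harmonics of degree n,
    with the eigenvalue L_n = n (n + 2), and S_n = P_1 + ... + P_n. For a function f of
    mean zero the energy dominates the tails of its expansion: summing by parts,
      sum_n (L_(n+1) - L_n) |f - S_n f|^2 = sum_n L_n |P_n f|^2 <= |grad f|^2
    ([energy_tail]). On the other hand, at a point x, orthonormality of the
    psi_j bounds sum_j |S_n psi_j (x)|^2 by the value z_n of the kernel of S_n
    on the diagonal ([psum_density]), and z_n <= c L_n^(3/2) with
    c^2 = 25 / (48 pi^4) ([zonal_density_le]). So the triangle inequality in C^N
    leaves at least the square of the positive part of sqrt rho - sqrt z_n for
    the tail sum_j |psi_j - S_n psi_j|^2 ([minkowski_tail]). With L = t^4, the sum
    of these squares against L_(n+1) - L_n dominates the integral over t of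
    4 t^3 times the square of the positive part of sqrt rho - sqrt c t^3
    ([rumin_sum]). That integral is (9/35) c^(-2/3) rho^(5/3), and integrating
    over the sphere gives the constant (35/9) c^(2/3), which is the one claimed.

    The spectral theory behind this rests on ridge functions y |-> p(<w, y>)
    alone. Rotation invariance of the surface measure, which comes from
    the factorization of a plane rotation into three shears ([scales_rot]),
    shows that the integral of <w, y>^n depends only on |w|. Expanding
    <s x + z, y>^n in s then yields Green's formula for two ridge functions
    ([green]). The Chebyshev polynomials of the second kind U_n are eigenvectors
    of the spherical Laplacian acting on profiles p ([lap_cheb]), and Green's formula makes them orthogonal and
    reproducing ([bil_cheb]): (n + 1) / (2 pi^2) U_n(<x, y>) is the kernel of P_n.

    The weak gradient G of f is only tested against gradients of ridge functions.
    Let B be the gradient of the partial sum of f. Averaging the weak equation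
    against f gives <G, B> = sum L_n |P_n f|^2, Green's formula gives the same
    value to <B, B>, and <G - B, G - B> >= 0 is the spectral bound ([energy]).

    Completeness of the P_n ([psum_complete]) is reached from ridge polynomials
    through exponentials, which span an algebra. An iteration of polynomials
    converging to the sign function turns it into indicators of half-spaces, and
    Dynkin's theorem with simple functions covers all square-integrable
    functions. *)

(** * Maps that scale a measure *)

Section transport.
Context {R : realType}.
Local Open Scope ereal_scope.

(** The pushforward of mu by f is c mu. *)
Definition scales d (T : measurableType d) (mu : set T -> \bar R) (f : T -> T)
    (c : \bar R) :=
  measurable_fun setT f /\
  forall A, measurable A -> mu (f @^-1` A) = c * mu A.

Lemma scales_ext d (T : measurableType d) (mu : set T -> \bar R) f g c :
  f =1 g -> scales mu f c -> scales mu g c.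
Proof. by move=> /funext ->. Qed.

Lemma scales_id d (T : measurableType d) (mu : set T -> \bar R) :
  scales mu id 1.
Proof. by split=> // A mA; rewrite mul1e. Qed.

Lemma scales_comp d (T : measurableType d) (mu : set T -> \bar R) f g a b :
  scales mu f a -> scales mu g b -> scales mu (f \o g) (b * a).
Proof.
move=> [mf fE] [mg gE]; split; first exact: measurableT_comp.
move=> A mA; rewrite comp_preimage gE ?fE ?muleA//.
by rewrite -[X in measurable X]setTI; exact: mf.
Qed.

Lemma integral_scales d (T : measurableType d) (mu : {measure set T -> \bar R})
    f c (h : T -> \bar R) : (0 <= c)%E -> c \is a fin_num ->
  scales mu f c -> measurable_fun setT h -> (forall x, 0 <= h x) ->
  \int[mu]_x h (f x) = c * \int[mu]_x h x.
Proof.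
move=> c0 cfin [mf fE] mh h0.
have := @ge0_integral_pushforward _ _ _ _ R f mf mu setT h measurableT mh.
rewrite preimage_setT => <-; last by move=> y _; exact: h0.
have -> : c = (NngNum (fine_ge0 c0))%:num%:E by rewrite /= fineK.
rewrite -ge0_integral_mscale//.
apply: eq_measure_integral => A mA _.
by transitivity (mu (f @^-1` A)) => //; rewrite fE// -[in LHS](fineK cfin).
Qed.

(** Fubini: the inner section is transformed first, then the outer variable. *)
Lemma scales_prod d1 d2 (T1 : measurableType d1) (T2 : measurableType d2)
    (m1 : {measure set T1 -> \bar R})
    (m2 : {sigma_finite_measure set T2 -> \bar R}) f g a b :
  0 <= a -> a \is a fin_num -> 0 <= b -> b \is a fin_num ->
  scales m1 f a -> (forall x, scales m2 (g x) b) ->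
  measurable_fun setT (fun z : T1 * T2 => g z.1 z.2) ->
  scales (m1 \x m2) (fun z => (f z.1, g z.1 z.2)) (a * b).
Proof.
move=> a0 afin b0 bfin mf mg mgg.
have mF : measurable_fun setT (fun z : T1 * T2 => (f z.1, g z.1 z.2)).
  apply: measurable_fun_pair => //.
  by apply: measurableT_comp => //; case: mf.
split=> // A mA.
rewrite /product_measure1.
have -> : (fun x => (m2 \o xsection ((fun z : T1 * T2 => (f z.1, g z.1 z.2)) @^-1` A)) x)
  = (fun x => b * (m2 \o xsection A) (f x)).
  apply/funext => x /=; case: (mg x) => _ <-; last exact: measurable_xsection.
  congr (m2 _); apply/seteqP; split=> y /=; rewrite /xsection/= !inE//=.
have mx := measurable_fun_xsection m2 mA.
rewrite ge0_integralZl//=; last by apply: (measurableT_comp mx); case: mf.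
by rewrite (integral_scales a0 afin mf mx)// muleCA muleA.
Qed.

(** The two last factors are interchanged inside the iterated integral of an
    indicator, by Fubini for fixed first coordinate. *)
Lemma scales_swap d1 d2 (T1 : measurableType d1) (T2 : measurableType d2)
    (m1 : {sigma_finite_measure set T1 -> \bar R})
    (m2 : {sigma_finite_measure set T2 -> \bar R}) :
  scales (m1 \x m2 \x m2) (fun z : T1 * T2 * T2 => (z.1.1, z.2, z.1.2)) 1.
Proof.
set s := fun z => _.
have ms : measurable_fun setT s.
  apply: measurable_fun_pair.
    apply: measurable_fun_pair => //.
    by apply: measurableT_comp; [exact: measurable_fst|exact: measurable_fst].
  by apply: measurableT_comp; [exact: measurable_snd|exact: measurable_fst].
split=> // A mA; rewrite mul1e.
have msA : measurable (s @^-1` A) by rewrite -[X in measurable X]setTI; exact: ms.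
pose f t b c : \bar R := (\1_A (t, b, c))%:E.
have mf t : measurable_fun setT (fun z : T2 * T2 => f t z.1 z.2).
  apply/measurable_EFinP.
  have mtz : measurable_fun setT (fun z : T2 * T2 => (t, z.1, z.2)).
    by apply: measurable_fun_pair => //; apply: measurable_fun_pair.
  by apply: measurableT_comp mtz; exact: measurable_indic.
have secE (B : set (T1 * T2 * T2)) (mB : measurable B) :
    product_measure1 (m1 \x m2) m2 B = \int[m1]_t \int[m2]_b \int[m2]_c (\1_B (t, b, c))%:E.
  have mi : measurable_fun setT (fun z : T1 * T2 * T2 => (\1_B z : R)%:E).
    exact/measurable_EFinP.
  rewrite /product_measure1 -(indic_fubini_tonelli_FE m2 mB).
  rewrite (fubini_tonelli1 (m1 := m1) (m2 := m2))//.
    exact: (measurable_fun_fubini_tonelli_F (m2 := m2) _ mi).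
  by move=> tb; apply: integral_ge0 => c _; rewrite lee_fin.
apply: (eq_trans (secE _ msA)); apply: (eq_trans _ (esym (secE _ mA))).
apply: eq_integral => t _.
rewrite (fubini_tonelli (m1 := m2) (m2 := m2) (fun z => f t z.1 z.2))//=.
by move=> z; rewrite lee_fin.
Qed.

Definition image_measure d d' (T1 : measurableType d) (T2 : measurableType d')
    (m : {measure set T1 -> \bar R}) (f : T1 -> T2)
    (mf : measurable_fun setT f) : {measure set T2 -> \bar R} :=
  measure_function_pushforward__canonical__measure_function_Measure m mf.

Lemma scales_flip d (T : measurableType d)
    (m : {sigma_finite_measure set T -> \bar R}) :
  scales (m \x m) (fun z : T * T => (z.2, z.1)) 1.
Proof.
have ms : measurable_fun setT (fun z : T * T => (z.2, z.1)).
  by apply: measurable_fun_pair.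
split=> // A mA; rewrite mul1e; apply/esym.
apply: (product_measure_unique (m' := image_measure (m \x m) ms) _ mA).
move=> X Y mX mY; rewrite /= /pushforward.
have -> : (fun z : T * T => (z.2, z.1)) @^-1` (X `*` Y) = Y `*` X.
  by apply/seteqP; split=> z /= [].
by rewrite product_measure1E// muleC.
Qed.

Lemma scales_affine (r t : R) : (0 < r)%R ->
  scales (@lebesgue_measure R) (fun x => r * x + t)%R (r^-1)%:E.
Proof.
move=> r0.
have mf : measurable_fun setT (fun x : R => r * x + t)%R.
  by apply: measurable_funD => //; exact: measurable_funM.
split=> // A mA.
have r1 : (0 <= r)%R := ltW r0.
pose m : {measure set (measurableTypeR R) -> \bar R} :=
  mscale (NngNum r1) (image_measure (T1 := measurableTypeR R)
    (T2 := measurableTypeR R) (@lebesgue_measure R) mf).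
suff -> : lebesgue_measure A = m A.
  rewrite -[m A]/(r%:E * lebesgue_measure ((fun x : R => r * x + t)%R @^-1` A)).
  by rewrite muleA -EFinM mulVf ?gt_eqF// mul1e.
apply: (@lebesgue_measure_unique R m) => // _ [[a b] _ <-].
transitivity (r%:E * lebesgue_measure ((fun x : R => r * x + t)%R @^-1` `]a, b])) => //.
have -> : (fun x : R => r * x + t)%R @^-1` `]a, b] = `]((a - t) / r)%R, ((b - t) / r)%R]%classic.
  apply/seteqP; split=> x /=; rewrite !in_itv/= ltr_pdivrMr// ler_pdivlMr//;
  by rewrite ltrBlDr lerBrDr (mulrC x).
rewrite !lebesgue_measure_itv/= !lte_fin ltr_pM2r ?invr_gt0// ltrD2r.
case: ifPn => _; last by rewrite mule0.
by rewrite -!EFinD -EFinM; congr EFin; field; rewrite gt_eqF.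
Qed.

Lemma scales_shear d (T : measurableType d) (m : {measure set T -> \bar R})
    (phi : T -> R) : measurable_fun setT phi ->
  scales (m \x @lebesgue_measure R) (fun z => (z.1, z.2 + phi z.1)%R) 1.
Proof.
move=> mphi.
have := @scales_prod _ _ T _ m (@lebesgue_measure R) id
  (fun t x => x + phi t)%R 1 1.
rewrite mule1; apply => //; first exact: scales_id.
- move=> x; rewrite -[X in scales _ _ X]/(1%R%:E) -[X in X%:E]invr1.
  apply: scales_ext (scales_affine (phi x) ltr01) => y.
  by rewrite mul1r.
- by apply: measurable_funD => //; exact: measurableT_comp.
Qed.

(** A rotation by an angle t in a coordinate plane is a product of three shears,
    with slopes - tan (t/2), sin t and - tan (t/2). Shears along one axis suffice,
    since the swap of the two axes conjugates them to the others. The state is abstracted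
    as two readings pr1, pr2 and an update, so that the plane may sit anywhere in
    a product. *)
Lemma scales_rot d (T : measurableType d) (m : set T -> \bar R)
    (pr1 pr2 : T -> R) (upd : T -> R -> R -> T) (c s : R) :
  (forall z, upd z (pr1 z) (pr2 z) = z) ->
  (forall z a b, pr1 (upd z a b) = a) -> (forall z a b, pr2 (upd z a b) = b) ->
  (forall z a b a' b', upd (upd z a b) a' b' = upd z a' b') ->
  scales m (fun z => upd z (pr2 z) (pr1 z)) 1 ->
  (forall k, scales m (fun z => upd z (pr1 z) (pr2 z + k * pr1 z)) 1)%R ->
  (c ^+ 2 + s ^+ 2 = 1)%R -> (1 + c != 0)%R ->
  scales m (fun z => upd z (c * pr1 z - s * pr2 z) (s * pr1 z + c * pr2 z))%R 1.
Proof.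
move=> upd0 pr1E pr2E updE sw sh cs c1.
have sh' k : scales m (fun z => upd z (pr1 z + k * pr2 z)%R (pr2 z)) 1.
  have := scales_comp sw (scales_comp (sh k) sw); rewrite !mule1.
  by apply: scales_ext => z /=; rewrite !(updE, pr1E, pr2E).
(* s / (1 + c) is the tangent of half the angle *)
pose k := (- (s / (1 + c)))%R.
have := scales_comp (sh' k) (scales_comp (sh s) (sh' k)); rewrite !mule1.
apply: scales_ext => z /=; rewrite !(updE, pr1E, pr2E) {}/k.
set k := (s / (1 + c))%R.
have kc : (c = 1 - s * k)%R.
  rewrite /k mulrA; have -> : (s * s = (1 + c) * (1 - c))%R.
    by transitivity (1 - c ^+ 2)%R; [rewrite -[in RHS]cs|]; ring.
  by rewrite mulrAC mulfV// mul1r; ring.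
have ks : (s = 2 * k - k * k * s)%R.
  transitivity (k * (1 + c))%R; first by rewrite /k mulfVK.
  by rewrite {1}kc; ring.
congr upd.
- transitivity ((1 - s * k) * pr1 z - (2 * k - k * k * s) * pr2 z)%R; first ring.
  by rewrite -kc -ks.
- by rewrite [in RHS]kc; ring.
Qed.
End transport.

(** * Plane rotations of four-space *)

Section rotations.
Context {R : realType}.
Notation leb := (@lebesgue_measure R).
Implicit Types x : R4 R.

Definition rot01 (c s : R) x : R4 R :=
  (c * x.1.1.1 - s * x.1.1.2, s * x.1.1.1 + c * x.1.1.2, x.1.2, x.2).
Definition rot12 (c s : R) x : R4 R :=
  (x.1.1.1, c * x.1.1.2 - s * x.1.2, s * x.1.1.2 + c * x.1.2, x.2).
Definition rot23 (c s : R) x : R4 R :=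
  (x.1.1.1, x.1.1.2, c * x.1.2 - s * x.2, s * x.1.2 + c * x.2).

Lemma scales_prod_id d1 d2 (T1 : measurableType d1) (T2 : measurableType d2)
    (m1 : {measure set T1 -> \bar R})
    (m2 : {sigma_finite_measure set T2 -> \bar R}) f :
  scales m1 f 1%E -> scales (m1 \x m2)%E (fun z => (f z.1, z.2)) 1%E.
Proof.
move=> fE; rewrite -[X in scales _ _ X]mule1.
apply: (scales_prod (g := fun _ => id)) => //; rewrite ?lee_fin ?ler01//.
  by move=> _; exact: scales_id.
exact: measurable_snd.
Qed.

Section rot_last.
Context d (T : measurableType d) (m : {sigma_finite_measure set T -> \bar R}).

Lemma scales_rot_last (c s : R) : c ^+ 2 + s ^+ 2 = 1 -> 1 + c != 0 ->
  scales (m \x leb \x leb)%E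
    (fun z => (z.1.1, c * z.1.2 - s * z.2, s * z.1.2 + c * z.2)) 1%E.
Proof.
move=> cs c1.
apply: (@scales_rot R _ _ _ (fun z : T * R * R => z.1.2) (fun z => z.2)
  (fun z a b => (z.1.1, a, b))) => //; first by case=> -[].
- exact: (@scales_swap R _ _ T (measurableTypeR R) m leb).
- move=> k; apply: scales_ext (@scales_shear R _ _ (m \x leb)%E
    (fun z : T * R => k * z.2) _); first by case=> -[].
  exact: measurable_funM.
Qed.

End rot_last.

Lemma scales_rot_pair (c s : R) : c ^+ 2 + s ^+ 2 = 1 -> 1 + c != 0 ->
  scales (leb \x leb)%E
    (fun z => (c * z.1 - s * z.2, s * z.1 + c * z.2)) 1%E.
Proof.
move=> cs c1.
apply: (@scales_rot R _ _ _ (fun z : R * R => z.1) (fun z => z.2)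
  (fun z a b => (a, b))) => //; first by case.
- exact: (@scales_flip R _ (measurableTypeR R) leb).
- move=> k; apply: scales_ext (@scales_shear R _ _ leb
    (fun z : R => k * z) _); first by case.
  exact: measurable_funM.
Qed.

Lemma scales_rot01 c s : c ^+ 2 + s ^+ 2 = 1 -> 1 + c != 0 ->
  scales lebesgue4 (rot01 c s) 1%E.
Proof.
move=> cs c1; apply: (scales_prod_id leb (scales_prod_id leb (scales_rot_pair cs c1))).
Qed.

Lemma scales_rot12 c s : c ^+ 2 + s ^+ 2 = 1 -> 1 + c != 0 ->
  scales lebesgue4 (rot12 c s) 1%E.
Proof. by move=> cs c1; exact: (scales_prod_id leb (scales_rot_last leb cs c1)). Qed.

Definition lebesgue2 : set (measurableTypeR R * measurableTypeR R) -> \bar R := (leb \x leb)%E.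

HB.instance Definition _ := Measure.on lebesgue2.
HB.instance Definition _ := Measure_isSigmaFinite.Build _ _ _ lebesgue2
  (isSigmaFinite.sigma_finiteT (lebesgue_integral_fubini.measure_function_Measure_isSigmaFinite__to__measure_function_isSigmaFinite leb leb)).

Lemma scales_rot23 c s : c ^+ 2 + s ^+ 2 = 1 -> 1 + c != 0 ->
  scales lebesgue4 (rot23 c s) 1%E.
Proof.
move=> cs c1; apply: scales_ext (scales_rot_last lebesgue2 cs c1).
by case=> -[[]].
Qed.

(** What the cone construction of the surface measure sees of an orthogonal map. *)
Definition isometry_lin (f : R4 R -> R4 R) :=
  [/\ scales lebesgue4 f 1%E, forall a x, f (a *: x) = a *: f x &
      forall x, enorm (f x) = enorm x].

Lemma normsqE x : \sum_i coord x i ^+ 2 =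
  x.1.1.1 ^+ 2 + x.1.1.2 ^+ 2 + x.1.2 ^+ 2 + x.2 ^+ 2.
Proof. by rewrite !big_ord_recr big_ord0 /coord /= add0r. Qed.

Lemma scale4E (a : R) x :
  a *: x = (a * x.1.1.1, a * x.1.1.2, a * x.1.2, a * x.2).
Proof. by case: x => -[[]]. Qed.

Lemma isometry_rot01 c s : c ^+ 2 + s ^+ 2 = 1 -> 1 + c != 0 ->
  isometry_lin (rot01 c s).
Proof.
move=> cs c1; split; first exact: scales_rot01.
  by move=> a x; rewrite !scale4E /rot01 /=; congr (_, _, _, _); ring.
move=> x; rewrite /enorm !normsqE /rot01 /=; congr Num.sqrt.
transitivity ((c ^+ 2 + s ^+ 2) * (x.1.1.1 ^+ 2 + x.1.1.2 ^+ 2) + x.1.2 ^+ 2 + x.2 ^+ 2); first ring.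
by rewrite cs; ring.
Qed.

Lemma isometry_rot12 c s : c ^+ 2 + s ^+ 2 = 1 -> 1 + c != 0 ->
  isometry_lin (rot12 c s).
Proof.
move=> cs c1; split; first exact: scales_rot12.
  by move=> a x; rewrite !scale4E /rot12 /=; congr (_, _, _, _); ring.
move=> x; rewrite /enorm !normsqE /rot12 /=; congr Num.sqrt.
transitivity ((c ^+ 2 + s ^+ 2) * (x.1.1.2 ^+ 2 + x.1.2 ^+ 2) + x.1.1.1 ^+ 2 + x.2 ^+ 2); first ring.
by rewrite cs; ring.
Qed.

Lemma isometry_rot23 c s : c ^+ 2 + s ^+ 2 = 1 -> 1 + c != 0 ->
  isometry_lin (rot23 c s).
Proof.
move=> cs c1; split; first exact: scales_rot23.
  by move=> a x; rewrite !scale4E /rot23 /=; congr (_, _, _, _); ring.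
move=> x; rewrite /enorm !normsqE /rot23 /=; congr Num.sqrt.
transitivity ((c ^+ 2 + s ^+ 2) * (x.1.2 ^+ 2 + x.2 ^+ 2) + x.1.1.1 ^+ 2 + x.1.1.2 ^+ 2); first ring.
by rewrite cs; ring.
Qed.

Lemma isometry_scales f : isometry_lin f -> scales (surface R) f 1%E.
Proof.
move=> [[mf fE] flin fn]; split=> // A mA; rewrite mul1e /surface; congr (_ * _)%E.
transitivity (lebesgue4 (f @^-1` [set x | [/\ 0 < enorm x, enorm x <= 1 & A (normalize x)]])).
  by congr lebesgue4; apply/seteqP; split=> x /=; rewrite /normalize flin fn.
by rewrite fE ?mul1e//; exact: measurable_cone.
Qed.

Lemma scales_homothety (r : R) : 0 < r ->
  scales lebesgue4 (fun x => r *: x) (r ^- 4)%:E.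
Proof.
move=> r0.
have r1 : 0 <= r^-1 by rewrite invr_ge0 ltW.
have s1 : scales leb (fun y : R => r * y) (r^-1)%:E.
  by apply: scales_ext (scales_affine 0 r0) => y; rewrite addr0.
have step d (T : measurableType d) (m : {measure set T -> \bar R}) f (a : R) :
    0 <= a -> scales m f a%:E ->
    scales (m \x leb)%E (fun z => (f z.1, r * z.2)) (a * r^-1)%:E.
  move=> a0 fa.
  rewrite EFinM.
  apply: (@scales_prod R _ _ T (measurableTypeR R) m leb f (fun _ (y : R) => r * y)) => //.
  exact: measurable_funM.
have r2 := mulr_ge0 r1 r1; have r3 := mulr_ge0 r2 r1.
have := step _ _ _ _ _ r3 (step _ _ _ _ _ r2 (step _ _ _ _ _ r1 s1)).
have -> : r^-1 * r^-1 * r^-1 * r^-1 = r ^- 4 by rewrite -!exprVn; ring.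
by apply: scales_ext => x; rewrite scale4E.
Qed.

End rotations.

(** * The area of the unit sphere *)

Section mass.
Context {R : realType}.
Notation leb := (@lebesgue_measure R).
Implicit Types x : R4 R.

Definition lebesgue3 : set (measurableTypeR R * measurableTypeR R * measurableTypeR R) -> \bar R :=
  (lebesgue2 \x leb)%E.

HB.instance Definition _ := Measure.on lebesgue3.
HB.instance Definition _ := Measure_isSigmaFinite.Build _ _ _ lebesgue3
  (isSigmaFinite.sigma_finiteT (lebesgue_integral_fubini.measure_function_Measure_isSigmaFinite__to__measure_function_isSigmaFinite (@lebesgue2 R) leb)).
HB.instance Definition _ := Measure_isSigmaFinite.Build _ _ _ (@lebesgue4 R)
  (isSigmaFinite.sigma_finiteT (lebesgue_integral_fubini.measure_function_Measure_isSigmaFinite__to__measure_function_isSigmaFinite lebesgue3 leb)).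

Lemma integral_prod_gauss d (T : measurableType d)
    (m : {sigma_finite_measure set T -> \bar R}) (f : T -> R) :
  measurable_fun setT f -> (forall t, 0 <= f t) ->
  (\int[(m \x leb)%E]_z (f z.1 * gauss_fun z.2)%:E =
   \int[m]_t (f t)%:E * (Num.sqrt pi)%:E)%E.
Proof.
move=> mf f0.
have gm := @measurable_gauss_fun R.
rewrite (fubini_tonelli1 (m1 := m) (m2 := leb)); last 2 first.
- apply/measurable_EFinP; apply: measurable_funM.
    exact: measurableT_comp.
  exact: measurableT_comp.
- by move=> z; rewrite lee_fin mulr_ge0// gauss_fun_ge0.
rewrite -ge0_integralZr//; last 2 first.
- exact/measurable_EFinP.
- by move=> t _; rewrite lee_fin.
apply: eq_integral => t _ /=; rewrite /fubini_F /=.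
under eq_integral do rewrite EFinM.
rewrite ge0_integralZl//; last 3 first.
- exact/measurable_EFinP.
- by move=> y _; rewrite lee_fin gauss_fun_ge0.
- by rewrite lee_fin.
by rewrite integralT_gauss.
Qed.

Definition normsq x : R := \sum_i coord x i ^+ 2.

Lemma integral_gauss4 :
  (\int[lebesgue4]_x (expR (- normsq x))%:E = (pi ^+ 2)%:E :> \bar R)%E.
Proof.
have gm := @measurable_gauss_fun R.
have g0 := @gauss_fun_ge0 R.
transitivity (\int[lebesgue4]_x (gauss_fun x.1.1.1 * gauss_fun x.1.1.2 *
   gauss_fun x.1.2 * gauss_fun x.2)%:E : \bar R)%E.
  by apply: eq_integral => x _; rewrite /normsq normsqE !opprD !expRD.
have m1 : measurable_fun setT (fun z : measurableTypeR R * measurableTypeR R => gauss_fun z.1 * gauss_fun z.2).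
  by apply: measurable_funM; exact: measurableT_comp.
have m2 : measurable_fun setT (fun z : measurableTypeR R * measurableTypeR R * measurableTypeR R => gauss_fun z.1.1 * gauss_fun z.1.2 * gauss_fun z.2).
  apply: measurable_funM; last exact: measurableT_comp.
  exact: (measurableT_comp m1).
have E1 := integral_prod_gauss leb gm g0.
have E2 := integral_prod_gauss lebesgue2 m1 _.
have E3 := integral_prod_gauss lebesgue3 m2 _.
apply: (eq_trans (E3 _)) => [z|]; first by rewrite !mulr_ge0.
apply: (eq_trans (congr1 (fun a => a * _)%E (eq_trans (E2 _) (congr1 (fun a => a * _)%E E1)))).
  by move=> z; rewrite !mulr_ge0.
rewrite integralT_gauss -!EFinM; congr EFin.
have E : Num.sqrt pi ^+ 2 = pi :> R by rewrite sqr_sqrtr// pi_ge0.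
by rewrite -[in RHS]E; ring.
Qed.

Lemma integral_tail_expRN (a : R) :
  (\int[leb]_(s in `[a, +oo[) (expR (- s))%:E = (expR (- a))%:E)%E.
Proof.
rewrite (@ge0_continuous_FTC2y _ _ (fun x : R => - expR (- x)) _ 0).
- by rewrite -EFinB opprK add0r.
- by move=> x _; exact: expR_ge0.
- apply: continuous_subspaceT => x.
  by apply: continuous_comp; [exact: opp_continuous|exact: continuous_expR].
- by rewrite -[X in _ --> X]oppr0; apply: cvgN; exact: cvgr_expR.
- by move=> x _; exact: ex_derive.
- apply: cvg_at_right_filter; apply: cvgN; apply: continuous_comp.
    exact: opp_continuous.
  exact: continuous_expR.
- move=> x _.
  rewrite derive1E derive_val; by rewrite mulrN1 opprK.
Qed.

(** By the antiderivative - (x^2 + 2 x + 2) exp (- x). *)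
Lemma integral_sqr_expRN :
  (\int[leb]_(s in `[0%R, +oo[) (s ^+ 2 * expR (- s))%:E = 2%:E)%E.
Proof.
rewrite (@ge0_continuous_FTC2y _ _ (fun x : R => - (x ^+ 2 + 2 * x + 2) * expR (- x)) _ 0).
- by rewrite -EFinB oppr0 expR0; congr EFin; ring.
- by move=> x _; rewrite mulr_ge0 ?sqr_ge0 ?expR_ge0.
- apply: continuous_subspaceT => x.
  apply: cvgM; first exact: exprn_continuous.
  by apply: continuous_comp; [exact: opp_continuous|exact: continuous_expR].
(* the square of 1 + x / 4 <= exp (x / 4) absorbs the quadratic factor *)
- apply: (@squeeze_cvgr _ _ _ _ (fun x : R => - (16 * expR (- (x * 2^-1)))) (fun=> 0)).
  + near=> x.
    have x0 : 0 <= x by near: x; exact: nbhs_pinfty_ge.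
    have e0 := expR_ge0 (- x).
    have h := expR_ge1Dx (x / 4).
    have e4 : expR (x / 4) ^+ 2 * expR (- x) = expR (- (x * 2^-1)).
      by rewrite -expRM_natl -expRD; congr expR; field.
    rewrite -e4 mulNr lerN2 oppr_le0 mulrA; apply/andP; split.
      rewrite ler_wpM2r//.
      have : (1 + x / 4) ^+ 2 <= expR (x / 4) ^+ 2.
        by rewrite lerXn2r// nnegrE ?expR_ge0//; lra.
      nra.
    by rewrite mulr_ge0//; nra.
  + rewrite -[X in _ --> X]oppr0 -[X in _ --> - X](mulr0 16).
    apply: cvgN; apply: cvgMr.
    apply: (@cvg_comp _ _ _ (fun x : R => x * 2^-1) (fun y : R => expR (- y)) _ (pinfty_nbhs R)).
      exact: gt0_cvgMly.
    exact: cvgr_expR.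
  + exact: cvg_cst.
- by move=> x _; exact: ex_derive.
- apply: cvg_at_right_filter.
  apply: cvgM.
    apply: cvgN; apply: cvgD; last exact: cvg_cst.
    apply: cvgD; first exact: exprn_continuous.
    by apply: cvgM; [exact: cvg_cst|exact: cvg_id].
  by apply: continuous_comp; [exact: opp_continuous|exact: continuous_expR].
- move=> x _.
  rewrite derive1E derive_val /=.
  by rewrite /GRing.scale /=; ring.
Unshelve. all: by end_near. Qed.

Definition cball (r : R) : set (R4 R) := [set x | enorm x <= r].

Lemma measurable_cball r : measurable (cball r).
Proof.
rewrite (_ : cball r = enorm @^-1` `]-oo, r]).
  by rewrite -[X in measurable X]setTI; exact: measurable_enorm.
by apply/seteqP; split=> x /=; rewrite in_itv/=.
Qed.

Lemma normsq_ge0 x : 0 <= normsq x.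
Proof. by apply: sumr_ge0 => i _; exact: sqr_ge0. Qed.

Lemma enorm_sqr x : enorm x ^+ 2 = normsq x.
Proof. by rewrite sqr_sqrtr// normsq_ge0. Qed.

Lemma enorm_ge0 x : 0 <= enorm x. Proof. exact: sqrtr_ge0. Qed.

Lemma normsqZ (a : R) x : normsq (a *: x) = a ^+ 2 * normsq x.
Proof. by rewrite /normsq !normsqE scale4E /=; ring. Qed.

Lemma enormZ (a : R) x : enorm (a *: x) = `|a| * enorm x.
Proof.
by rewrite /enorm -/(normsq _) normsqZ sqrtrM ?sqr_ge0// sqrtr_sqr.
Qed.

Lemma enorm_eq0 x : (enorm x == 0) = (x == 0).
Proof.
rewrite -sqrf_eq0 enorm_sqr /normsq normsqE.
case: x => -[[a b] c] d /=; rewrite !paddr_eq0 ?addr_ge0 ?sqr_ge0// !sqrf_eq0.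
by rewrite -!pair_eqE /= /pair_eq /=.
Qed.

Lemma enorm_gt0 x : (0 < enorm x) = (x != 0).
Proof. by rewrite lt_neqAle enorm_ge0 andbT eq_sym enorm_eq0. Qed.

Lemma cball0 : cball 0 = [set 0].
Proof.
apply/seteqP; split=> x /=; rewrite /cball/=.
  by rewrite le_eqVlt ltNge enorm_ge0 orbF enorm_eq0 => /eqP.
by move=> ->; rewrite le_eqVlt enorm_eq0 eqxx.
Qed.

Lemma lebesgue4_set0 : lebesgue4 [set 0 : R4 R] = 0%E :> \bar R.
Proof.
have -> : [set 0 : R4 R] = [set 0 : R * R * R] `*` [set 0 : R].
  apply/seteqP; split=> -[x y]/=; first by case=> -> ->.
  by case=> -> ->.
have m3 : measurable ([set 0] : set (R * R * R)).
  have -> : [set 0 : R * R * R] = [set 0 : R] `*` [set 0 : R] `*` [set 0 : R].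
    apply/seteqP; split=> -[[x y] z]/=; first by case=> -> -> ->.
    by case=> -[-> ->] ->.
  by apply: measurableX => //; exact: measurableX.
have := @product_measure1E _ _ _ _ R lebesgue3 leb _ _ m3 (measurable_set1 (0 : R)).
move=> E; apply: (eq_trans E).
apply: (eq_trans (congr1 (fun a => _ * a)%E (lebesgue_measure_set1 (0 : R)))).
by rewrite mule0.
Qed.

Lemma lebesgue4_cball r : 0 < r ->
  lebesgue4 (cball r) = ((r ^+ 4)%:E * lebesgue4 (cball 1))%E.
Proof.
move=> r0; have [_ /(_ _ (measurable_cball r))] := scales_homothety r0.
rewrite (_ : _ @^-1` _ = cball 1) => [->|].
  by rewrite muleA -EFinM mulfV ?mul1e// expf_eq0/= gt_eqF.
by apply/seteqP; split=> x /=; rewrite /cball/= enormZ gtr0_norm// ger_pMr.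
Qed.

Lemma measurable_normsq : measurable_fun setT normsq.
Proof.
rewrite (_ : normsq = fun x => enorm x ^+ 2); last by apply/funext => x; rewrite enorm_sqr.
by apply: measurable_funX; exact: measurable_enorm.
Qed.

(** Layer cake: the two iterated integrals of exp (- s) over the region
    |x|^2 <= s are the Gaussian integral and the volume of the unit ball times
    the integral of s^2 exp (- s). *)
Lemma lebesgue4_cball1 : lebesgue4 (cball 1) = (pi ^+ 2 / 2)%:E :> \bar R.
Proof.
pose E : set (R4 R * R) := [set z | normsq z.1 <= z.2].
have mE : measurable E.
  rewrite (_ : E = ((fun z : R4 R * R => z.2 - normsq z.1) @^-1` `[0, +oo[)).
    rewrite -[X in measurable X]setTI.
    have : measurable_fun setT (fun z : R4 R * R => z.2 - normsq z.1).
      apply: measurable_funB => //.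
      by apply: measurableT_comp => //; exact: measurable_normsq.
    exact.
  by apply/seteqP; split=> z /=; rewrite !in_itv/= !andbT subr_ge0.
pose f (z : R4 R * R) : \bar R := (\1_E z * expR (- z.2))%:E.
have mf : measurable_fun setT f.
  apply/measurable_EFinP; apply: measurable_funM => //.
  by do 2 apply: measurableT_comp => //.
have f0 z : (0 <= f z)%E by rewrite lee_fin mulr_ge0// expR_ge0.
have := fubini_tonelli (m1 := @lebesgue4 R) (m2 := leb) f mf f0.
transitivity (2^-1%:E * \int[leb]_s \int[lebesgue4]_x f (x, s))%E.
  transitivity (2^-1%:E * \int[leb]_(s in `[0%R, +oo[) ((s ^+ 2 * expR (- s))%:E * lebesgue4 (cball 1)))%E.
    rewrite ge0_integralZr//.
    - by rewrite integral_sqr_expRN muleA -EFinM mulVf// mul1e.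
    - apply: measurable_funTS; apply/measurable_EFinP; apply: measurable_funM => //.
      by apply: measurableT_comp => //.
    - by move=> s _; rewrite lee_fin mulr_ge0 ?expR_ge0// sqr_ge0.
  congr (_ * _)%E; rewrite integral_mkcond; apply: eq_integral => s _.
  rewrite patchE; case: ifPn => [|/negP]; rewrite inE/= in_itv/= andbT => s0; last first.
    rewrite integral0_eq// => x _; rewrite /f indicE memNset ?mul0r// /E/=.
    by move=> xs; apply: s0; exact: le_trans (normsq_ge0 x) xs.
  transitivity (\int[lebesgue4]_x ((expR (- s))%:E * (\1_(cball (Num.sqrt s)) x)%:E))%E; last first.
    apply: eq_integral => x _; rewrite /f /= EFinM muleC; congr (_%:E * _)%E.
    have EE : ((x, s) \in E) = (x \in cball (Num.sqrt s)).
      by apply/idP/idP; rewrite !inE /E /cball/= -enorm_sqr;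
        rewrite -[X in _ ^+ 2 <= X](sqr_sqrtr s0) ler_sqr// nnegrE ?sqrtr_ge0 ?enorm_ge0.
    by rewrite !indicE EE.
  rewrite ge0_integralZl//; last first.
    by apply/measurable_EFinP; apply: measurable_indic; exact: measurable_cball.
  rewrite integral_indic//; last exact: measurable_cball.
  rewrite setIT mulrC EFinM -muleA; congr (_ * _)%E.
  have [->|s1] := eqVneq s 0.
    rewrite expr2 mul0r mul0e sqrtr0.
    exact/esym/(eq_trans (congr1 lebesgue4 cball0) lebesgue4_set0).
  have s2 : 0 < Num.sqrt s by rewrite sqrtr_gt0 lt_neqAle eq_sym s1.
  apply: (eq_trans _ (esym (lebesgue4_cball s2))); congr (_%:E * _)%E.
  by rewrite -[in LHS](sqr_sqrtr s0) -exprM.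
rewrite -H mulrC EFinM; congr (_ * _)%E.
rewrite -integral_gauss4; apply: eq_integral => x _.
rewrite -integral_tail_expRN [RHS]integral_mkcond; apply: eq_integral => s _.
rewrite patchE /f indicE /=.
have -> : (s \in `[normsq x, +oo[%classic) = ((x, s) \in E).
  by apply/idP/idP; rewrite !inE /E/= in_itv/= andbT.
by case: ifP => _; rewrite ?mul1r ?mul0r.
Qed.

Lemma measurable_SU2 : measurable (SU2 R).
Proof.
have -> : SU2 R = enorm @^-1` [set 1] by [].
by rewrite -[X in measurable X]setTI; apply: measurable_enorm.
Qed.

Lemma enorm_normalize x : x != 0 -> enorm (normalize x) = 1.
Proof.
move=> x0; rewrite /normalize enormZ ger0_norm ?invr_ge0 ?enorm_ge0//.
by rewrite mulVf// enorm_eq0.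
Qed.

Lemma surface_SU2 : surface R (SU2 R) = (2 * pi ^+ 2)%:E.
Proof.
rewrite /surface.
have -> : [set x | [/\ 0 < enorm x, enorm x <= 1 & SU2 R (normalize x)]] = cball 1 `\ 0.
  apply/seteqP; split=> x /=; rewrite /cball/= enorm_gt0.
    by case=> /eqP.
  by case=> x1 /eqP x0; split=> //; exact: enorm_normalize.
transitivity (4%:E * lebesgue4 (cball 1) : \bar R)%E; last first.
  by rewrite lebesgue4_cball1 -EFinM; congr EFin; field.
congr (_ * _)%E; apply/esym.
have m0 : measurable ([set 0] : set (R4 R)).
  by rewrite -cball0; exact: measurable_cball.
have {1}-> : cball 1 = (cball 1 `\ 0) `|` [set 0].
  rewrite setUC setDUK// => x ->; rewrite /cball/=.
  by have /eqP -> : enorm (0 : R4 R) == 0; rewrite ?enorm_eq0.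
apply: measureU0 => //; last exact: lebesgue4_set0.
by apply: measurableD => //; exact: measurable_cball.
Qed.

End mass.

(** * Square-integrable functions on the sphere *)

Section sphere_L2.
Context {R : realType}.
Notation S3 := (SU2 R).
Notation sigma := (surface R).
Implicit Types (f g u v : R4 R -> R) (K H : R4 R -> R4 R -> R).

Definition sphere_sqint f := measurable_fun S3 f /\
  (\int[sigma]_(x in S3) (f x ^+ 2)%:E < +oo)%E.

Definition sphere_bounded f := measurable_fun S3 f /\
  exists C, forall x, S3 x -> `|f x| <= C.

Definition ip f g : R := \int[sigma]_(x in S3) (f x * g x).

Let mS3 : measurable S3 := measurable_SU2.

Lemma eq_measurable_S3 f g : (forall x, S3 x -> f x = g x) ->
  measurable_fun S3 f -> measurable_fun S3 g.
Proof. by move=> fg; apply: eq_measurable_fun => x /set_mem /fg. Qed.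

Lemma surface_fin : (sigma S3 < +oo)%E.
Proof. by rewrite surface_SU2 ltry. Qed.

Lemma sphere_bounded_integrable f : sphere_bounded f ->
  sigma.-integrable S3 (EFin \o f).
Proof.
move=> [mf [C fC]]; apply: measurable_bounded_integrable => //.
  exact: surface_fin.
by exists `|C|; split; [exact: normr_real|] => M CM x Sx /=;
  apply: (le_trans (fC x Sx)); apply: le_trans (ltW CM); exact: ler_norm.
Qed.

Lemma sphere_boundedM f g : sphere_bounded f -> sphere_bounded g ->
  sphere_bounded (fun x => f x * g x).
Proof.
move=> [mf [C fC]] [mg [D gD]]; split; first exact: measurable_funM.
exists (C * D) => x Sx; rewrite normrM ler_pM//; [exact: fC|exact: gD].
Qed.

Lemma sphere_boundedD f g : sphere_bounded f -> sphere_bounded g ->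
  sphere_bounded (fun x => f x + g x).
Proof.
move=> [mf [C fC]] [mg [D gD]]; split; first exact: measurable_funD.
exists (C + D) => x Sx; rewrite (le_trans (ler_normD _ _))// lerD//; [exact: fC|exact: gD].
Qed.

Lemma sphere_bounded_cst (c : R) : sphere_bounded (fun=> c).
Proof. by split => //; exists `|c|. Qed.

Lemma sphere_boundedZ (c : R) f : sphere_bounded f ->
  sphere_bounded (fun x => c * f x).
Proof. by move=> bf; apply: sphere_boundedM => //; exact: sphere_bounded_cst. Qed.

Lemma sphere_bounded_sum (I : Type) (r : seq I) (P : pred I) (F : I -> R4 R -> R) :
  (forall i, P i -> sphere_bounded (F i)) ->
  sphere_bounded (fun x => \sum_(i <- r | P i) F i x).
Proof.
move=> bF; elim: r => [|i r IH].
  by under eq_fun do rewrite big_nil; exact: sphere_bounded_cst.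
have [Pi|/negbTE Pi] := boolP (P i); under eq_fun do rewrite big_cons Pi; last by [].
by apply: sphere_boundedD => //; exact: bF.
Qed.

Lemma sphere_bounded_ext f g : (forall x, S3 x -> f x = g x) ->
  sphere_bounded f -> sphere_bounded g.
Proof.
move=> fg [mf [C fC]]; split; first exact: eq_measurable_S3 mf.
by exists C => x Sx; rewrite -fg//; exact: fC.
Qed.

Lemma sphere_bounded_coord i : sphere_bounded (coord ^~ i).
Proof.
split; first by apply: measurable_funTS; exact: measurable_coord.
exists 1 => x /= Sx.
rewrite -(@ler_pXn2r _ 2)// ?nnegrE// expr1n real_normK ?num_real//.
have <- : normsq x = 1 by rewrite -enorm_sqr Sx expr1n.
by rewrite /normsq (bigD1 i)//= lerDl sumr_ge0// => j _; rewrite sqr_ge0.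
Qed.

Lemma sphere_bounded_sqint f : sphere_bounded f -> sphere_sqint f.
Proof.
move=> bf; split; first by case: bf.
have /sphere_bounded_integrable/integrableP[_] := sphere_boundedM bf bf.
by under eq_integral do rewrite /= ger0_norm -expr2 ?sqr_ge0//.
Qed.

Lemma sphere_sqint_ext f g : (forall x, S3 x -> f x = g x) ->
  sphere_sqint f -> sphere_sqint g.
Proof.
move=> fg [mf f2]; split; first exact: eq_measurable_S3 mf.
by rewrite (eq_integral (fun x => (f x ^+ 2)%:E))// => x /set_mem Sx; rewrite fg.
Qed.

Lemma sphere_sqint_integrable f g : sphere_sqint f -> sphere_sqint g ->
  sigma.-integrable S3 (EFin \o (fun x => f x * g x)).
Proof.
have sq h : sphere_sqint h -> sigma.-integrable S3 (EFin \o (fun x => h x ^+ 2)).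
  move=> [mh h2]; apply/integrableP; split.
    by apply/measurable_EFinP; exact: measurable_funX.
  by under eq_integral do rewrite /= ger0_norm ?sqr_ge0//.
move=> sf sg.
apply: (@le_integrable _ _ _ sigma _ mS3 _ ((EFin \o (fun x => f x ^+ 2)%R) \+ (EFin \o (fun x => g x ^+ 2)%R))%E).
- apply/measurable_EFinP; case: sf sg => mf _ [mg _]; exact: measurable_funM.
- move=> x _ /=; rewrite lee_fin [X in _ <= X]ger0_norm ?addr_ge0 ?sqr_ge0//.
  move: (f x) (g x) => a b; rewrite ler_norml.
  by apply/andP; split; [have := sqr_ge0 (a + b)|have := sqr_ge0 (a - b)]; nra.
- by apply: integrableD => //; exact: sq.
Qed.

Lemma sphere_sqintP f : sphere_sqint f <->
  measurable_fun S3 f /\ sigma.-integrable S3 (EFin \o (fun x => f x * f x)).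
Proof.
split=> [sf|[mf /integrableP[_]]].
  by split; [case: sf|exact: sphere_sqint_integrable].
move=> f2; split=> //; apply: le_lt_trans f2.
by rewrite le_eqVlt; apply/orP; left; apply/eqP; apply: eq_integral => x _ /=; rewrite ger0_norm -expr2 ?sqr_ge0//.
Qed.

Lemma sphere_sqintZ (c : R) f : sphere_sqint f -> sphere_sqint (fun x => c * f x).
Proof.
move=> /sphere_sqintP[mf f2]; apply/sphere_sqintP; split.
  exact: measurable_funM.
rewrite (_ : _ \o _ = fun x => ((c ^+ 2)%:E * (EFin \o (fun x => f x * f x)%R) x)%E).
  exact: integrableZl.
by apply/funext => x /=; rewrite -EFinM; congr EFin; ring.
Qed.

Lemma sphere_sqintD f g : sphere_sqint f -> sphere_sqint g ->
  sphere_sqint (fun x => f x + g x).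
Proof.
move=> sf sg; apply/sphere_sqintP; split.
  by case: sf sg => mf _ [mg _]; exact: measurable_funD.
have ff := sphere_sqint_integrable sf sf.
have fg := sphere_sqint_integrable sf sg.
have gg := sphere_sqint_integrable sg sg.
rewrite (_ : _ \o _ = (((EFin \o (fun x => f x * f x)%R) \+ (EFin \o (fun x => f x * g x)%R)) \+ ((EFin \o (fun x => f x * g x)%R) \+ (EFin \o (fun x => g x * g x)%R)))%E).
  by apply: integrableD => //; exact: integrableD.
by apply/funext => x /=; rewrite -!EFinD; congr EFin; ring.
Qed.

Lemma sphere_sqintB f g : sphere_sqint f -> sphere_sqint g ->
  sphere_sqint (fun x => f x - g x).
Proof.
move=> sf sg.
have := sphere_sqintD sf (sphere_sqintZ (-1) sg).
by apply: sphere_sqint_ext => x _; rewrite mulN1r.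
Qed.

Lemma sphere_sqint_sum (I : Type) (r : seq I) (P : pred I) (F : I -> R4 R -> R) :
  (forall i, P i -> sphere_sqint (F i)) ->
  sphere_sqint (fun x => \sum_(i <- r | P i) F i x).
Proof.
move=> bF; elim: r => [|i r IH].
  by under eq_fun do rewrite big_nil; exact/sphere_bounded_sqint/sphere_bounded_cst.
have [Pi|/negbTE Pi] := boolP (P i); under eq_fun do rewrite big_cons Pi; last by [].
by apply: sphere_sqintD => //; exact: bF.
Qed.

Lemma ipC f g : ip f g = ip g f.
Proof. by apply: eq_Rintegral => x _; rewrite mulrC. Qed.

Lemma eq_ip f g f' g' : (forall x, S3 x -> f x = f' x) ->
  (forall x, S3 x -> g x = g' x) -> ip f g = ip f' g'.
Proof. by move=> ff gg; apply: eq_Rintegral => x /set_mem Sx; rewrite ff ?gg. Qed.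

Lemma ipDl f g h : sphere_sqint f -> sphere_sqint g -> sphere_sqint h ->
  ip (fun x => f x + g x) h = ip f h + ip g h.
Proof.
move=> sf sg sh; rewrite /ip -RintegralD//; try exact: sphere_sqint_integrable.
by apply: eq_Rintegral => x _; rewrite mulrDl.
Qed.

Lemma ipZl (c : R) f h : sphere_sqint f -> sphere_sqint h ->
  ip (fun x => c * f x) h = c * ip f h.
Proof.
move=> sf sh; rewrite /ip -RintegralZl//; try exact: sphere_sqint_integrable.
by apply: eq_Rintegral => x _; rewrite mulrA.
Qed.

Lemma ipDr f g h : sphere_sqint f -> sphere_sqint g -> sphere_sqint h ->
  ip h (fun x => f x + g x) = ip h f + ip h g.
Proof. by move=> sf sg sh; rewrite ipC ipDl// !(ipC h). Qed.

Lemma ipZr (c : R) f h : sphere_sqint f -> sphere_sqint h ->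
  ip h (fun x => c * f x) = c * ip h f.
Proof. by move=> sf sh; rewrite ipC ipZl// ipC. Qed.

Lemma ip0l h : ip (fun=> 0) h = 0.
Proof.
rewrite /ip; under eq_Rintegral do rewrite mul0r.
by rewrite Rintegral_cst// mul0r.
Qed.

Lemma ip_suml (I : Type) (r : seq I) (P : pred I) (F : I -> R4 R -> R) h :
  (forall i, P i -> sphere_sqint (F i)) -> sphere_sqint h ->
  ip (fun x => \sum_(i <- r | P i) F i x) h = \sum_(i <- r | P i) ip (F i) h.
Proof.
move=> sF sh; elim: r => [|i r IH].
  by under eq_fun do rewrite big_nil; rewrite big_nil ip0l.
have [Pi|/negbTE Pi] := boolP (P i); under eq_fun do rewrite big_cons Pi;
  rewrite big_cons Pi; last by [].
by rewrite ipDl ?IH//; [exact: sF|exact: sphere_sqint_sum].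
Qed.

Lemma ip_sumr (I : Type) (r : seq I) (P : pred I) (F : I -> R4 R -> R) h :
  (forall i, P i -> sphere_sqint (F i)) -> sphere_sqint h ->
  ip h (fun x => \sum_(i <- r | P i) F i x) = \sum_(i <- r | P i) ip h (F i).
Proof. by move=> sF sh; rewrite ipC ip_suml//; apply: eq_bigr => i _; rewrite ipC. Qed.

Lemma ip_ge0 f : 0 <= ip f f.
Proof. by apply: Rintegral_ge0 => x _; rewrite -expr2 sqr_ge0. Qed.

Lemma ip_sqrB f g : sphere_sqint f -> sphere_sqint g ->
  ip (fun x => f x - g x) (fun x => f x - g x) = ip f f - 2 * ip f g + ip g g.
Proof.
move=> sf sg.
have sNg : sphere_sqint (fun x => -1 * g x) by exact: sphere_sqintZ.
have -> : (fun x => f x - g x) = (fun x => f x + -1 * g x).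
  by apply/funext => x; rewrite mulN1r.
rewrite ipDl// ?ipDr//; try exact: sphere_sqintD.
by rewrite !ipZl// !ipZr// (ipC g f); ring.
Qed.

(** Finite-rank kernels: for these the order of integration may be exchanged by
    linearity alone. *)
Inductive separable : (R4 R -> R4 R -> R) -> Prop :=
| separable_prod f g : sphere_bounded f -> sphere_bounded g ->
    separable (fun x y => f x * g y)
| separableD K H : separable K -> separable H ->
    separable (fun x y => K x y + H x y)
| separable_ext K H : (forall x y, S3 x -> S3 y -> K x y = H x y) ->
    separable K -> separable H.

Lemma separableM K H : separable K -> separable H ->
  separable (fun x y => K x y * H x y).
Proof.
move=> sK; elim: sK H => [f g bf bg|K1 K2 _ IH1 _ IH2|K1 K2 K12 _ IH] H sH.
- elim: sH => [f' g' bf' bg'|H1 H2 _ IH1 _ IH2|H1 H2 H12 _ IH].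
  + apply: separable_ext (separable_prod (sphere_boundedM bf bf') (sphere_boundedM bg bg')) => x y _ _.
    by ring.
  + by apply: separable_ext (separableD IH1 IH2) => x y _ _; ring.
  + by apply: separable_ext IH => x y Sx Sy; rewrite H12.
- apply: separable_ext (separableD (IH1 _ sH) (IH2 _ sH)) => x y _ _; ring.
- by apply: separable_ext (IH _ sH) => x y Sx Sy; rewrite K12.
Qed.

Lemma separable_cst (c : R) : separable (fun _ _ => c).
Proof.
apply: separable_ext (separable_prod (sphere_bounded_cst c) (sphere_bounded_cst 1)) => x y _ _.
by rewrite mulr1.
Qed.

Lemma separable_sum (I : Type) (r : seq I) (P : pred I) (F : I -> R4 R -> R4 R -> R) :
  (forall i, P i -> separable (F i)) ->
  separable (fun x y => \sum_(i <- r | P i) F i x y).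
Proof.
move=> bF; elim: r => [|i r IH].
  by apply: separable_ext (separable_cst 0) => x y _ _; rewrite big_nil.
have [Pi|/negbTE Pi] := boolP (P i); last first.
  by apply: separable_ext IH => x y _ _; rewrite big_cons Pi.
apply: separable_ext (separableD (bF _ Pi) IH) => x y _ _.
by rewrite big_cons Pi.
Qed.

Lemma separable_boundedr K x : separable K -> S3 x -> sphere_bounded (K x).
Proof.
move=> sK Sx; elim: sK => [f g bf bg|K1 K2 _ IH1 _ IH2|K1 K2 K12 _ IH].
- exact: sphere_boundedZ.
- exact: sphere_boundedD.
- by apply: sphere_bounded_ext IH => y Sy; rewrite K12.
Qed.

Lemma separableC K : separable K -> separable (fun x y => K y x).
Proof.
elim=> [f g bf bg|K1 K2 _ IH1 _ IH2|K1 K2 K12 _ IH].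
- by apply: separable_ext (separable_prod bg bf) => x y _ _; rewrite mulrC.
- by apply: separable_ext (separableD IH1 IH2).
- by apply: separable_ext IH => x y Sx Sy; rewrite K12.
Qed.

Lemma separable_boundedl K y : separable K -> S3 y -> sphere_bounded (K ^~ y).
Proof. by move=> /separableC; exact: separable_boundedr. Qed.

Lemma separable_ip_bounded K u : separable K -> sphere_sqint u ->
  sphere_bounded (fun x => ip (K x) u).
Proof.
move=> sK su; elim: sK => [f g bf bg|K1 K2 sK1 IH1 sK2 IH2|K1 K2 K12 _ IH].
- apply: (@sphere_bounded_ext (fun x => ip g u * f x)); last exact: sphere_boundedZ.
  by move=> x Sx; rewrite [LHS]mulrC -ipZl//; exact: sphere_bounded_sqint.
- apply: sphere_bounded_ext (sphere_boundedD IH1 IH2) => x Sx.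
  by rewrite ipDl//; apply: sphere_bounded_sqint; exact: separable_boundedr.
- by apply: sphere_bounded_ext IH => x Sx; apply: eq_ip => // y Sy; exact: K12.
Qed.

Lemma separable_fubini K u v : separable K -> sphere_sqint u -> sphere_sqint v ->
  ip (fun x => ip (K x) u) v = ip (fun y => ip (K ^~ y) v) u.
Proof.
move=> sK su sv; elim: sK => [f g bf bg|K1 K2 sK1 IH1 sK2 IH2|K1 K2 K12 _ IH].
- have sf := sphere_bounded_sqint bf; have sg := sphere_bounded_sqint bg.
  transitivity (ip (fun x => ip g u * f x) v).
    by apply: eq_ip => // x Sx; rewrite [RHS]mulrC -ipZl.
  transitivity (ip (fun x => ip f v * g x) u).
    by rewrite !ipZl// [LHS]mulrC.
  apply: eq_ip => // y Sy; rewrite [LHS]mulrC -ipZl//.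
  by apply: eq_ip => // x _; rewrite [LHS]mulrC.
- transitivity (ip (fun x => ip (K1 x) u + ip (K2 x) u) v).
    by apply: eq_ip => // x Sx; rewrite ipDl//; apply: sphere_bounded_sqint; exact: separable_boundedr.
  have sq K' (sK : separable K') w (sw : sphere_sqint w) :
      sphere_sqint (fun x => ip (K' x) w).
    by apply: sphere_bounded_sqint; exact: separable_ip_bounded.
  rewrite (ipDl (sq _ sK1 _ su) (sq _ sK2 _ su) sv) IH1 IH2.
  rewrite -(ipDl (sq _ (separableC sK1) _ sv) (sq _ (separableC sK2) _ sv) su).
  by apply: eq_ip => // y Sy; rewrite ipDl//; apply: sphere_bounded_sqint; exact: separable_boundedl.
- transitivity (ip (fun x => ip (K1 x) u) v).
    by apply: eq_ip => // x Sx; apply: eq_ip => // y Sy; rewrite K12.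
  by rewrite IH; apply: eq_ip => // y Sy; apply: eq_ip => // x Sx; rewrite K12.
Qed.

End sphere_L2.

(** * Moments of linear forms *)

Section moments.
Context {R : realType}.
Notation S3 := (SU2 R).
Notation sigma := (surface R).
Implicit Types (x y z w : R4 R).

Definition dot x y : R := \sum_i coord x i * coord y i.

Lemma dotE x y : dot x y =
  x.1.1.1 * y.1.1.1 + x.1.1.2 * y.1.1.2 + x.1.2 * y.1.2 + x.2 * y.2.
Proof. by rewrite /dot !big_ord_recr big_ord0 /coord /= add0r. Qed.

Lemma dotC x y : dot x y = dot y x.
Proof. by rewrite !dotE; ring. Qed.

Lemma dotDl x y z : dot (x + y) z = dot x z + dot y z.
Proof. by rewrite !dotE /=; ring. Qed.

Lemma dotZl (a : R) x z : dot (a *: x) z = a * dot x z.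
Proof. by rewrite !dotE scale4E /=; ring. Qed.

Lemma dotxx x : dot x x = normsq x.
Proof. by apply: eq_bigr => i _; rewrite expr2. Qed.

Lemma SU2P x : S3 x <-> normsq x = 1.
Proof.
rewrite -enorm_sqr /SU2/=; split=> [->|/eqP]; first by rewrite expr1n.
by rewrite sqrp_eq1 ?enorm_ge0// => /eqP.
Qed.

Lemma measurable_dot x : measurable_fun setT (dot x).
Proof.
by apply: measurable_sum => i; apply: measurable_funM => //; exact: measurable_coord.
Qed.

Lemma sphere_bounded_dot x : sphere_bounded (dot x).
Proof.
apply: sphere_bounded_sum => i _; apply: sphere_boundedZ; exact: sphere_bounded_coord.
Qed.

Lemma sphere_boundedX (f : R4 R -> R) n : sphere_bounded f ->
  sphere_bounded (fun x => f x ^+ n).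
Proof.
move=> bf; elim: n => [|n IH]; first exact: sphere_bounded_cst.
by under eq_fun do rewrite exprS; exact: sphere_boundedM.
Qed.

Lemma sphere_bounded_horner (p : {poly R}) (f : R4 R -> R) : sphere_bounded f ->
  sphere_bounded (fun x => p.[f x]).
Proof.
move=> bf; elim/poly_ind: p => [|p c IH].
  by under eq_fun do rewrite horner0; exact: sphere_bounded_cst.
under eq_fun do rewrite hornerMXaddC.
by apply: sphere_boundedD; [exact: sphere_boundedM|exact: sphere_bounded_cst].
Qed.

Lemma sqint_ridge (p : {poly R}) x : sphere_sqint (fun y => p.[dot x y]).
Proof. exact/sphere_bounded_sqint/sphere_bounded_horner/sphere_bounded_dot. Qed.

Lemma separable_ridge (p : {poly R}) : separable (fun x y => p.[dot x y]).
Proof.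
have sd : separable dot.
  apply: separable_sum => i _; apply: separable_prod; exact: sphere_bounded_coord.
elim/poly_ind: p => [|p c IH].
  by apply: separable_ext (separable_cst 0) => x y _ _; rewrite horner0.
apply: separable_ext (separableD (separableM IH sd) (separable_cst c)) => x y _ _.
by rewrite hornerMXaddC.
Qed.

Definition moment w n : R := ip (fun y => dot w y ^+ n) (fun=> 1).

Lemma moment_isometry rho w w' n : isometry_lin rho ->
  (forall x, dot w (rho x) = dot w' x) -> moment w n = moment w' n.
Proof.
move=> iso ww'.
have [mrho rhoE] := isometry_scales iso.
have [_ _ rn] := iso.
pose f y : \bar R := (dot w y ^+ n * 1)%:E.
have mf : measurable_fun setT f.
  apply/measurable_EFinP; apply: measurable_funM => //.
  by apply: measurable_funX; exact: measurable_dot.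
have preS : rho @^-1` S3 = S3 by apply/seteqP; split=> x; rewrite /SU2/= rn.
have if' : sigma.-integrable (rho @^-1` S3) (f \o rho).
  rewrite preS.
  rewrite (_ : f \o rho = EFin \o (fun y => dot w' y ^+ n * 1)).
    apply: sphere_bounded_integrable; apply: sphere_boundedM; last exact: sphere_bounded_cst.
    exact/sphere_boundedX/sphere_bounded_dot.
  by apply/funext => y; rewrite /f /= ww'.
have := integral_pushforward mrho mf if' measurable_SU2.
rewrite preS => E; rewrite /moment /ip /Rintegral; congr fine.
transitivity (\int[pushforward sigma rho]_(y in S3) f y)%E.
  apply: eq_measure_integral => A mA _; apply/esym.
  by apply: (eq_trans (rhoE A mA)); rewrite mul1e.
rewrite E; apply: eq_integral => y _; rewrite /f /=; by rewrite ww'.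
Qed.

(** The half-turn, which has no decomposition into shears, is avoided by two quarter
    turns first. *)
Lemma rotate_to_axis (F : R -> R -> R) :
  (forall c s a b, c ^+ 2 + s ^+ 2 = 1 -> 1 + c != 0 ->
     F a b = F (c * a + s * b) (c * b - s * a)) ->
  forall a b, F a b = F (Num.sqrt (a ^+ 2 + b ^+ 2)) 0.
Proof.
move=> Frot a b.
have quarter u v : F u v = F v (- u).
  rewrite (Frot 0 1) ?expr0n ?expr1n ?add0r ?addr0 ?oner_neq0//.
  by rewrite !mul0r !mul1r add0r sub0r.
set r := Num.sqrt _.
have [r0|r_neq0] := eqVneq r 0.
  have : r ^+ 2 = 0 by rewrite r0 expr0n.
  rewrite sqr_sqrtr ?addr_ge0 ?sqr_ge0// => /eqP.
  by rewrite r0 paddr_eq0 ?sqr_ge0// !sqrf_eq0 => /andP[/eqP -> /eqP ->].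
have r2 : r ^+ 2 = a ^+ 2 + b ^+ 2 by rewrite sqr_sqrtr// addr_ge0// sqr_ge0.
have good u v : r ^+ 2 = u ^+ 2 + v ^+ 2 -> 1 + u / r != 0 -> F u v = F r 0.
  move=> ruv ur; rewrite (Frot (u / r) (v / r))//.
    congr F.
      by apply: (mulIf r_neq0); rewrite -expr2 ruv; field.
    by field.
  by rewrite !expr_div_n -mulrDl -ruv mulfV// expf_eq0/= r_neq0.
have [ar|] := eqVneq (1 + a / r) 0; last exact: good.
rewrite quarter quarter; apply: good; first by rewrite !sqrrN.
apply/eqP => ar'.
have : 2 = 0 :> R by rewrite -[RHS](addr0 0) -{1}ar -ar'; field.
by move/eqP; rewrite pnatr_eq0.
Qed.

(** Successive rotations in three coordinate planes move w to the first axis. *)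
Lemma moment_axis w n : moment w n = moment (enorm w, 0, 0, 0) n.
Proof.
case: w => -[[a b] c] d.
have -> : moment (a, b, c, d) n = moment (a, b, Num.sqrt (c ^+ 2 + d ^+ 2), 0) n.
  apply: (rotate_to_axis (F := fun c d => moment (a, b, c, d) n)) => {}c s {}a' b' cs c1.
  apply: (moment_isometry n (isometry_rot23 cs c1)) => x.
  by rewrite !dotE /=; ring.
have -> (u : R) : moment (a, b, u, 0) n = moment (a, Num.sqrt (b ^+ 2 + u ^+ 2), 0, 0) n.
  apply: (rotate_to_axis (F := fun c d => moment (a, c, d, 0) n)) => {}c s {}a' b' cs c1.
  apply: (moment_isometry n (isometry_rot12 cs c1)) => x.
  by rewrite !dotE /=; ring.
have -> (u : R) : moment (a, u, 0, 0) n = moment (Num.sqrt (a ^+ 2 + u ^+ 2), 0, 0, 0) n.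
  apply: (rotate_to_axis (F := fun c d => moment (c, d, 0, 0) n)) => {}c s {}a' b' cs c1.
  apply: (moment_isometry n (isometry_rot01 cs c1)) => x.
  by rewrite !dotE /=; ring.
suff -> : enorm (a, b, c, d) = Num.sqrt (a ^+ 2 + Num.sqrt (b ^+ 2 + Num.sqrt (c ^+ 2 + d ^+ 2) ^+ 2) ^+ 2) by [].
rewrite /enorm normsqE /= (sqr_sqrtr (addr_ge0 (sqr_ge0 c) (sqr_ge0 d))).
by rewrite sqr_sqrtr ?addr_ge0 ?sqr_ge0// !addrA.
Qed.

Definition axial n : R := moment (1, 0, 0, 0) n.

Lemma momentZ (a : R) w n : moment (a *: w) n = a ^+ n * moment w n.
Proof.
rewrite /moment -ipZl; try exact/sphere_bounded_sqint/sphere_bounded_cst.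
  by apply: eq_ip => // y _; rewrite dotZl exprMn.
exact/sphere_bounded_sqint/sphere_boundedX/sphere_bounded_dot.
Qed.

Lemma momentE w n : moment w n = enorm w ^+ n * axial n.
Proof.
rewrite moment_axis -momentZ; congr moment.
by rewrite scale4E /= mulr1 mulr0.
Qed.

Lemma axial_odd n : odd n -> axial n = 0.
Proof.
move=> n_odd.
have : axial n = - axial n; last by move/eqP; rewrite -addr_eq0 -mulr2n mulrn_eq0 => /eqP.
rewrite {1}/axial.
have := momentZ (-1) (1, 0, 0, 0) n; rewrite momentE enormZ normrN1 mul1r -momentE => ->.
by rewrite -signr_odd n_odd expr1 mulN1r.
Qed.

Lemma moment_even w k : moment w k.*2 = normsq w ^+ k * axial k.*2.
Proof. by rewrite momentE -enorm_sqr -exprM mul2n. Qed.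

End moments.

(** * Joint moments of two linear forms *)

Section funk_hecke.
Context {R : realType}.
Local Notation axial := (@axial R).
Implicit Types (x y z w : R4 R) (p q : {poly R}).

Lemma poly_horner_inj p q : (forall s, p.[s] = q.[s]) -> p = q.
Proof.
move=> pq; apply/eqP; rewrite -subr_eq0; apply/negPn/negP => pq0.
have := max_poly_roots pq0 (rs := [seq i%:R | i <- iota 0 (size (p - q))]).
rewrite size_map size_iota ltnn map_inj_uniq ?iota_uniq; last first.
  by move=> i j /eqP; rewrite eqr_nat => /eqP.
suff -> : all (root (p - q)) [seq i%:R | i <- iota 0 (size (p - q))] by move=> /(_ isT isT).
by apply/allP => s _; rewrite /root hornerD hornerN pq subrr.
Qed.

Definition mu x z a b : R :=
  ip (fun y => dot x y ^+ a) (fun y => dot z y ^+ b).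

Lemma sqint_dotX x n : sphere_sqint (fun y => dot x y ^+ n).
Proof. exact/sphere_bounded_sqint/sphere_boundedX/sphere_bounded_dot. Qed.

Lemma sqint1 : sphere_sqint (fun _ : R4 R => 1 : R).
Proof. exact/sphere_bounded_sqint/sphere_bounded_cst. Qed.

Lemma moment_binom x z n s :
  moment (s *: x + z) n = \sum_(a < n.+1) 'C(n, a)%:R * mu x z a (n - a) * s ^+ a.
Proof.
rewrite /moment.
transitivity (ip (fun y => \sum_(a < n.+1) ('C(n, a)%:R * s ^+ a) * (dot x y ^+ a * dot z y ^+ (n - a))) (fun=> 1)).
  apply: eq_ip => // y _; rewrite dotDl dotZl addrC exprDn; apply: eq_bigr => i _.
  by rewrite exprMn -mulr_natl; ring.
have sxz a : sphere_sqint (fun y => dot x y ^+ a * dot z y ^+ (n - a)).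
  by apply/sphere_bounded_sqint/sphere_boundedM; apply/sphere_boundedX/sphere_bounded_dot.
rewrite ip_suml; last 2 first.
- by move=> i _; apply: sphere_sqintZ; exact: sxz.
- exact: sqint1.
apply: eq_bigr => a _; rewrite ipZl//; last exact: sqint1.
rewrite mulrAC; congr (_ * _ * _).
by apply: eq_Rintegral => y _; rewrite mulr1.
Qed.

Definition mu_poly x z n : {poly R} :=
  \poly_(a < n.+1) ('C(n, a)%:R * mu x z a (n - a)).

Definition quad (t : R) : {poly R} := 1 + (2 * t) *: 'X + 'X^2.

(** The generating function of the joint moments: |s x + z|^2 is
    1 + 2 <x, z> s + s^2 for unit vectors. *)
Lemma mu_polyE x z n : normsq x = 1 -> normsq z = 1 ->
  mu_poly x z n = axial n *: quad (dot x z) ^+ n./2.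
Proof.
move=> x1 z1; apply: poly_horner_inj => s.
rewrite horner_poly -moment_binom hornerZ horner_exp /quad !hornerE mulrC.
have [n_odd|n_even] := boolP (odd n).
  by rewrite momentE axial_odd// !mulr0.
have -> : moment (s *: x + z) n = normsq (s *: x + z) ^+ n./2 * axial n.
  by rewrite -{1 3}(even_halfK n_even) moment_even.
congr (_ ^+ _ * _).
rewrite -dotxx dotDl dotZl !(dotC _ (s *: x + z)) !dotDl !dotZl !dotxx x1 z1 (dotC z x).
ring.
Qed.

Lemma deriv_quadX t k : (quad t ^+ k.+1)^`() = (2 * k.+1%:R) *: ((t%:P + 'X) * quad t ^+ k).
Proof.
rewrite deriv_exp /quad !derivD derivZ derivX derivXn -[1]/(1%:P) derivC add0r /=.
rewrite -mulr_natl -!mul_polyC !polyCM !polyC_natr; ring.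
Qed.

Lemma dot_axis i y : dot (axis i) y = coord y i.
Proof.
rewrite dotE /axis /coord.
by case: i => -[|[|[|[|//]]]] i4 /=; rewrite !mul0r ?mul1r ?addr0 ?add0r.
Qed.

Lemma normsq_axis i : normsq (axis i : R4 R) = 1.
Proof.
rewrite -dotxx dot_axis /axis /coord.
by case: i => -[|[|[|[|//]]]] i4.
Qed.

Lemma dot_axis_neq i j : i != j -> dot (axis i) (axis j : R4 R) = 0.
Proof.
rewrite dot_axis /axis /coord.
by case: i j => -[|[|[|[|//]]]] i4 [[|[|[|[|//]]]]] j4.
Qed.

(** Multiply by the sum of the squared coordinates, which is 1 on the sphere. The
    three off-diagonal joint moments agree: each is the coefficient of s^2 in the
    generating function for two orthogonal axes. *)
Lemma axial_rec k : k.+2.*2%:R * axial k.+1.*2 = (k.*2.+1)%:R * axial k.*2.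
Proof.
have off i : i != 0 -> (k.*2.+1)%:R * mu (axis i) (axis 0) 2 k.*2 = axial k.+1.*2.
  move=> i0.
  have H := mu_polyE k.+1.*2 (normsq_axis i) (normsq_axis 0).
  move: H; rewrite doubleK dot_axis_neq// => /(congr1 (fun p => p^`()`_1)).
  rewrite derivZ deriv_quadX coef_deriv coef_poly /=.
  rewrite !coefZ add0r coefXM /= -horner_coef0.
  have -> : (quad 0 ^+ k).[0] = 1 by rewrite horner_exp /quad !hornerE expr0n addr0 expr1n.
  rewrite mulr1 doubleS subn2 /=.
  have C2 : ('C(k.*2.+2, 2)%:R *+ 2 : R) = (2 * k.+1%:R) * k.*2.+1%:R.
    rewrite -mulr_natl -natrM -mul_bin_diag bin1 natrM; congr (_ * _).
    by rewrite -doubleS -mul2n natrM.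
  move: (mu _ _ _ _) => m; rewrite -mulrnAl C2 => H.
  have k0 : 2 * k.+1%:R != 0 :> R by rewrite mulf_neq0// pnatr_eq0.
  by apply: (mulfI k0); rewrite mulrA H mulrC.
have ax0 : axial k.*2 = \sum_(i < 4) mu (axis i) (axis 0) 2 k.*2.
  rewrite /mu -ip_suml; last 2 first.
  - by move=> i _; exact: sqint_dotX.
  - exact: sqint_dotX.
  rewrite ipC /axial /moment; apply: eq_ip => y Sy.
    by [].
  rewrite -(proj1 (SU2P y) Sy) /normsq; apply: eq_bigr => i _.
  by rewrite dot_axis.
have diag : mu (axis 0) (axis 0) 2 k.*2 = axial k.+1.*2.
  rewrite /mu /axial /moment /ip; apply: eq_Rintegral => y _.
  by rewrite mulr1 -exprD doubleS.
rewrite ax0 mulr_sumr big_ord_recl diag (eq_bigr (fun=> axial k.+1.*2)); last first.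
  by move=> i _; exact: off.
rewrite sumr_const card_ord -mulr_natl.
by rewrite doubleS doubleS -[X in X.+2]addn1 -[k.*2.+1]addn1 -addn2 -!addnA !natrD; ring.
Qed.

(** Integration by parts for the monomials in two linear forms. It compares the
    coefficients of s^a in the derivative of the generating function, where
    the derivative of (1 + 2 t s + s^2)^(k+1) brings back the exponent k, and
    [axial_rec] relates the two constants. *)
Lemma mu_rec x z a b : normsq x = 1 -> normsq z = 1 ->
  (a + b)%:R * mu x z a.+1 b + 3 * mu x z a.+1 b =
  a%:R * mu x z a.-1 b + b%:R * dot x z * mu x z a b.-1.
Proof.
move=> x1 z1.
have mu_odd c d : odd (c + d) -> mu x z c d = 0.
  move=> cd; have := congr1 (fun p => p`_c) (mu_polyE (c + d) x1 z1).
  rewrite axial_odd// scale0r coef_poly ltnS leq_addr coef0 addKn => /eqP.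
  by rewrite mulf_eq0 pnatr_eq0 -leqn0 leqNgt bin_gt0 leq_addr/= => /eqP.
have [ab|ab] := boolP (odd (a.+1 + b)).
  rewrite mu_odd// !mulr0 addr0.
  have -> : a%:R * mu x z a.-1 b = 0.
    case: a ab => [|a] ab; first by rewrite mul0r.
    by rewrite mu_odd ?mulr0//; rewrite !addSn/= negbK in ab.
  case: b ab => [|b] ab; first by rewrite !mul0r add0r.
  by rewrite mu_odd ?mulr0 ?addr0//; rewrite addnS addSn /= negbK in ab.
have [k Nk] : exists k, (a.+1 + b = k.+1.*2)%N.
  exists (a.+1 + b)./2.-1; rewrite prednK; first by rewrite even_halfK.
  by case: (a) (b) ab => [|a'] [|b'] //=; rewrite ?addn0 ?addn1 ?addSn ?addnS.
have H1 := congr1 (fun p => (p^`())`_a) (mu_polyE k.+1.*2 x1 z1).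
have H2 := mu_polyE k.*2 x1 z1.
move: H1 H2; rewrite /= !doubleK derivZ deriv_quadX => H1 H2.
have coefM (c d : nat) : (c + d)%N = k.*2 ->
    axial k.*2 * (quad (dot x z) ^+ k)`_c = 'C(k.*2, c)%:R * mu x z c d.
  move=> cd; rewrite -coefZ -H2 coef_poly ltnS -cd leq_addr.
  by rewrite addKn.
set A : R := 'C(k.*2.+2, a.+1)%:R.
have A0 : a.+1%:R * A != 0.
  rewrite mulf_neq0 ?pnatr_eq0// -lt0n bin_gt0.
  by rewrite -doubleS -Nk leq_addr.
have ab' : (a + b = k.*2.+1)%N by move: Nk; rewrite doubleS addSn => -[].
(* the binomial weights of the coefficients a and a.-1 in the lower power *)
have bin_b : k.*2.+2%:R * k.*2.+1%:R * 'C(k.*2, a)%:R = a.+1%:R * A * b%:R.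
  rewrite /A -!natrM -mulnA mul_bin_down mulnCA mul_bin_diag -ab' addKn.
  by congr (_%:R); rewrite mulnC.
have bin_a : k.*2.+2%:R * k.*2.+1%:R * (if a is a'.+1 then 'C(k.*2, a')%:R else 0) = a.+1%:R * A * a%:R.
  rewrite /A; case: (a) => [|a']; first by rewrite !mulr0.
  by rewrite -!natrM -mulnA mul_bin_diag mulnCA mul_bin_diag mulnC.
have H3 : k.+2.*2%:R * (a.+1%:R * A * mu x z a.+1 b) =
    k.*2.+2%:R * (k.*2.+1%:R * axial k.*2 * (((dot x z)%:P + 'X) * quad (dot x z) ^+ k)`_a).
  have -> : k.*2.+2%:R = 2 * k.+1%:R :> R by rewrite -doubleS -mul2n natrM.
  rewrite -axial_rec; move: H1; rewrite coef_deriv coef_poly ltnS -Nk addSn ltnS leq_addr.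
  rewrite subSS addKn ab' -/A -[X in X = _ -> _]mulr_natl [X in X = _ -> _]mulrA !coefZ => ->; ring.
apply: (mulfI A0).
rewrite -mulrDl -natrD ab'.
have -> : (k.*2.+1 + 3 = k.+2.*2)%N by rewrite !doubleS addn3.
rewrite mulrCA H3 [((_)%:P + 'X) * _]mulrDl coefD coefCM coefXM.
set q := quad (dot x z) ^+ k; set qa := (if _ then _ else _).
transitivity (k.*2.+2%:R * (k.*2.+1%:R * axial k.*2 * qa) +
  k.*2.+2%:R * (k.*2.+1%:R * axial k.*2 * (dot x z * q`_a))); first ring.
rewrite [RHS]mulrDr /qa /q; congr (_ + _).
- transitivity (k.*2.+2%:R * k.*2.+1%:R * (if a is a'.+1 then 'C(k.*2, a')%:R else 0) * mu x z a.-1 b); last by rewrite bin_a; ring.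
  case: (a) ab' => [|a'] /= ab'; first by rewrite !(mulr0, mul0r).
  rewrite -!mulrA (coefM _ b)//.
  by move: ab'; rewrite addSn => -[].
- case: (b) ab' bin_b => [|b'] ab' bin_b.
    rewrite !(mul0r, mulr0).
    have : axial k.*2 * (quad (dot x z) ^+ k)`_a = 0.
      by rewrite -coefZ -H2 coef_poly -ab' addn0 ltnn.
    move: (axial _) (_`_a) => u v uv.
    rewrite [X in _ * X](_ : _ = k.*2.+1%:R * dot x z * (u * v)); last ring.
    by rewrite uv !mulr0.
  transitivity (k.*2.+2%:R * k.*2.+1%:R * 'C(k.*2, a)%:R * (dot x z * mu x z a b')); last by rewrite bin_b; ring.
  have /coefM E : (a + b' = k.*2)%N by move: ab'; rewrite addnS => -[].
  transitivity (k.*2.+2%:R * k.*2.+1%:R * dot x z * (axial k.*2 * (quad (dot x z) ^+ k)`_a)); first ring.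
  by rewrite E; ring.
Qed.

End funk_hecke.

(** * Green's formula and zonal harmonics *)

Section zonal.
Context {R : realType}.
Implicit Types (x y z w : R4 R) (p q : {poly R}).

Definition bil x z p q : R := ip (fun y => p.[dot x y]) (fun y => q.[dot z y]).

Lemma bilC x z p q : bil x z p q = bil z x q p.
Proof. exact: ipC. Qed.

Lemma bil_linl x z (c : R) p p' q :
  bil x z (c *: p + p') q = c * bil x z p q + bil x z p' q.
Proof.
rewrite /bil -ipZl; try exact: sqint_ridge.
rewrite -ipDl; try exact: sqint_ridge; last exact/sphere_sqintZ/sqint_ridge.
by apply: eq_ip => // y _; rewrite hornerD hornerZ.
Qed.

Lemma bil_linr x z (c : R) p q q' :
  bil x z p (c *: q + q') = c * bil x z p q + bil x z p q'.
Proof. by rewrite bilC bil_linl !(bilC z). Qed.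

Lemma bil0l x z q : bil x z 0 q = 0.
Proof. by rewrite /bil -[RHS](ip0l (fun y => q.[dot z y])); apply: eq_ip => // y _; rewrite horner0. Qed.

Lemma bilZl x z (c : R) p q : bil x z (c *: p) q = c * bil x z p q.
Proof. by rewrite -[c *: p]addr0 bil_linl bil0l addr0. Qed.

Lemma bilDl x z p p' q : bil x z (p + p') q = bil x z p q + bil x z p' q.
Proof. by rewrite -[p]scale1r bil_linl mul1r scale1r. Qed.

Lemma bilBl x z p p' q : bil x z (p - p') q = bil x z p q - bil x z p' q.
Proof. by rewrite bilDl -scaleN1r bilZl mulN1r. Qed.

Lemma bil0r x z p : bil x z p 0 = 0. Proof. by rewrite bilC bil0l. Qed.

Lemma bilZr x z (c : R) p q : bil x z p (c *: q) = c * bil x z p q.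
Proof. by rewrite bilC bilZl bilC. Qed.

Lemma bilDr x z p q q' : bil x z p (q + q') = bil x z p q + bil x z p q'.
Proof. by rewrite bilC bilDl !(bilC z). Qed.

Lemma bil_suml x z (I : Type) (r : seq I) (P : pred I) (F : I -> {poly R}) q :
  bil x z (\sum_(i <- r | P i) F i) q = \sum_(i <- r | P i) bil x z (F i) q.
Proof. by apply: (big_morph (fun p => bil x z p q)) => [p p'|]; rewrite ?bilDl ?bil0l. Qed.

Lemma bil_mu x z a b : bil x z 'X^a 'X^b = mu x z a b.
Proof. by apply: eq_ip => y _; rewrite hornerXn. Qed.

(** The spherical Laplacian in terms of the profile: it sends y |-> p(<w, y>) to
    y |-> (lap p)(<w, y>) for a unit vector w. *)
Definition lap p : {poly R} := (1 - 'X^2) * p^`()^`() - 3%:R *: ('X * p^`()).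

Lemma lap_lin (c : R) p q : lap (c *: p + q) = c *: lap p + lap q.
Proof.
rewrite /lap !(derivD, derivZ) -!mul_polyC.
ring.
Qed.

Lemma poly_lin0 (F : {poly R} -> R) :
  (forall (c : R) p q, F (c *: p + q) = c * F p + F q) ->
  (forall n, F 'X^n = 0) -> forall p, F p = 0.
Proof.
move=> Flin FX p.
have F0 : F 0 = 0.
  by have := Flin (-1) 0 0; rewrite scaler0 addr0 mulN1r addNr.
rewrite -[p]coefK poly_def.
elim/big_rec: _ => // i q _ Fq.
by rewrite Flin FX Fq mulr0 addr0.
Qed.

(** Green's formula on the sphere for two ridge functions: the inner product of
    their gradients at y is p' q' (<x, z> - <x, y> <z, y>). On monomials it is
    [mu_rec]. *)
Lemma green x z p q : normsq x = 1 -> normsq z = 1 ->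
  bil x z (lap p) q + dot x z * bil x z p^`() q^`()
  - bil x z ('X * p^`()) ('X * q^`()) = 0.
Proof.
move=> x1 z1; pose Phi p q := bil x z (lap p) q + dot x z * bil x z p^`() q^`()
  - bil x z ('X * p^`()) ('X * q^`()); rewrite -/(Phi p q).
have X_lin (c : R) p' q' : 'X * (c *: p' + q')^`() = c *: ('X * p'^`()) + 'X * q'^`().
  by rewrite derivD derivZ mulrDr scalerAr.
apply: (poly_lin0 (F := fun p => Phi p q)) => [c p1 p2|a].
  by rewrite /Phi lap_lin X_lin derivD derivZ !bil_linl; ring.
apply: (poly_lin0 (F := Phi 'X^a)) => [c q1 q2|b].
  by rewrite /Phi X_lin derivD derivZ !bil_linr; ring.
rewrite /Phi /lap; case: a => [|a].
  by rewrite expr0 -[1]/(1%:P) !derivC ?deriv0 !(mulr0, scaler0, subr0) !bil0l mulr0 addr0 subrr.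
have dX n : 'X * ('X^n)^`() = n%:R *: 'X^n :> {poly R}.
  by case: n => [|n]; rewrite derivXn ?mulr0n ?mulr0 ?scale0r// mulrnAr -exprS -scaler_nat.
have d1 n : ('X^n)^`() = n%:R *: 'X^(n.-1) :> {poly R} by rewrite derivXn scaler_nat.
rewrite !dX bilBl !bilZl bilZr d1 /= derivZ mulrBl mul1r bilBl.
rewrite d1 -!scalerAr !bilZl bil_mu.
have -> : 'X^2 * 'X^(a.-1) = 'X^(a.-1.+2) :> {poly R} by rewrite -exprD.
have -> : a%:R * bil x z 'X^(a.-1.+2) 'X^b = a%:R * mu x z a.+1 b.
  by case: (a) => [|a']; rewrite ?mul0r ?bil_mu.
rewrite d1 bilZr !bil_mu.
have := mu_rec a b x1 z1; rewrite natrD => H.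
rewrite /GRing.scale /=.
transitivity (a.+1%:R * ((a%:R * mu x z a.-1 b + b%:R * dot x z * mu x z a b.-1) -
  ((a%:R + b%:R) * mu x z a.+1 b + 3 * mu x z a.+1 b))); first ring.
by rewrite H subrr mulr0.
Qed.

(** The Chebyshev polynomials of the second kind, U_n. *)
Fixpoint cheb n : {poly R} :=
  match n with
  | 0 => 1
  | 1 => 2%:R *: 'X
  | (m.+1 as m').+1 => 2%:R *: 'X * cheb m' - cheb m
  end.

Lemma chebSS n : cheb n.+2 = 2%:R *: 'X * cheb n.+1 - cheb n.
Proof. by []. Qed.

(** U_(n-1), with the convention U_(-1) = 0. *)
Definition chebP n : {poly R} := if n is m.+1 then cheb m else 0.

Lemma chebS n : cheb n.+1 = 2%:R *: 'X * cheb n - chebP n.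
Proof. by case: n => [|n]; rewrite ?chebSS//= mulr1 subr0. Qed.

Lemma deriv1 : (1 : {poly R})^`() = 0.
Proof. exact: derivC. Qed.

(** The first relation trades the second derivative in [lap] for a first one; the
    two have to be proved together. *)
Lemma cheb_deriv n :
  (1 - 'X^2) * (cheb n)^`() = n.+1%:R *: chebP n - n%:R *: ('X * cheb n) /\
  'X * (cheb n)^`() = n%:R *: cheb n + (chebP n)^`().
Proof.
elim: n => [|n [IHA IHB]].
  by rewrite /= deriv1 !mulr0 !scale0r scaler0 deriv0 subr0 addr0.
have C : (cheb n.+1)^`() = n.+2%:R *: cheb n + 'X * (cheb n)^`().
  rewrite chebS derivB derivM derivZ derivX.
  have -> : (chebP n)^`() = 'X * (cheb n)^`() - n%:R *: cheb n by rewrite IHB addrC addKr.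
  rewrite -!mul_polyC !polyC_natr; ring.
rewrite C; split.
  rewrite mulrDr mulrCA IHA chebS /=.
  rewrite -!mul_polyC !polyC_natr; ring.
rewrite mulrDr.
have -> : 'X * ('X * (cheb n)^`()) = (cheb n)^`() - (1 - 'X^2) * (cheb n)^`().
  by rewrite expr2; ring.
rewrite IHA chebS /= -!mul_polyC !polyC_natr; ring.
Qed.

Lemma cheb_derivS n : (cheb n.+1)^`() = n.+2%:R *: cheb n + 'X * (cheb n)^`().
Proof.
have [_ IHB] := cheb_deriv n.
rewrite chebS derivB derivM derivZ derivX.
have -> : (chebP n)^`() = 'X * (cheb n)^`() - n%:R *: cheb n by rewrite IHB addrC addKr.
rewrite -!mul_polyC !polyC_natr; ring.
Qed.

(** Differentiate the first relation of [cheb_deriv]. *)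
Lemma lap_cheb n : lap (cheb n) = - (n * n.+2)%:R *: cheb n.
Proof.
have [A B] := cheb_deriv n.
have E : (chebP n)^`() = 'X * (cheb n)^`() - n%:R *: cheb n by rewrite B addrC addKr.
have dQ : (1 - 'X^2 : {poly R})^`() = - ('X *+ 2) by rewrite derivB deriv1 derivXn sub0r.
move/(congr1 (fun p => p^`())): A.
rewrite derivM dQ derivB !derivZ E [('X * _)^`()]derivM derivX => A.
rewrite /lap.
have -> : (1 - 'X^2) * (cheb n)^`()^`() = n.+1%:R *: ('X * (cheb n)^`() - n%:R *: cheb n) - n%:R *: (1 * cheb n + 'X * (cheb n)^`()) - (- ('X *+ 2)) * (cheb n)^`().
  by rewrite -A addrAC subrr add0r.
rewrite -!mul_polyC polyCN !polyC_natr; ring.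
Qed.

Lemma bil_lapC x z p q : normsq x = 1 -> normsq z = 1 ->
  bil x z (lap p) q = bil x z p (lap q).
Proof.
move=> x1 z1; have := green p q x1 z1; have := green q p z1 x1.
rewrite (dotC z x) ![bil z x _ _]bilC => H1 H2.
rewrite -[LHS]subr0 -[RHS]subr0 -{1}H2 -H1; ring.
Qed.

(** Eigenvectors of a symmetric operator for distinct eigenvalues. *)
Lemma bil_cheb_neq x z m n : normsq x = 1 -> normsq z = 1 -> m != n ->
  bil x z (cheb m) (cheb n) = 0.
Proof.
move=> x1 z1 mn; have := bil_lapC (cheb m) (cheb n) x1 z1.
rewrite !lap_cheb bilZl bilZr => /eqP; rewrite -subr_eq0 -mulrBl mulf_eq0.
case/orP => [|/eqP //]; rewrite subr_eq0 eqr_opp eqr_nat => /eqP mn'.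
have : m.+1 = n.+1; last by move=> [] /eqP; rewrite (negbTE mn).
have sq k : (k * k.+2).+1 = (k.+1 ^ 2)%N by rewrite -mulnn; ring.
by apply/eqP; rewrite -(eqn_exp2r _ _ (isT : 0 < 2)%N) -!sq mn'.
Qed.

(** Symmetry of [lap], with the monomial on the other side. *)
Lemma bil_Xn_cheb x z a n : normsq x = 1 -> normsq z = 1 ->
  ((n * n.+2)%:R - (a * a.+2)%:R) * bil x z 'X^a (cheb n) +
  (a * a.-1)%:R * bil x z 'X^(a.-2) (cheb n) = 0.
Proof.
move=> x1 z1; have := bil_lapC 'X^a (cheb n) x1 z1.
have -> : lap 'X^a = (a * a.-1)%:R *: 'X^(a.-2) - (a * a.+2)%:R *: 'X^a.
  rewrite /lap; case: a => [|[|a]].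
  - by rewrite expr0 deriv1 deriv0 !mulr0 scaler0 !scale0r.
  - by rewrite expr1 derivX deriv1 mulr0 mulr1 muln0 scale0r.
  - rewrite !derivXn /= !derivMn !derivXn /= -!mulrnA -mul_polyC !polyC_natr.
    rewrite -!mul_polyC !polyC_natr !exprS expr0; ring.
rewrite lap_cheb bilBl !bilZl bilZr => H.
move/eqP: H; rewrite -subr_eq0 => /eqP H.
by rewrite -[RHS]H; ring.
Qed.

Lemma bil_Xn_cheb_lt x z a n : normsq x = 1 -> normsq z = 1 -> (a < n)%N ->
  bil x z 'X^a (cheb n) = 0.
Proof.
move=> x1 z1; elim/ltn_ind: a => a IH an.
have /eqP := bil_Xn_cheb a n x1 z1.
have -> : (a * a.-1)%:R * bil x z 'X^(a.-2) (cheb n) = 0.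
  case: a IH an => [|[|a]] IH an; rewrite ?mul0r//.
  by rewrite /= IH ?mulr0//; apply: leq_trans (ltnW (ltnW an)); rewrite ltnS.
rewrite addr0 mulf_eq0 subr_eq0 eqr_nat => /orP[/eqP E|/eqP//].
by have := ltn_mul an (_ : a.+2 < n.+2)%N; rewrite !ltnS E ltnn => /(_ an).
Qed.

Lemma cheb_tail p x z n : normsq x = 1 -> normsq z = 1 -> (size p <= n)%N ->
  bil x z p (cheb n) = 0.
Proof.
move=> x1 z1 pn; rewrite -[p]coefK poly_def bil_suml big1// => i _.
by rewrite bilZl bil_Xn_cheb_lt ?mulr0// (leq_trans (ltn_ord i)).
Qed.

(** The left-hand sides W n satisfy, up to normalization, the three-term
    recurrence of the Chebyshev polynomials. *)
Lemma bil_Xn_chebn x z n : normsq x = 1 -> normsq z = 1 ->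
  bil x z 'X^n (cheb n) = 2 * pi ^+ 2 / (2 ^+ n * n.+1%:R) * (cheb n).[dot x z].
Proof.
move=> x1 z1.
pose W n := bil x z 'X^n (cheb n).
have W0 : W 0 = 2 * pi ^+ 2.
  rewrite /W /bil /ip; under eq_Rintegral do rewrite !hornerC mulr1.
  rewrite (Rintegral_cst _ (@measurable_SU2 R)) mul1r.
  exact: (congr1 fine surface_SU2).
pose t := dot x z.
(* U_(k+1) - U_(k-1) is twice the Chebyshev polynomial of the first kind, whose
   derivative is a multiple of U_k *)
have rec k : k.+2%:R * W k.+1 = k.+1%:R * t * W k - bil x z 'X^(k.+1) (chebP k).
  have lapT : lap (cheb k.+1 - chebP k) =
      - (k.+1%:R * k.+3%:R) *: cheb k.+1 + (k%:R - 1) * k.+1%:R *: chebP k.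
    rewrite -scaleN1r addrC lap_lin lap_cheb natrM scaleN1r addrC; congr (_ + _).
    case: k => [|k]; first by rewrite /lap !(deriv0, mulr0, scaler0) subr0 oppr0.
    rewrite lap_cheb -scaleNr opprK natrM; congr (_ *: _).
    by rewrite -!natr1; ring.
  have dT : (cheb k.+1 - chebP k)^`() = (2 * k.+1%:R) *: cheb k.
    have [_ B] := cheb_deriv k.
    rewrite derivB cheb_derivS B -mul_polyC -!mul_polyC polyCM !polyC_natr -!natr1; ring.
  have XdT : 'X * ((2 * k.+1%:R) *: cheb k) = k.+1%:R *: (cheb k.+1 + chebP k).
    rewrite chebS subrK -!mul_polyC !polyCM !polyC_natr; ring.
  have := green 'X^(k.+1) (cheb k.+1 - chebP k) x1 z1.
  have dXk : ('X^(k.+1))^`() = k.+1%:R *: 'X^k :> {poly R}.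
    by rewrite derivXn scaler_nat.
  have XdXk : 'X * (k.+1%:R *: 'X^k) = k.+1%:R *: 'X^(k.+1) :> {poly R}.
    by rewrite -scalerAr -exprS.
  rewrite bil_lapC// lapT dT XdT dXk XdXk.
  rewrite !(bilDr, bilZr, bilZl) -/(W k.+1) -/(W k) -/t => H.
  set m := bil _ _ _ (chebP k) in H *.
  have k0 : k.+1%:R != 0 :> R by rewrite pnatr_eq0.
  apply/eqP; rewrite -subr_eq0; apply/eqP/(mulfI k0); rewrite mulr0.
  apply: (mulfI (_ : - (2 : R) != 0)); first by rewrite oppr_eq0 pnatr_eq0.
  by rewrite mulr0 -[RHS]H -!natr1; ring.
have recS k : k.+3%:R * W k.+2 = k.+2%:R * t * W k.+1 - k.+1%:R / 4 * W k.
  rewrite rec /=; congr (_ - _).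
  have := bil_Xn_cheb k.+2 k x1 z1; rewrite /= -/(W k).
  have -> : (k * k.+2)%:R - (k.+2 * k.+4)%:R = - (4 * k.+2%:R) :> R.
    by rewrite !natrM -!natr1; ring.
  have k0 : 4 * k.+2%:R != 0 :> R by rewrite mulf_neq0// pnatr_eq0.
  move=> H; apply: (mulfI k0); apply/eqP; rewrite -subr_eq0; apply/eqP.
  by rewrite -[RHS]oppr0 -[RHS](congr1 -%R H) natrM -!natr1; field.
have main k : W k = 2 * pi ^+ 2 / (2 ^+ k * k.+1%:R) * (cheb k).[t] /\
     W k.+1 = 2 * pi ^+ 2 / (2 ^+ k.+1 * k.+2%:R) * (cheb k.+1).[t].
  elim: k => [|k [IH1 IH2]].
    split; first by rewrite W0 /= hornerC expr0 !mulr1 divr1.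
    have := rec 0; rewrite /= bil0r subr0 W0 mul1r expr1 hornerZ hornerX => H.
    apply: (mulfI (_ : (2 : R) != 0)); first by rewrite pnatr_eq0.
    by rewrite H; field.
  split=> //; have k3 : k.+3%:R != 0 :> R by rewrite pnatr_eq0.
  have k2 : k.+2%:R != 0 :> R by rewrite pnatr_eq0.
  have k1 : k.+1%:R != 0 :> R by rewrite pnatr_eq0.
  have e2 : 2 ^+ k != 0 :> R by rewrite expf_neq0// pnatr_eq0.
  apply: (mulfI k3); rewrite recS IH1 IH2 chebSS hornerD hornerN hornerM hornerZ hornerX !exprS.
  move: (cheb k.+1).[t] (cheb k).[t] (2 ^+ k) e2 => u v e e2.
  by field; rewrite e2 !lt0r_neq0// ltr_wpDr.
by have [] := main n.
Qed.

Lemma size_cheb_lead n : (size (cheb n - 2 ^+ n *: 'X^n)%R <= n)%N.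
Proof.
have sz k : (size (cheb k - 2 ^+ k *: 'X^k)%R <= k)%N -> (size (cheb k) <= k.+1)%N.
  move=> H; rewrite -[cheb k](subrK (2 ^+ k *: 'X^k)).
  rewrite (leq_trans (size_polyD _ _))// geq_max (leq_trans H)//=.
  by rewrite (leq_trans (size_scale_leq _ _))// size_polyXn.
suff : (size (cheb n - 2 ^+ n *: 'X^n)%R <= n)%N /\
       (size (cheb n.+1 - 2 ^+ n.+1 *: 'X^(n.+1))%R <= n.+1)%N by case.
elim: n => [|n [IH1 IH2]].
  by rewrite !expr0 !expr1 scale1r !subrr size_poly0.
split=> //; rewrite chebSS.
have -> : 2 *: 'X * cheb n.+1 - cheb n - 2 ^+ n.+2 *: 'X^(n.+2) =
    2 *: ('X * (cheb n.+1 - 2 ^+ n.+1 *: 'X^(n.+1))) - cheb n.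
  by rewrite -!mul_polyC !exprS !polyCM; ring.
rewrite (leq_trans (size_polyD _ _))// geq_max size_polyN (leq_trans (sz _ IH1))// andbT.
rewrite (leq_trans (size_scale_leq _ _))//.
by rewrite (leq_trans (size_polyMleq _ _))// size_polyX.
Qed.

(** The reproducing property, which makes U_n(<x, y>) a multiple of the kernel of a
    projection. Only the leading term 2^n X^n of the first factor contributes. *)
Lemma bil_cheb x z n : normsq x = 1 -> normsq z = 1 ->
  bil x z (cheb n) (cheb n) = 2 * pi ^+ 2 / n.+1%:R * (cheb n).[dot x z].
Proof.
move=> x1 z1.
rewrite -[X in bil _ _ X _](subrK (2 ^+ n *: 'X^n)) bilDl cheb_tail ?size_cheb_lead// add0r.
rewrite bilZl bil_Xn_chebn//.
have e0 : 2 ^+ n != 0 :> R by rewrite expf_neq0// pnatr_eq0.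
by field; rewrite e0 lt0r_neq0// ltr_wpDr.
Qed.

Lemma cheb_basis p n : (size p <= n)%N ->
  exists c : nat -> R, p = \sum_(k < n) c k *: cheb k.
Proof.
elim: n p => [|n IH] p pn.
  by exists (fun=> 0); rewrite big_ord0; apply/eqP; rewrite -size_poly_leq0.
have [|c pE] := IH (p - (p`_n / 2 ^+ n) *: cheb n).
  apply/leq_sizeP => j nj; rewrite coefB coefZ.
  have := size_cheb_lead n => /leq_sizeP /(_ _ nj); rewrite coefB coefZ coefXn.
  move: nj; rewrite leq_eqVlt => /predU1P[<-|nj].
    rewrite eqxx mulr1 => /eqP; rewrite subr_eq0 => /eqP ->.
    by rewrite mulfVK ?subrr// expf_neq0// pnatr_eq0.
  rewrite gtn_eqF// mulr0 subr0 => ->; rewrite mulr0 subr0.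
  by rewrite (leq_sizeP _ _ pn).
exists (fun k => if (k < n)%N then c k else p`_n / 2 ^+ n).
rewrite big_ord_recr /= ltnn -[LHS](subrK ((p`_n / 2 ^+ n) *: cheb n)) pE.
by congr (_ + _); apply: eq_bigr => i _; rewrite ltn_ord.
Qed.

End zonal.

(** * Gradients of ridge functions as test fields *)

Section smooth_ridge.
Context {R : realType}.
Implicit Types (x y z w : R4 R) (p q : {poly R}) (f g : R4 R -> R).

Lemma is_derive_line f x (v : R4 R) (df : R) :
  is_derive (0 : R) (1 : R) (fun h : R => f (h *: v + x)) df -> is_derive x v f df.
Proof.
have E : (fun h : R => h^-1 *: ((f \o shift x) (h *: v) - f x)) =
  (fun h : R => h^-1 *: (((fun h : R => f (h *: v + x)) \o shift 0) (h *: 1) - f (0 *: v + x))).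
  by apply/funext => h /=; rewrite addr0 scale0r add0r [_%:A]mulr1.
move=> [D1 D2]; split; first exact/derivable1P.
by rewrite -D2 /derive E.
Qed.

Lemma is_derive_horner p f x (v : R4 R) (df : R) : is_derive x v f df ->
  is_derive x v (fun y => p.[f y]) (p^`().[f x] * df).
Proof.
move=> Df; elim/poly_ind: p => [|p c IH].
  rewrite deriv0 horner0 mul0r (_ : (fun _ => _) = cst 0); last by apply/funext => y; rewrite horner0.
  exact: is_derive_cst.
rewrite (_ : (fun y => _) = ((fun y => p.[f y]) * f + cst c)); last first.
  by apply/funext => y; rewrite hornerMXaddC.
apply: is_derive_eq; rewrite derivD derivM derivX derivC addr0 mulr1 !hornerE.
by rewrite /GRing.scale /=; ring.
Qed.

Definition inorm x : R := (enorm x)^-1.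

(** Rational expressions in the coordinates and 1/|x|: a class containing the
    radial extensions of ridge functions and stable under partial derivatives,
    which gives smoothness off the origin without computing any of them. *)
Inductive rational : (R4 R -> R) -> Prop :=
| rational_cst c : rational (fun=> c)
| rational_coord i : rational (coord ^~ i)
| rational_inorm : rational inorm
| rationalD f g : rational f -> rational g -> rational (fun x => f x + g x)
| rationalM f g : rational f -> rational g -> rational (fun x => f x * g x).

Lemma coord_line x i j (h : R) :
  coord (h *: axis i + x) j = h * (i == j)%:R + coord x j.
Proof.
rewrite /coord /axis; case: x => -[[a b] c] d.
rewrite -val_eqE /tnth.
case: i j => -[|[|[|[|//]]]] i4 [[|[|[|[|//]]]]] j4 /=;
  rewrite /GRing.scale /= ?mulr0 ?mulr1 //.
Qed.

Lemma is_derive_coord x i j :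
  is_derive x (axis i) (coord ^~ j) ((i == j)%:R : R).
Proof.
apply: is_derive_line.
under eq_fun do rewrite coord_line.
by apply: is_derive_eq; rewrite /GRing.scale /= !(mul0r, mulr0, mulr1, addr0, add0r).
Qed.

Lemma normsq_line x i (h : R) :
  normsq (h *: axis i + x) = normsq x + 2 * h * coord x i + h ^+ 2.
Proof.
rewrite /normsq (eq_bigr (fun j => coord x j ^+ 2 + (2 * h * coord x j + h ^+ 2) * (i == j)%:R)).
  rewrite big_split /= -addrA; congr (_ + _).
  rewrite (bigD1 i)//= eqxx mulr1 big1 ?addr0// => j /negbTE ji.
  by rewrite eq_sym ji mulr0.
move=> j _; rewrite coord_line; case: (i == j) => /=; ring.
Qed.

Lemma is_derive_inorm x i : x != 0 ->
  is_derive x (axis i) inorm (- coord x i * inorm x ^+ 3).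
Proof.
move=> x0; apply: is_derive_line.
have n0 : 0 < normsq x by rewrite -enorm_sqr exprn_gt0// enorm_gt0.
have e0 : enorm x != 0 by rewrite enorm_eq0.
pose u (h : R) := normsq x + 2 * h * coord x i + h ^+ 2.
rewrite (_ : (fun h => _) = fun h => (Num.sqrt (u h))^-1); last first.
  by apply/funext => h; rewrite /inorm /enorm -/(normsq _) normsq_line.
have u0 : u 0 = normsq x by rewrite /u mulr0 mul0r expr0n !addr0.
have Du : is_derive (0 : R) 1 u (2 * coord x i).
  rewrite /u; apply: is_derive_eq; rewrite /GRing.scale /=.
  ring.
have Ds : is_derive (0 : R) 1 (Num.sqrt \o u) ((2 * Num.sqrt (u 0))^-1 * (2 * coord x i)).
  by apply: is_derive1_comp; apply: is_derive1_sqrt; rewrite u0.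
have := is_deriveV _ Ds; rewrite /= u0 => /(_ e0) H.
apply: is_derive_eq; rewrite /GRing.scale /= /inorm /enorm -/(normsq x).
field; exact: e0.
Qed.

Lemma rational_sum (I : Type) (r : seq I) (F : I -> R4 R -> R) :
  (forall i, rational (F i)) -> rational (fun x => \sum_(i <- r) F i x).
Proof.
move=> rF; elim: r => [|i r IH].
  by under eq_fun do rewrite big_nil; exact: rational_cst.
by under eq_fun do rewrite big_cons; exact: rationalD.
Qed.

Lemma rational_horner p f : rational f -> rational (fun x => p.[f x]).
Proof.
move=> rf; elim/poly_ind: p => [|p c IH].
  by under eq_fun do rewrite horner0; exact: rational_cst.
under eq_fun do rewrite hornerMXaddC.
by apply: rationalD; [exact: rationalM|exact: rational_cst].
Qed.

Lemma rational_derive f i : rational f -> exists2 g, rational g &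
  forall x, x != 0 -> is_derive x (axis i) f (g x).
Proof.
elim=> [c|j||f1 f2 _ [g1 r1 D1] _ [g2 r2 D2]|f1 f2 rf1 [g1 r1 D1] rf2 [g2 r2 D2]].
- by exists (fun=> 0); [exact: rational_cst|move=> x _; exact: is_derive_cst].
- exists (fun=> (i == j)%:R); first exact: rational_cst.
  by move=> x _; exact: is_derive_coord.
- exists (fun x => -1 * coord x i * (inorm x * inorm x * inorm x)).
    by repeat (apply: rationalM || exact: rational_cst || exact: rational_coord || exact: rational_inorm).
  move=> x x0; apply: is_derive_eq (is_derive_inorm i x0) _; ring.
- exists (fun x => g1 x + g2 x); first exact: rationalD.
  by move=> x x0; apply: is_deriveD; [exact: D1|exact: D2].
- exists (fun x => f1 x * g2 x + f2 x * g1 x).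
    by apply: rationalD; exact: rationalM.
  by move=> x x0; apply: is_deriveM; [exact: D1|exact: D2].
Qed.

Lemma continuous_coord i : continuous (fun x : R4 R => coord x i : R).
Proof.
have c1 : continuous (fun x : R4 R => x.1) by move=> x; exact: cvg_fst.
have c11 : continuous (fun x : R4 R => x.1.1).
  by move=> x; apply: cvg_comp (c1 x) _; exact: cvg_fst.
case: i => -[|[|[|[|//]]]] i4; rewrite /coord /tnth /= => x.
- by apply: cvg_comp (c11 x) _; exact: cvg_fst.
- by apply: cvg_comp (c11 x) _; exact: cvg_snd.
- by apply: cvg_comp (c1 x) _; exact: cvg_snd.
- exact: cvg_snd.
Qed.

Lemma continuous_enorm : continuous (enorm : R4 R -> R).
Proof.
move=> x; apply: continuous_comp; last exact: sqrt_continuous.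
rewrite (_ : (fun _ => _) = fun x : R4 R => coord x 0 * coord x 0 + coord x 1 * coord x 1 +
    coord x 2%:R * coord x 2%:R + coord x 3%:R * coord x 3%:R); last first.
  by apply/funext => y; rewrite normsqE /coord /= -!expr2.
by repeat (apply: cvgD || (apply: cvgM; exact: continuous_coord)).
Qed.

Lemma near_neq0 x : x != 0 -> \forall y \near x, y != 0.
Proof.
move=> x0; have e0 : enorm x != 0 by rewrite enorm_eq0.
have := cvgr_neq0 _ (@continuous_enorm x) e0 => /(_ _).
by under eq_near do rewrite enorm_eq0.
Qed.

Lemma rational_continuous f x : rational f -> x != 0 -> {for x, continuous f}.
Proof.
move=> rf x0; elim: rf => [c|j||f1 f2 _ IH1 _ IH2|f1 f2 _ IH1 _ IH2].
- exact: cst_continuous.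
- exact: continuous_coord.
- by apply: cvgV; [rewrite enorm_eq0|exact: continuous_enorm].
- exact: cvgD.
- exact: cvgM.
Qed.

Lemma rational_smooth f : rational f -> smooth_on [set x | x != 0] f.
Proof.
move=> rf s /= x x0.
have [g rg fg] : exists2 g, rational g & forall y, y != 0 -> foldr partial f s y = g y.
  elim: s => [|i s [g rg fg]]; first by exists f.
  have [h rh Dh] := rational_derive i rg.
  exists h => // y y0 /=; rewrite /partial.
  have -> : 'D_(axis i) (foldr partial f s) y = 'D_(axis i) g y.
    by apply: near_eq_derive; near do apply: fg; exact: near_neq0.
  by have [] := Dh _ y0.
have nfg : \near x, foldr partial f s x = g x by near do apply: fg; exact: near_neq0.
split.
  have gc : g @ x --> g x := rational_continuous rg x0.
  suff : foldr partial f s @ x --> foldr partial f s x by [].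
  rewrite fg//; apply: cvg_trans gc; apply: near_eq_cvg.
  by apply: filterS nfg => y ->.
move=> i; have [h rh Dh] := rational_derive i rg.
have [Dg _] := Dh _ x0.
by apply: near_eq_derivable Dg; apply: filterS nfg => y ->.
Unshelve. all: by end_near. Qed.

(** For p the derivative of q, the tangential gradient of y |-> q(<w, y>). *)
Definition ridge_field p w y i : R :=
  p.[dot w y] * (coord w i - dot w y * coord y i).

Definition ncoord i x : R := inorm x * coord x i.

Definition ndot w x : R := \sum_j coord w j * ncoord j x.

Lemma coord_normalize x i : coord (normalize x) i = ncoord i x.
Proof.
rewrite /ncoord /normalize /inorm scale4E /coord.
by case: i => -[|[|[|[|//]]]] i4.
Qed.

Lemma radial_ridge p w i : radial (fun y => ridge_field p w y i) =
  fun y => p.[ndot w y] * (coord w i - ndot w y * ncoord i y).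
Proof.
apply/funext => y; rewrite /radial /ridge_field coord_normalize.
have -> : dot w (normalize y) = ndot w y; last by [].
by apply: eq_bigr => j _; rewrite coord_normalize.
Qed.

Lemma smooth_ridge_field p w : smooth_field (ridge_field p w).
Proof.
have rn i : rational (ncoord i) by apply: rationalM; [exact: rational_inorm|exact: rational_coord].
have rd : rational (ndot w).
  by apply: rational_sum => j; apply: rationalM => //; exact: rational_cst.
split=> [i|x /SU2P x1].
  rewrite /smooth radial_ridge; apply: rational_smooth.
  apply: rationalM; first exact: rational_horner.
  apply: rationalD; first exact: rational_cst.
  under eq_fun do rewrite -mulN1r.
  by apply: rationalM; [exact: rational_cst|exact: rationalM].
rewrite (eq_bigr (fun i => p.[dot w x] * (coord w i * coord x i - dot w x * coord x i ^+ 2))).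
  rewrite -mulr_sumr sumrB -mulr_sumr -/(normsq x) x1 mulr1 -/(dot w x).
  by rewrite subrr mulr0.
by move=> i _; rewrite /ridge_field; ring.
Qed.

Lemma divergence_ridge p w x : normsq w = 1 -> normsq x = 1 ->
  divergence (ridge_field p^`() w) x = (lap p).[dot w x].
Proof.
move=> w1 x1.
have e1 : enorm x = 1 by rewrite /enorm -/(normsq x) x1 sqrtr1.
have x0 : x != 0 by rewrite -enorm_eq0 e1 oner_eq0.
have i1 : inorm x = 1 by rewrite /inorm e1 invr1.
have n1 j : ncoord j x = coord x j by rewrite /ncoord i1 mul1r.
have d1 : ndot w x = dot w x by apply: eq_bigr => j _; rewrite n1.
have Dn i j : is_derive x (axis i) (ncoord j) ((i == j)%:R - coord x i * coord x j).
  apply: is_derive_eq (is_deriveM (is_derive_inorm i x0) (is_derive_coord x i j)) _.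
  by rewrite i1 /GRing.scale /=; ring.
pose t := dot w x.
have Dd i : is_derive x (axis i) (ndot w) (coord w i - t * coord x i).
  rewrite (_ : ndot w = \sum_j (coord w j \*: ncoord j)); last first.
    by apply/funext => y; rewrite fct_sumE.
  apply: is_derive_eq.
  rewrite (eq_bigr (fun j => coord w j * (i == j)%:R - coord x i * (coord w j * coord x j))); last first.
    by move=> j _; rewrite /GRing.scale /=; ring.
  rewrite sumrB -mulr_sumr -/(dot w x) -/t mulrC; congr (_ - _).
  rewrite (bigD1 i)//= eqxx mulr1 big1 ?addr0// => j /negbTE ji.
  by rewrite eq_sym ji mulr0.
have E i : partial i (radial (ridge_field p^`() w ^~ i)) x =
    p^`()^`().[t] * (coord w i ^+ 2 - 2 * t * (coord w i * coord x i) + t ^+ 2 * coord x i ^+ 2)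
    - p^`().[t] * (coord w i * coord x i - 2 * t * coord x i ^+ 2 + t).
  rewrite /partial radial_ridge.
  have D : is_derive x (axis i) (fun y => coord w i - ndot w y * ncoord i y)
     (0 - (ndot w x *: (1 - coord x i * coord x i) + ncoord i x *: (coord w i - t * coord x i))).
    apply: is_deriveB; apply: is_derive_eq (is_deriveM (Dd i) (Dn i i)) _.
    by rewrite eqxx.
  have [_ ->] := is_deriveM (is_derive_horner p^`() (Dd i)) D.
  by rewrite /GRing.scale /= n1 d1 -/t; ring.
rewrite /divergence (eq_bigr _ (fun i _ => E i)).
rewrite sumrB -!mulr_sumr !big_split /= !sumrN -!mulr_sumr.
rewrite -/(normsq w) -/(normsq x) -/(dot w x) w1 x1 -/t sumr_const card_ord.
rewrite /lap hornerD hornerN hornerM hornerZ hornerM hornerD hornerN hornerXn hornerX hornerC.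
by rewrite -mulr_natl; ring.
Qed.

End smooth_ridge.

(** * Projections onto the spherical harmonics *)

Section projections.
Context {R : realType}.
Notation S3 := (SU2 R).
Implicit Types (x y z w : R4 R) (p q : {poly R}) (u v a : R4 R -> R).

(** The profile of the kernel of the projection onto the harmonics of degree n. *)
Definition zpoly n : {poly R} := (n.+1%:R / (2 * pi ^+ 2)) *: cheb n.

Lemma bil_zpoly x z m n : S3 x -> S3 z ->
  bil x z (zpoly m) (zpoly n) = (m == n)%:R * (zpoly n).[dot x z].
Proof.
move=> /SU2P x1 /SU2P z1; rewrite /zpoly bilZl bilZr hornerZ.
have [->|mn] := eqVneq m n; last by rewrite bil_cheb_neq// !mulr0 mul0r.
rewrite bil_cheb// mul1r.
have pi0 : pi != 0 :> R by rewrite gt_eqF// pi_gt0.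
by move: (@pi R) pi0 => c c0; field; rewrite c0 lt0r_neq0// ltr_wpDr.
Qed.

Definition zproj n u x : R := ip (fun y => (zpoly n).[dot x y]) u.

Lemma zproj_bounded n u : sphere_sqint u -> sphere_bounded (zproj n u).
Proof. by move=> su; exact: separable_ip_bounded (separable_ridge _) su. Qed.

Lemma zproj_sqint n u : sphere_sqint u -> sphere_sqint (zproj n u).
Proof. by move=> su; exact/sphere_bounded_sqint/zproj_bounded. Qed.

Lemma eq_zproj n u v x : (forall y, S3 y -> u y = v y) -> zproj n u x = zproj n v x.
Proof. by move=> uv; apply: eq_ip. Qed.

Lemma zprojD n u v x : sphere_sqint u -> sphere_sqint v ->
  zproj n (fun y => u y + v y) x = zproj n u x + zproj n v x.
Proof. by move=> su sv; rewrite /zproj ipDr//; exact: sqint_ridge. Qed.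

Lemma zprojZ n (c : R) u x : sphere_sqint u ->
  zproj n (fun y => c * u y) x = c * zproj n u x.
Proof. by move=> su; rewrite /zproj ipZr//; exact: sqint_ridge. Qed.

Lemma zproj_sym n u v : sphere_sqint u -> sphere_sqint v ->
  ip (zproj n u) v = ip u (zproj n v).
Proof.
move=> su sv; rewrite [LHS](separable_fubini (separable_ridge (zpoly n)) su sv) ipC.
by apply: eq_ip => // y _; apply: eq_ip => // x _; rewrite dotC.
Qed.

Lemma zproj_zproj m n u x : sphere_sqint u -> S3 x ->
  zproj n (zproj m u) x = (m == n)%:R * zproj n u x.
Proof.
move=> su Sx; rewrite /zproj ipC.
rewrite (separable_fubini (separable_ridge (zpoly m)) su (sqint_ridge _ _)).
rewrite -ipZl//; last exact: sqint_ridge.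
apply: eq_ip => // z Sz; rewrite [dot x z]dotC -bil_zpoly//.
by apply: eq_ip => // y _; rewrite dotC.
Qed.

Lemma ip_zproj_zproj m n u : sphere_sqint u ->
  ip (zproj m u) (zproj n u) = (m == n)%:R * ip u (zproj n u).
Proof.
move=> su; rewrite zproj_sym//; last exact: zproj_sqint.
rewrite -ipZr//; last exact: zproj_sqint.
apply: eq_ip => // x Sx; rewrite zproj_zproj//.
by have [->|mn] := eqVneq n m; rewrite ?mul0r.
Qed.

Definition psum m M u x : R := \sum_(m <= n < M) zproj n u x.

Lemma psum_sqint m M u : sphere_sqint u -> sphere_sqint (psum m M u).
Proof. by move=> su; apply: sphere_sqint_sum => n _; exact: zproj_sqint. Qed.

Lemma ip_psum m M u : sphere_sqint u ->
  ip u (psum m M u) = \sum_(m <= n < M) ip u (zproj n u).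
Proof. by move=> su; rewrite ip_sumr// => n _; exact: zproj_sqint. Qed.

Lemma ip_psum_psum m M u : sphere_sqint u ->
  ip (psum m M u) (psum m M u) = ip u (psum m M u).
Proof.
move=> su; rewrite ip_suml; last 2 first.
- by move=> n _; exact: zproj_sqint.
- exact: psum_sqint.
rewrite ip_psum//; apply: eq_big_nat => n mnM.
rewrite ip_sumr; last 2 first.
- by move=> k _; exact: zproj_sqint.
- exact: zproj_sqint.
rewrite (bigD1_seq n) ?iota_uniq ?mem_index_iota//=.
rewrite ip_zproj_zproj// eqxx mul1r big1 ?addr0// => k /negbTE kn.
by rewrite ip_zproj_zproj// eq_sym kn mul0r.
Qed.

Lemma ip_zproj_ge0 n u : sphere_sqint u -> 0 <= ip u (zproj n u).
Proof. by move=> su; have := ip_zproj_zproj n n su; rewrite eqxx mul1r => <-; exact: ip_ge0. Qed.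

Lemma ip_psum_compl m M u : sphere_sqint u ->
  ip (fun x => u x - psum m M u x) (fun x => u x - psum m M u x) =
  ip u u - \sum_(m <= n < M) ip u (zproj n u).
Proof.
move=> su; rewrite ip_sqrB//; last exact: psum_sqint.
by rewrite ip_psum_psum// ip_psum//; ring.
Qed.

Lemma psumD m M u v x : sphere_sqint u -> sphere_sqint v ->
  psum m M (fun y => u y + v y) x = psum m M u x + psum m M v x.
Proof. by move=> su sv; rewrite /psum -big_split; apply: eq_bigr => n _; rewrite zprojD. Qed.

Lemma psumZ m M (c : R) u x : sphere_sqint u ->
  psum m M (fun y => c * u y) x = c * psum m M u x.
Proof. by move=> su; rewrite /psum mulr_sumr; apply: eq_bigr => n _; rewrite zprojZ. Qed.

(** Finite combinations of eigenfunctions, seen as the functions that a partial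
    sum of the expansion reproduces. *)
Definition spectral a := sphere_bounded a /\
  exists M, forall M', (M <= M')%N -> forall x, S3 x -> psum 0 M' a x = a x.

Lemma spectralD a b : spectral a -> spectral b -> spectral (fun x => a x + b x).
Proof.
move=> [ba [M aM]] [bb [N bN]]; split; first exact: sphere_boundedD.
exists (maxn M N) => M'; rewrite geq_max => /andP[MM' NM'] x Sx.
by rewrite psumD ?aM ?bN//; exact: sphere_bounded_sqint.
Qed.

Lemma spectralZ (c : R) a : spectral a -> spectral (fun x => c * a x).
Proof.
move=> [ba [M aM]]; split; first exact: sphere_boundedZ.
exists M => M' MM' x Sx.
by rewrite psumZ ?aM//; exact: sphere_bounded_sqint.
Qed.

Lemma spectral_ext a b : (forall x, S3 x -> a x = b x) -> spectral a -> spectral b.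
Proof.
move=> ab [ba [M aM]]; split; first exact: sphere_bounded_ext ba.
exists M => M' MM' x Sx; rewrite -ab// -(aM M')//.
by apply: eq_bigr => n _; apply: eq_zproj => y Sy; rewrite ab.
Qed.

Lemma spectral_cheb w k : S3 w -> spectral (fun y => (cheb k).[dot w y]).
Proof.
move=> Sw; split; first exact/sphere_bounded_horner/sphere_bounded_dot.
exists k.+1 => M kM x Sx.
have pE n : zproj n (fun y => (cheb k).[dot w y]) x = (n == k)%:R * (cheb k).[dot w x].
  rewrite /zproj -[ip _ _]/(bil x w (zpoly n) (cheb k)) /zpoly bilZl.
  have [x1 w1] := (proj1 (SU2P x) Sx, proj1 (SU2P w) Sw).
  have [->|nk] := eqVneq n k; last by rewrite bil_cheb_neq// mulr0 mul0r.
  rewrite bil_cheb// mul1r dotC.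
  have pi0 : pi != 0 :> R by rewrite gt_eqF// pi_gt0.
  by move: (@pi R) pi0 => c c0; field; rewrite c0 lt0r_neq0// ltr_wpDr.
rewrite /psum (eq_bigr _ (fun n _ => pE n)) (bigD1_seq k) ?iota_uniq ?mem_index_iota//=.
by rewrite eqxx mul1r big1 ?addr0// => n /negbTE ->; rewrite mul0r.
Qed.

Lemma spectral0 : spectral (fun=> 0).
Proof.
have := spectralZ 0 (spectral_cheb 0 (proj2 (SU2P _) (normsq_axis 0))).
by apply: spectral_ext => x _; rewrite mul0r.
Qed.

Lemma spectral_sum (I : Type) (r : seq I) (F : I -> R4 R -> R) :
  (forall i, spectral (F i)) -> spectral (fun x => \sum_(i <- r) F i x).
Proof.
move=> sF; elim: r => [|i r IH].
  by apply: spectral_ext spectral0 => x _; rewrite big_nil.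
by apply: spectral_ext (spectralD (sF i) IH) => x _; rewrite big_cons.
Qed.

(** The degree of the profile bounds the harmonics involved; the length of w is
    absorbed in the profile. *)
Lemma spectral_ridge p w : spectral (fun y => p.[dot w y]).
Proof.
have unit q z : S3 z -> spectral (fun y => q.[dot z y]).
  move=> Sv; have [c] := cheb_basis (leqnn (size q)); move: (size q) => n qE.
  apply: (@spectral_ext (fun y => \sum_(k < n) c k * (cheb k).[dot z y])).
    by move=> y _; rewrite qE horner_sum; apply: eq_bigr => k _; rewrite hornerZ.
  by apply: spectral_sum => k; exact/spectralZ/spectral_cheb.
have [->|w0] := eqVneq w 0.
  apply: spectral_ext (unit (p.[0])%:P _ (proj2 (SU2P _) (normsq_axis 0))) => x _.
  by rewrite hornerC; congr (p.[_]); rewrite dotE /= !mul0r !addr0.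
apply: spectral_ext (unit (p \Po (enorm w *: 'X)) _ (enorm_normalize w0)) => x _.
rewrite horner_comp hornerZ hornerX /normalize dotZl mulrA mulfV ?mul1r//.
by rewrite enorm_eq0.
Qed.

End projections.

(** * Completeness of the spherical harmonics *)

Section density.
Context {R : realType}.
Notation S3 := (SU2 R).
Notation sigma := (surface R).
Implicit Types (x y z w : R4 R) (f g h a : R4 R -> R).

Let mS3 : measurable S3 := measurable_SU2.

Lemma ip_sqrD_le f g : sphere_sqint f -> sphere_sqint g ->
  ip (fun x => f x + g x) (fun x => f x + g x) <= 2 * ip f f + 2 * ip g g.
Proof.
move=> sf sg; have := ip_ge0 (fun x => f x - g x).
rewrite ip_sqrB// ipDl ?ipDr//; try exact: sphere_sqintD.
by rewrite (ipC g f); lra.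
Qed.

Lemma ip_cvg0 (h : nat -> R4 R -> R) g : (forall n, measurable_fun S3 (h n)) ->
  (forall x, S3 x -> h ^~ x @ \oo --> 0) -> sphere_sqint g ->
  (forall n x, S3 x -> `|h n x| <= g x) ->
  forall e, 0 < e -> exists n, ip (h n) (h n) < e.
Proof.
move=> mh h0 sg hg e e0.
have H := @dominated_cvg _ _ R sigma S3 mS3 (fun n x => (h n x * h n x)%:E)
  (fun=> 0%E) (fun x => (g x * g x)%:E).
have : (\int[sigma]_(x in S3) (h n x * h n x)%:E)%E @[n --> \oo] --> (0%E : \bar R).
  rewrite -[X in _ --> X](@integral0 _ _ R sigma S3).
  apply: H => //.
  - by move=> n; apply/measurable_EFinP; exact: measurable_funM.
  - move=> x Sx; apply/fine_cvgP; split; first by apply: nearW.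
    by rewrite -[X in _ --> X](mulr0 0); apply: cvgM; exact: h0.
  - exact: sphere_sqint_integrable.
  - move=> n x Sx; rewrite /= lee_fin normrM.
    have := hg n x Sx; have := normr_ge0 (h n x); nra.
move=> /fine_cvgP[_] /cvgrPdist_lt /(_ _ e0)[n _ /(_ n (leqnn n))].
rewrite /= sub0r normrN => hn; exists n.
by rewrite (le_lt_trans (ler_norm _)).
Qed.

(** Membership in the closure of the finite spectral combinations in L^2. *)
Definition dense f := sphere_sqint f /\
  forall e : R, 0 < e -> exists2 a, spectral a & ip (fun x => f x - a x) (fun x => f x - a x) < e.

Lemma spectral_sqint a : spectral a -> sphere_sqint a.
Proof. by move=> [ba _]; exact: sphere_bounded_sqint. Qed.

Lemma spectral_dense a : spectral a -> dense a.
Proof.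
move=> sa; split; first exact: spectral_sqint.
move=> e e0; exists a => //.
rewrite (_ : ip _ _ = 0)//; rewrite -[RHS](ip0l (fun=> 0)).
by apply: eq_ip => x _; rewrite subrr.
Qed.

Lemma denseD f g : dense f -> dense g -> dense (fun x => f x + g x).
Proof.
move=> [sf df] [sg dg]; split; first exact: sphere_sqintD.
move=> e e0; have e4 : 0 < e / 4 by rewrite divr_gt0.
have [a sa fa] := df _ e4; have [b sb gb] := dg _ e4.
exists (fun x => a x + b x); first exact: spectralD.
have := ip_sqrD_le (sphere_sqintB sf (spectral_sqint sa)) (sphere_sqintB sg (spectral_sqint sb)).
rewrite (@eq_ip _ _ _ (fun x => f x + g x - (a x + b x)) (fun x => f x + g x - (a x + b x))); last 2 first.
- by move=> x _; ring.
- by move=> x _; ring.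
lra.
Qed.

Lemma denseZ (c : R) f : dense f -> dense (fun x => c * f x).
Proof.
move=> [sf df]; split; first exact: sphere_sqintZ.
move=> e e0; have e4 : 0 < e / (c ^+ 2 + 1) by rewrite divr_gt0// ltr_wpDl// sqr_ge0.
have [a sa fa] := df _ e4.
exists (fun x => c * a x); first exact: spectralZ.
have sfa := sphere_sqintB sf (spectral_sqint sa).
rewrite (_ : ip _ _ = c * (c * ip (fun x => f x - a x) (fun x => f x - a x))); last first.
  rewrite -ipZr// -ipZl//; last exact: sphere_sqintZ.
  by apply: eq_ip => x _; ring.
have := ip_ge0 (fun x => f x - a x).
move: fa; rewrite ltr_pdivlMr ?ltr_wpDl ?sqr_ge0//.
move: (ip _ _) => u; nra.
Qed.

Lemma dense_ext f g : (forall x, S3 x -> f x = g x) -> dense f -> dense g.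
Proof.
move=> fg [sf df]; split; first exact: sphere_sqint_ext sf.
move=> e e0; have [a sa fa] := df _ e0; exists a => //.
by rewrite (@eq_ip _ _ _ (fun x => f x - a x) (fun x => f x - a x))// => x Sx; rewrite fg.
Qed.

(** By dominated convergence for the squares of the differences f - f_ n. *)
Lemma dense_lim (f_ : nat -> R4 R -> R) f g : (forall n, dense (f_ n)) ->
  measurable_fun S3 f ->
  (forall x, S3 x -> f_ ^~ x @ \oo --> f x) -> sphere_sqint g ->
  (forall n x, S3 x -> `|f_ n x| <= g x) -> dense f.
Proof.
move=> df mf ff sg fg.
have fg' x : S3 x -> `|f x| <= g x.
  move=> Sx; apply: (ler_cvg_to (cvg_norm (ff _ Sx)) (cvg_cst (g x))).
  by apply: nearW => n; exact: fg.
have sf : sphere_sqint f.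
  apply/sphere_sqintP; split=> //.
  apply: le_integrable (sphere_sqint_integrable sg sg) => //.
    by apply/measurable_EFinP; exact: measurable_funM.
  move=> x Sx; rewrite /= lee_fin !normrM.
  have := fg' x Sx; have := normr_ge0 (f x); have := ler_norm (g x).
  move: `|f x| `|g x| (g x) => u v t tv u0 ut; nra.
split=> // e e0.
have e4 : 0 < e / 4 by rewrite divr_gt0.
have [n hn] : exists n, ip (fun x => f x - f_ n x) (fun x => f x - f_ n x) < e / 4.
  apply: (@ip_cvg0 (fun n x => f x - f_ n x) (fun x => 2 * g x)) => //.
  - by move=> n; apply: measurable_funB => //; case: (df n) => -[].
  - move=> x Sx; rewrite -(subrr (f x)); apply: cvgB; [exact: cvg_cst|exact: ff].
  - exact: sphere_sqintZ.
  - move=> n x Sx; rewrite (le_trans (ler_normB _ _))//.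
    by have := fg n x Sx; have := fg' x Sx; lra.
have [sfn /(_ _ e4)[a sa ha]] := df n.
exists a => //.
have := ip_sqrD_le (sphere_sqintB sf sfn) (sphere_sqintB sfn (spectral_sqint sa)).
rewrite (@eq_ip _ _ _ (fun x => f x - a x) (fun x => f x - a x)); last 2 first.
- by move=> x _; ring.
- by move=> x _; ring.
lra.
Qed.

(** Exponentials span an algebra, because their products are exponentials; it is
    then stable under polynomials. *)
Inductive expalg : (R4 R -> R) -> Prop :=
| expalg_exp w : expalg (fun y => expR (dot w y))
| expalgD f g : expalg f -> expalg g -> expalg (fun y => f y + g y)
| expalgZ (c : R) f : expalg f -> expalg (fun y => c * f y).

Lemma expalg_ext f g : f =1 g -> expalg f -> expalg g.
Proof. by move=> /funext ->. Qed.

Lemma expalgM f g : expalg f -> expalg g -> expalg (fun y => f y * g y).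
Proof.
move=> ef eg; elim: ef => [w|f1 f2 _ IH1 _ IH2|c f' _ IH].
- elim: eg => [z|g1 g2 _ IH1 _ IH2|c g' _ IH].
  + by apply: expalg_ext (expalg_exp (w + z)) => y; rewrite dotDl expRD.
  + by apply: expalg_ext (expalgD IH1 IH2) => y; rewrite mulrDr.
  + by apply: expalg_ext (expalgZ c IH) => y; rewrite mulrCA.
- by apply: expalg_ext (expalgD IH1 IH2) => y; rewrite mulrDl.
- by apply: expalg_ext (expalgZ c IH) => y; rewrite mulrA.
Qed.

Lemma expalg_cst (c : R) : expalg (fun=> c).
Proof.
apply: expalg_ext (expalgZ c (expalg_exp 0)) => y.
by rewrite dotE /= !mul0r !addr0 expR0 mulr1.
Qed.

(** The Taylor polynomials of an exponential are ridge polynomials. *)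
Lemma expalg_dense f : expalg f -> dense f.
Proof.
elim=> [w|f1 f2 _ IH1 _ IH2|c f' _ IH]; [|exact: denseD|exact: denseZ].
have [_ [C dC]] := sphere_bounded_dot w.
have bexp : measurable_fun S3 (fun y => expR (dot w y)).
  apply: measurableT_comp => //.
  by apply: measurable_funTS; exact: measurable_dot.
apply: (@dense_lim (fun n y => series (exp_coeff (dot w y)) n) _ (fun=> expR C)) => //.
- move=> n; apply: spectral_dense.
  apply: spectral_ext (spectral_ridge (\sum_(0 <= k < n) (k`!%:R)^-1 *: 'X^k) w) => y _.
  rewrite /series /= horner_sum; apply: eq_bigr => k _.
  by rewrite hornerZ hornerXn /exp_coeff /= mulrC.
- move=> y _; exact: is_cvg_series_exp_coeff.
- exact/sphere_bounded_sqint/sphere_bounded_cst.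
- move=> n y Sy.
  apply: (@le_trans _ _ (series (exp_coeff `|dot w y|) n)).
    rewrite -normed_series_exp_coeff; exact: ler_norm_sum.
  apply: (@le_trans _ _ (expR `|dot w y|)); last by rewrite ler_expR dC.
  apply: nondecreasing_cvgn_le; last exact: is_cvg_series_exp_coeff.
  by apply: nondecreasing_series => k _ _; exact: exp_coeff_ge0.
Qed.

Lemma expalg_bounded f : expalg f -> exists C, forall x, S3 x -> `|f x| <= C.
Proof.
elim=> [w|f1 f2 _ [C1 H1] _ [C2 H2]|c f' _ [C H]].
- have [_ [C dC]] := sphere_bounded_dot w.
  exists (expR C) => x Sx; rewrite ger0_norm ?expR_ge0// ler_expR.
  by rewrite (le_trans _ (dC x Sx))// ler_norm.
- exists (C1 + C2) => x Sx; rewrite (le_trans (ler_normD _ _))// lerD//; [exact: H1|exact: H2].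
- by exists (`|c| * C) => x Sx; rewrite normrM ler_wpM2l// H.
Qed.

(** Newton's iteration for the sign: a polynomial map with the fixed points
    -1, 0, 1, attracting towards the signs on the interval between -1 and 1. *)
Definition newton (t : R) : R := t * (3 - t ^+ 2) / 2.

Lemma newton_pos (t : R) n : 0 < t <= 1 ->
  t <= iter n newton t <= 1 /\ 1 - iter n newton t <= (1 - t / 2) ^+ n.
Proof.
move=> /andP[t0 t1]; elim: n => [|n [/andP[IH1 IH2] IH3]].
  by rewrite /= lexx t1 expr0; split=> //; lra.
rewrite /=; move: (iter n newton t) IH1 IH2 IH3 => u ut u1 IH3.
have E : 1 - newton u = (1 - u) * ((1 - u) * (2 + u) / 2) by rewrite /newton; field.
have E2 : newton u - u = u * (1 - u) * (1 + u) / 2 by rewrite /newton; field.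
have h1 : 0 <= (1 - u) * (2 + u) / 2 <= 1 - t / 2 by apply/andP; split; nra.
have h2 : u <= newton u by rewrite -subr_ge0 E2; nra.
have h3 : newton u <= 1 by rewrite -subr_ge0 E; nra.
split; first by rewrite h3 andbT (le_trans ut).
rewrite E exprS mulrC; case/andP: h1 => h1 h1'.
by apply: ler_pM => //; lra.
Qed.

Lemma iter_newtonN (t : R) n : iter n newton (- t) = - iter n newton t.
Proof. by elim: n => //= n ->; rewrite /newton sqrrN !mulNr. Qed.

Lemma iter_newton0 n : iter n newton 0 = 0.
Proof. by elim: n => //= n ->; rewrite /newton !mul0r. Qed.

Lemma newton_cvg (t : R) : 0 < t <= 1 -> iter n newton t @[n --> \oo] --> (1 : R).
Proof.
move=> t01; case/andP: (t01) => t0 t1.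
have H : (fun n => (1 - t / 2) ^+ n) @ \oo --> (0 : R).
  by apply: cvg_expr; rewrite ger0_norm; lra.
have H' : (fun n => 1 - (1 - t / 2) ^+ n) @ \oo --> (1 : R).
  by rewrite -[X in _ --> X]subr0; apply: cvgB => //; exact: cvg_cst.
apply: (squeeze_cvgr _ H' (cvg_cst _)).
apply: nearW => n; have [/andP[_ h1] h2] := newton_pos n t01.
by rewrite h1 andbT; lra.
Qed.

Lemma newton_le1 (t : R) n : `|t| <= 1 -> `|iter n newton t| <= 1.
Proof.
wlog t0 : t / 0 <= t => [H|].
  case: (lerP 0 t) => [/H //|/ltW t0 t1].
  by rewrite -[t]opprK iter_newtonN normrN H ?normrN// oppr_ge0.
rewrite ger0_norm// => t1; have [->|t_neq0] := eqVneq t 0.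
  by rewrite iter_newton0 normr0.
have t01 : 0 < t <= 1 by rewrite t1 lt_neqAle eq_sym t_neq0 t0.
have [/andP[h1 h2] _] := newton_pos n t01.
by rewrite ger0_norm// (le_trans t0).
Qed.

(** (u + u^2) / 2 sends the possible limits -1, 0, 1 of the iteration to 0, 0, 1. *)
Definition step_seq (t : R) n : R := (iter n newton t + iter n newton t ^+ 2) / 2.

Lemma step_seq_cvg (t : R) : `|t| <= 1 -> step_seq t @ \oo --> ((0 < t)%R%:R : R).
Proof.
move=> t1; have H (l : R) : iter n newton t @[n --> \oo] --> l ->
    step_seq t @ \oo --> (l + l * l) / 2.
  move=> hl; apply: cvgM; last exact: cvg_cst.
  apply: cvgD => //; under eq_fun do rewrite expr2.
  exact: cvgM.
have [t0|t0|t0] := ltrgtP 0 t.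
- have := H 1; rewrite mulr1 divff ?pnatr_eq0//; apply.
  by apply: newton_cvg; rewrite t0 -(gtr0_norm t0).
- have := H (-1); rewrite mulrNN mulr1 addNr mul0r; apply.
  rewrite (_ : (fun n => _) = (fun n => - iter n newton (- t))); last first.
    by apply/funext => n; rewrite iter_newtonN opprK.
  apply: cvgN; apply: newton_cvg.
  by rewrite oppr_gt0 t0 -(ltr0_norm t0).
- have := H 0; rewrite mulr0 addr0 mul0r; apply.
  rewrite -t0 (_ : (fun n => _) = fun=> 0); first exact: cvg_cst.
  by apply/funext => n; rewrite iter_newton0.
Qed.

Lemma step_seq_le1 (t : R) n : `|t| <= 1 -> `|step_seq t n| <= 1.
Proof.
move=> /(newton_le1 n); rewrite /step_seq; move: (iter _ _ _) => u.
by rewrite !ler_norml => /andP[u1 u2]; apply/andP; split; nra.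
Qed.

Lemma expalg_step f n : expalg f -> expalg (fun y => step_seq (f y) n).
Proof.
move=> ef.
have ei : expalg (fun y => iter n newton (f y)).
  elim: n => // n IH /=.
  apply: expalg_ext (expalgZ 2^-1 (expalgM IH (expalgD (expalg_cst 3) (expalgZ (-1) (expalgM IH IH))))) => y.
  by rewrite /newton; ring.
apply: expalg_ext (expalgZ 2^-1 (expalgD ei (expalgM ei ei))) => y.
by rewrite /step_seq; ring.
Qed.

(** Pointwise limits of uniformly bounded members of the algebra multiply, which
    makes this class stable under intersection. *)
Definition limset (A : set (R4 R)) := measurable A /\
  exists f : nat -> R4 R -> R, (forall n, expalg (f n)) /\
    forall x, S3 x -> (forall n, `|f n x| <= 1) /\ f ^~ x @ \oo --> (\1_A x : R).

Lemma limsetI : setI_closed limset.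
Proof.
move=> A B [mA [f [ef fA]]] [mB [g [eg gB]]]; split; first exact: measurableI.
exists (fun n x => f n x * g n x); split=> [n|x Sx]; first exact: expalgM.
have [f1 fc] := fA x Sx; have [g1 gc] := gB x Sx; split=> [n|].
  by rewrite normrM mulr_ile1.
by rewrite indicI; exact: cvgM.
Qed.

(** The function exp (x_i) - exp a has the sign of x_i - a; it is scaled into the
    basin of the iteration. *)
Lemma limset_coord i (a : R) : limset [set y | a < coord y i].
Proof.
split.
  rewrite (_ : [set y | _] = (coord ^~ i) @^-1` `]a, +oo[).
    rewrite -[X in measurable X]setTI; exact: measurable_coord.
  by apply/seteqP; split=> y /=; rewrite in_itv/= andbT.
have e1 : expalg (fun y => expR (dot (axis i) y) - expR a).
  by apply: expalg_ext (expalgD (expalg_exp (axis i)) (expalg_cst (- expR a))).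
have [C HC] := expalg_bounded e1.
pose c := (`|C| + 1)^-1.
have c0 : 0 < c by rewrite invr_gt0 ltr_wpDl.
exists (fun n y => step_seq (c * (expR (dot (axis i) y) - expR a)) n); split=> [n|x Sx].
  exact/expalg_step/expalgZ.
have h1 : `|c * (expR (dot (axis i) x) - expR a)| <= 1.
  rewrite normrM (gtr0_norm c0) -ler_pdivlMl// invrK mulr1.
  by rewrite (le_trans (HC x Sx))// (le_trans (ler_norm _))// lerDl.
split=> [n|]; first exact: step_seq_le1.
rewrite indicE; have := step_seq_cvg h1; rewrite pmulr_rgt0// subr_gt0 ltr_expR dot_axis.
have -> : (x \in [set y | a < coord y i]) = (a < coord x i) by apply/idP/idP; rewrite inE.
by [].
Qed.

Lemma limset_dense A : limset A -> dense \1_A.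
Proof.
move=> [mA [f [ef fA]]].
apply: (@dense_lim f _ (fun=> 1)) => //.
- by move=> n; exact: expalg_dense.
- by move=> x Sx; case: (fA x Sx).
- exact/sphere_bounded_sqint/sphere_bounded_cst.
- by move=> n x Sx; case: (fA x Sx).
Qed.

Lemma denseB f g : dense f -> dense g -> dense (fun x => f x - g x).
Proof.
move=> df dg; apply: dense_ext (denseD df (denseZ (-1) dg)) => x _.
by rewrite mulN1r.
Qed.

Lemma dense_sum (I : Type) (r : seq I) (F : I -> R4 R -> R) :
  (forall i, dense (F i)) -> dense (fun x => \sum_(i <- r) F i x).
Proof.
move=> dF; elim: r => [|i r IH].
  apply: dense_ext (spectral_dense spectral0) => x _; by rewrite big_nil.
by apply: dense_ext (denseD (dF i) IH) => x _; rewrite big_cons.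
Qed.

(** The half-spaces make the coordinates, hence the identity, measurable from the
    sigma-algebra generated by [limset]. *)
Lemma sigma_limset (A : set (R4 R)) : measurable A -> (<<s limset >>) A.
Proof.
pose T := g_sigma_algebraType limset.
have mc i : measurable_fun [set: T] (fun x : T => coord (x : R4 R) i).
  move=> mT; apply: (measurability _ (RGenOInfty.measurableE R)) => //.
  move=> _ [_ [a ->] <-]; rewrite setTI.
  rewrite (_ : _ @^-1` _ = [set y | a < coord y i]); last first.
    by apply/seteqP; split=> y /=; rewrite in_itv/= andbT.
  by apply: sub_sigma_algebra; exact: limset_coord.
have mid : measurable_fun [set: T] (fun x : T => (x : R4 R)).
  rewrite (_ : (fun x => x) = fun x : T => (coord (x : R4 R) 0, coord (x : R4 R) 1,
    coord (x : R4 R) 2%:R, coord (x : R4 R) 3%:R)); last by apply/funext => -[[[]]].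
  by do 3 (apply: measurable_fun_pair => //).
by move=> mA; have := mid measurableT A mA; rewrite setTI.
Qed.

(** The indicators in the closure form a Dynkin system containing the
    intersection-stable class of the half-spaces. *)
Lemma dense_indic (A : set (R4 R)) : measurable A -> dense \1_A.
Proof.
move=> mA; pose H := [set B | measurable B /\ dense (\1_B : R4 R -> R)].
suff : H A by case.
apply: (@lambda_system_subset _ limset limsetI setT H) (sigma_limset mA) => //.
  split=> //.
  - split=> //; apply: dense_ext (expalg_dense (expalg_cst 1)) => x _.
    by rewrite indicT.
  - move=> B C CB [mB dB] [mC dC]; split; first exact: measurableD.
    apply: dense_ext (denseB dB dC) => x _; rewrite !indicE in_setD.
    have [xC|] := boolP (x \in C); last by rewrite subr0 andbT.
    by rewrite (mem_set (CB _ (set_mem xC))) subrr.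
  - move=> F ndF HF; split; first by apply: bigcupT_measurable => n; case: (HF n).
    apply: (@dense_lim (fun n => \1_(F n)) _ (fun=> 1)) => //.
    + by move=> n; case: (HF n).
    + apply: measurable_funTS; apply: measurable_indic.
      by apply: bigcupT_measurable => n; case: (HF n).
    + move=> x _; have [[n _ Fx]|nFx] := pselect ((\bigcup_n F n) x).
        apply: cvg_near_cst; exists n => // m /= nm.
        rewrite !indicE !mem_set//; first by exists n.
        by move/subsetPset: (ndF _ _ nm); exact.
      apply: cvg_near_cst; apply: nearW => n; rewrite !indicE !memNset//.
      by move=> Fx; apply: nFx; exists n.
    + exact/sphere_bounded_sqint/sphere_bounded_cst.
    + by move=> n x _; rewrite indicE; case: (_ \in _); rewrite ?normr1 ?normr0.
by move=> B lB; split; [case: lB|exact: limset_dense].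
Qed.

Import HBSimple HBNNSimple.

Lemma dense_nnfun f : sphere_sqint f -> (forall x, S3 x -> 0 <= f x) -> dense f.
Proof.
move=> sf f0; have [mf _] := sf.
have mEf : measurable_fun S3 (fun x => (f x)%:E) by exact/measurable_EFinP.
pose fn := nnsfun_approx mS3 mEf.
have f0E x : S3 x -> (0 <= (f x)%:E)%E by move=> Sx; rewrite lee_fin f0.
have fnc x : S3 x -> (fun n => fn n x) @ \oo --> f x.
  move=> Sx; have /fine_cvgP[_] := @cvg_nnsfun_approx _ _ _ _ mS3 _ mEf f0E x Sx.
  exact.
apply: (@dense_lim (fun n => fn n) f f) => //.
- move=> n; apply: (dense_ext (fun x _ => esym (fimfunEord (fn n) x))).
  apply: dense_sum => i; apply: denseZ; apply: dense_indic.
  exact: measurable_sfunP.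
- move=> n x Sx; rewrite ger0_norm; last exact: fun_ge0.
  have nd : nondecreasing_seq (fun n => fn n x).
    by move=> m k mk; have /lefP := nd_nnsfun_approx mS3 mEf mk; exact.
  rewrite -(cvg_lim _ (fnc x Sx))//; apply: nondecreasing_cvgn_le => //.
  by apply/cvg_ex; exists (f x); exact: fnc.
Qed.

Lemma sqint_dense f : sphere_sqint f -> dense f.
Proof.
have pos g : sphere_sqint g -> dense (fun x => Num.max (g x) 0).
  move=> sg; apply: dense_nnfun; last by move=> x _; rewrite le_max lexx orbT.
  have [mg _] := sg; have mm : measurable_fun S3 (fun x => Num.max (g x) 0).
    exact: measurable_maxr.
  apply/sphere_sqintP; split=> //.
  apply: le_integrable (sphere_sqint_integrable sg sg) => //.
    by apply/measurable_EFinP; exact: measurable_funM.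
  move=> x Sx; rewrite /= lee_fin !normrM.
  have h : `|Num.max (g x) 0| <= `|g x|.
    by case: (leP (g x) 0) => _; rewrite ?normr0.
  exact: ler_pM.
move=> sf; apply: dense_ext (denseB (pos _ sf) (pos _ (sphere_sqintZ (-1) sf))) => x _.
by rewrite mulN1r; case: (leP (f x) 0); case: (leP (- f x) 0) => /=; lra.
Qed.

(** The complement of [psum 0 M] contracts, and eventually annihilates each
    member of a dense family. *)
Lemma psum_complete f : sphere_sqint f -> forall e, 0 < e ->
  exists M0, forall M, (M0 <= M)%N ->
    ip (fun x => f x - psum 0 M f x) (fun x => f x - psum 0 M f x) < e.
Proof.
move=> sf e e0; have [_ /(_ _ e0)[a sa fa]] := sqint_dense sf.
have [_ [M0 aM]] := sa; exists M0 => M M0M.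
have sfa := sphere_sqintB sf (spectral_sqint sa).
have E x : S3 x -> f x - psum 0 M f x = f x - a x - psum 0 M (fun y => f y - a y) x.
  move=> Sx; rewrite -[X in _ - X - _](aM M)//.
  have -> : psum 0 M f x = psum 0 M (fun y => (f y - a y) + a y) x.
    by apply: eq_bigr => n _; apply: eq_zproj => y _; rewrite subrK.
  by rewrite psumD//; [ring|exact: spectral_sqint].
rewrite (eq_ip E E) ip_psum_compl//.
rewrite (le_lt_trans _ fa)// gerBl; apply: sumr_ge0 => n _.
exact: ip_zproj_ge0.
Qed.

End density.

(** * The spectral bound on the energy *)

Section energy.
Context {R : realType}.
Notation S3 := (SU2 R).
Implicit Types (x y z w : R4 R) (u v : R4 R -> R) (p q : {poly R}).

Lemma separable_ridge_field p i : separable (fun w y => ridge_field p w y i).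
Proof.
apply: separableM; first exact: separable_ridge.
have sw : separable (fun w y : R4 R => coord w i).
  apply: separable_ext (separable_prod (sphere_bounded_coord i) (sphere_bounded_cst 1)) => w y _ _.
  by rewrite mulr1.
have sy : separable (fun w y : R4 R => coord y i).
  apply: separable_ext (separable_prod (sphere_bounded_cst 1) (sphere_bounded_coord i)) => w y _ _.
  by rewrite mul1r.
apply: separable_ext (separableD sw (separableM (separable_ridge (- 'X)) sy)) => w y _ _.
by rewrite hornerN hornerX mulNr.
Qed.

Lemma ip_subE f g f' g' : sphere_sqint f -> sphere_sqint g ->
  sphere_sqint f' -> sphere_sqint g' ->
  ip f g - ip f' g' = ip (fun x => f x * g x - f' x * g' x) (fun=> 1).
Proof.
move=> sf sg sf' sg'; rewrite /ip -RintegralB; first last.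
- exact: sphere_sqint_integrable.
- exact: sphere_sqint_integrable.
- exact: measurable_SU2.
by apply: eq_Rintegral => x _; rewrite mulr1.
Qed.

(** Green's formula read on the gradients. *)
Lemma ip_ridge_field p q w z : S3 w -> S3 z ->
  \sum_i ip (fun y => ridge_field p^`() w y i) (fun y => ridge_field q^`() z y i) =
  - bil w z (lap p) q.
Proof.
move=> Sw Sz; have w1 := (proj1 (SU2P _) Sw); have z1 := proj1 (SU2P _) Sz.
have sb p' (v : R4 R) i : S3 v -> sphere_bounded (fun y => ridge_field p' v y i).
  by move=> Sv; exact: separable_boundedr (separable_ridge_field p' i) Sv.
transitivity (\sum_i ip (fun y => ridge_field p^`() w y i * ridge_field q^`() z y i) (fun=> 1)).
  by apply: eq_bigr => i _; apply: eq_Rintegral => y _; rewrite mulr1.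
rewrite -ip_suml; last 2 first.
- by move=> i _; apply: sphere_bounded_sqint; apply: sphere_boundedM; exact: sb.
- exact/sphere_bounded_sqint/sphere_bounded_cst.
transitivity (dot w z * bil w z p^`() q^`() - bil w z ('X * p^`()) ('X * q^`())).
  rewrite /bil.
  rewrite -ipZl; try exact: sqint_ridge.
  rewrite ip_subE; try exact: sqint_ridge; last exact/sphere_sqintZ/sqint_ridge.
  apply: eq_ip => // y /SU2P y1; rewrite /ridge_field !hornerM !hornerX.
  set P := p^`().[_]; set Q := q^`().[_].
  have [s es] : exists s, s = dot w y by exists (dot w y).
  have [t et] : exists t, t = dot z y by exists (dot z y).
  rewrite -es -et.
  transitivity (P * Q * (dot w z - t * dot w y - s * dot z y + s * t * normsq y)).
    rewrite /dot /normsq !big_ord_recr !big_ord0 /=; ring.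
  by rewrite y1 -es -et; ring.
by have := green p q w1 z1; lra.
Qed.

Definition zsum M : {poly R} := \sum_(n < M) zpoly n.

Lemma lap_zsum M : lap (zsum M) = - \sum_(n < M) (n * n.+2)%:R *: zpoly n.
Proof.
have lap0 : lap (0 : {poly R}) = 0 by rewrite /lap !deriv0 !mulr0 scaler0 subr0.
rewrite /zsum; elim: M => [|M IH]; first by rewrite !big_ord0 lap0 oppr0.
rewrite !big_ord_recr/= addrC [in LHS]/zpoly lap_lin IH lap_cheb opprD addrC.
by congr (_ + _); rewrite /zpoly !scalerA -scaleNr; congr (_ *: _); rewrite mulrN mulrC.
Qed.

(** A is compared with the field B obtained by integrating the gradients, in y, of
    the kernel zsum M (<w, y>) against u(w). Exchanging the integrals, the weak
    equation computes <A, B> and Green's formula computes <B, B>: both are the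
    left-hand side. *)
Lemma energy (u : R4 R -> R) (A : 'I_4 -> R4 R -> R) M : sphere_sqint u ->
  (forall i, sphere_sqint (A i)) ->
  (forall w p, S3 w -> \sum_i ip (A i) (fun y => ridge_field p^`() w y i) =
     - ip u (fun y => (lap p).[dot w y])) ->
  \sum_(n < M) (n * n.+2)%:R * ip u (zproj n u) <= \sum_i ip (A i) (A i).
Proof.
move=> su sA wA.
pose K i w y := ridge_field (zsum M)^`() w y i.
have sK i : separable (K i) by exact: separable_ridge_field.
pose B i y := ip (K i ^~ y) u.
have bB i : sphere_bounded (B i) := separable_ip_bounded (separableC (sK i)) su.
have sB i : sphere_sqint (B i) := sphere_bounded_sqint (bB i).
have ipAK i (v : R4 R -> R) : sphere_sqint v -> ip v (B i) = ip (fun w => ip v (K i w)) u.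
  move=> sv; rewrite ipC (separable_fubini (separableC (sK i)) su sv).
  by apply: eq_ip => // w _; exact: ipC.
have sumAK (V : 'I_4 -> R4 R -> R) : (forall i, sphere_sqint (V i)) ->
    (forall w, S3 w -> \sum_i ip (V i) (K i w) = \sum_(n < M) (n * n.+2)%:R * zproj n u w) ->
    \sum_i ip (V i) (B i) = \sum_(n < M) (n * n.+2)%:R * ip u (zproj n u).
  move=> sV VK; under eq_bigr do rewrite ipAK//.
  rewrite -ip_suml//; last first.
    move=> i _; apply: sphere_bounded_sqint.
    apply: sphere_bounded_ext (separable_ip_bounded (sK i) (sV i)) => w _; exact: ipC.
  rewrite (eq_ip VK (fun x _ => erefl)) ip_suml//; last first.
    by move=> n _; exact/sphere_sqintZ/zproj_sqint.
  by apply: eq_bigr => n _; rewrite ipZl 1?ipC//; exact: zproj_sqint.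
have AB : \sum_i ip (A i) (B i) = \sum_(n < M) (n * n.+2)%:R * ip u (zproj n u).
  apply: sumAK => // w Sw; rewrite wA// lap_zsum.
  transitivity (ip u (fun y => \sum_(n < M) (n * n.+2)%:R * (zpoly n).[dot w y])).
    rewrite -[LHS]mulN1r -ipZr//; last exact: sqint_ridge.
    apply: eq_ip => // y _; rewrite hornerN horner_sum mulN1r opprK.
    by apply: eq_bigr => n _; rewrite hornerZ.
  rewrite ip_sumr//; last by move=> n _; exact/sphere_sqintZ/sqint_ridge.
  by apply: eq_bigr => n _; rewrite ipZr 1?ipC//; exact: sqint_ridge.
have BB : \sum_i ip (B i) (B i) = \sum_(n < M) (n * n.+2)%:R * ip u (zproj n u).
  apply: sumAK => // w Sw.
  transitivity (ip (fun z => \sum_i ip (K i z) (K i w)) u).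
    rewrite ip_suml//; last first.
      move=> i _; apply: sphere_bounded_sqint.
      apply: separable_ip_bounded; first exact: sK.
      exact/sphere_bounded_sqint/(separable_boundedr (sK i) Sw).
    apply: eq_bigr => i _; rewrite ipC [RHS](separable_fubini (sK i))//; last first.
      exact/sphere_bounded_sqint/(separable_boundedr (sK i) Sw).
    by rewrite ipC; apply: eq_ip => // y _; exact: ipC.
  transitivity (ip (fun z => \sum_(n < M) (n * n.+2)%:R * (zpoly n).[dot w z]) u).
    apply: eq_ip => // z Sz; rewrite ip_ridge_field// lap_zsum -[- \sum_(n < M) _]scaleN1r bilZl mulN1r opprK bil_suml.
    apply: eq_bigr => n _; rewrite bilZl; congr (_ * _).
    rewrite bilC /zsum bil_suml (bigD1 n)//= bil_zpoly// eqxx mul1r big1 ?addr0// => m mn.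
    by rewrite bil_zpoly// (negbTE mn : (m == n :> nat) = false) mul0r.
  rewrite ip_suml//; last by move=> n _; exact/sphere_sqintZ/sqint_ridge.
  by apply: eq_bigr => n _; rewrite ipZl//; exact: sqint_ridge.
have : 0 <= \sum_i ip (fun y => A i y - B i y) (fun y => A i y - B i y).
  by apply: sumr_ge0 => i _; exact: ip_ge0.
under eq_bigr do rewrite ip_sqrB//.
by rewrite big_split/= sumrB -mulr_sumr AB BB; lra.
Qed.

(** Summation by parts; the boundary term is controlled by the remaining
    energy because the eigenvalues increase. *)
Lemma abel_tail (lam e : nat -> R) (E S : R) :
  lam 0%N = 0 -> (forall m n, (m <= n)%N -> lam m <= lam n) -> (forall k, 0 <= e k) ->
  (forall eps, 0 < eps -> exists M0, forall M, (M0 <= M)%N ->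
     E - \sum_(1 <= k < M) e k < eps) ->
  (forall M, \sum_(k < M) lam k * e k <= S) ->
  forall M, \sum_(n < M) (lam n.+1 - lam n) * (E - \sum_(1 <= k < n.+1) e k) <= S.
Proof.
move=> lam0 ndlam e0 eE eS M; apply/ler_addgt0Pr => eps eps0.
pose d n := E - \sum_(1 <= k < n.+1) e k.
have dS n : d n.+1 = d n - e n.+1 by rewrite /d big_nat_recr//=; ring.
have abel : \sum_(n < M) (lam n.+1 - lam n) * d n =
    lam M * d M + \sum_(k < M.+1) lam k * e k.
  elim: M => [|M IH]; first by rewrite big_ord0 big_ord1 lam0 !mul0r addr0.
  by rewrite !(big_ord_recr M.+1)/= big_ord_recr/= IH dS; ring.
have tail j : lam M * d M + \sum_(k < M.+1) lam k * e k <=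
    lam M * d (M + j)%N + \sum_(k < (M + j).+1) lam k * e k.
  elim: j => [|j IH]; first by rewrite addn0.
  rewrite (le_trans IH)// addnS dS [in leRHS]big_ord_recr/=.
  have h : lam M <= lam (M + j).+1 by rewrite ndlam// leqW// leq_addr.
  have := e0 (M + j).+1; nra.
have lamM : 0 <= lam M by rewrite -lam0 ndlam.
have [M0 hM0] : exists M0, forall M', (M0 <= M')%N -> E - \sum_(1 <= k < M') e k < eps / (lam M + 1).
  by apply: eE; rewrite divr_gt0// ltr_wpDl.
have := hM0 (M + M0).+1; rewrite -/(d _) leqW ?leq_addl// => /(_ isT).
rewrite ltr_pdivlMr ?ltr_wpDl// -/(d) => dM.
rewrite [leLHS]abel (le_trans (tail M0))// addrC lerD//.
have [d0|d0] := lerP 0 (d (M + M0)%N); first by nra.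
by rewrite (le_trans _ (ltW eps0))// mulr_ge0_le0// ltW.
Qed.

Lemma zproj0 (u : R4 R -> R) x : sphere_sqint u -> ip u (fun=> 1) = 0 -> zproj 0 u x = 0.
Proof.
move=> su u0; rewrite /zproj ipC.
rewrite (@eq_ip _ u _ u (fun=> (1%:R / (2 * pi ^+ 2)) * 1))//.
  by rewrite ipZr ?u0 ?mulr0//; exact/sphere_bounded_sqint/sphere_bounded_cst.
by move=> y _; rewrite /zpoly hornerZ hornerC.
Qed.

(** The mode 0 of the expansion vanishes with the mean of u, so that the sums start
    at 1. *)
Lemma energy_tail (u : R4 R -> R) (A : 'I_4 -> R4 R -> R) M : sphere_sqint u ->
  (forall i, sphere_sqint (A i)) -> ip u (fun=> 1) = 0 ->
  (forall w p, S3 w -> \sum_i ip (A i) (fun y => ridge_field p^`() w y i) =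
     - ip u (fun y => (lap p).[dot w y])) ->
  \sum_(n < M) ((n.+1 * n.+3)%:R - (n * n.+2)%:R) *
    ip (fun x => u x - psum 1 n.+1 u x) (fun x => u x - psum 1 n.+1 u x)
  <= \sum_i ip (A i) (A i).
Proof.
move=> su sA u0 wA.
under eq_bigr do rewrite ip_psum_compl//.
apply: (@abel_tail (fun n => (n * n.+2)%:R) (fun k => ip u (zproj k u))) => //.
- by move=> m n mn; rewrite ler_nat leq_mul.
- by move=> k; exact: ip_zproj_ge0.
- move=> eps eps0; have [M0 hM0] := psum_complete su eps0.
  exists M0.+1 => -[//|N] /= M0N.
  have := hM0 _ (leqW M0N); rewrite ip_psum_compl// (big_ltn (ltn0Sn N)).
  rewrite (@eq_ip _ u (zproj 0 u) u (fun=> 0))//; last by move=> x _; exact: zproj0.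
  by rewrite [ip u (fun=> 0)]ipC ip0l add0r.
- by move=> N; exact: energy.
Qed.

End energy.

(** * The inequalities behind Rumin's method *)

Section rumin_inequalities.
Context {R : realType}.

(** The primitive of 140 x^3 (Q - x^3)^2; the factor 140 clears the denominators. *)
Definition rumin_primitive (Q x : R) : R :=
  35 * Q ^+ 2 * x ^+ 4 - 40 * Q * x ^+ 7 + 14 * x ^+ 10.

(** The left-hand side is the integral of 140 x^3 (Q - x^3)^2 between a and b;
    replacing x^3 by a^3 in the square increases it. The difference is affine in
    Q, so that it suffices to look at Q = b^3, where all the coefficients in a
    and b - a are nonnegative. *)
Lemma rumin_increment (Q a b : R) : 0 <= a -> a <= b -> b ^+ 3 <= Q ->
  rumin_primitive Q b - rumin_primitive Q a <=
  35 * ((b ^+ 4 - a ^+ 4) * (Q - a ^+ 3) ^+ 2).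
Proof.
move=> a0 ab; have [h [h0 ->]] : exists h, 0 <= h /\ b = a + h.
  by exists (b - a); rewrite subr_ge0 addrC subrK.
move=> bQ; rewrite -subr_ge0.
have -> : 35 * (((a + h) ^+ 4 - a ^+ 4) * (Q - a ^+ 3) ^+ 2) -
    (rumin_primitive Q (a + h) - rumin_primitive Q a) =
  (Q - (a + h) ^+ 3) * (40 * h ^+ 7 + 280 * a * h ^+ 6 + 840 * a ^+ 2 * h ^+ 5
     + 1330 * a ^+ 3 * h ^+ 4 + 1120 * a ^+ 4 * h ^+ 3 + 420 * a ^+ 5 * h ^+ 2) +
  (26 * h ^+ 10 + 260 * a * h ^+ 9 + 1170 * a ^+ 2 * h ^+ 8
     + 3050 * a ^+ 3 * h ^+ 7 + 4970 * a ^+ 4 * h ^+ 6 + 5082 * a ^+ 5 * h ^+ 5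
     + 3045 * a ^+ 6 * h ^+ 4 + 840 * a ^+ 7 * h ^+ 3).
  by rewrite /rumin_primitive; ring.
have Qb : 0 <= Q - (a + h) ^+ 3 by rewrite subr_ge0.
have H (c : nat) i j : 0 <= c%:R * a ^+ i * h ^+ j by rewrite !mulr_ge0 ?exprn_ge0.
have H0 (c : nat) j : 0 <= c%:R * h ^+ j by rewrite !mulr_ge0 ?exprn_ge0.
have H1 (c : nat) j : 0 <= c%:R * a * h ^+ j by rewrite !mulr_ge0 ?exprn_ge0.
by rewrite addr_ge0 ?(mulr_ge0 Qb) ?addr_ge0 ?H0 ?H1 ?H.
Qed.

(** Each increment of [rumin_primitive] up to min (a M) s = s is bounded by a term
    of the sum, and the primitive has the value 9 s^10 at s. *)
Lemma rumin_sum (s : R) (a : nat -> R) M : a 0%N = 0 ->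
  (forall m n, (m <= n)%N -> a m <= a n) -> 0 <= s -> s <= a M ->
  9 * s ^+ 10 <= 35 *
  \sum_(n < M) (a n.+1 ^+ 4 - a n ^+ 4) * Num.max (s ^+ 3 - a n ^+ 3) 0 ^+ 2.
Proof.
move=> a0 nda s0 sM.
have age0 n : 0 <= a n by rewrite -a0 nda.
suff H k : rumin_primitive (s ^+ 3) (Num.min (a k) s) <= 35 *
    \sum_(n < k) (a n.+1 ^+ 4 - a n ^+ 4) * Num.max (s ^+ 3 - a n ^+ 3) 0 ^+ 2.
  have := H M; rewrite (min_idPr sM); apply: le_trans.
  by rewrite (_ : rumin_primitive _ _ = 9 * s ^+ 10)// /rumin_primitive; ring.
elim: k => [|k IH].
  by rewrite big_ord0 a0 (min_idPl s0) /rumin_primitive !expr0n/= !mulr0 subrr addr0.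
rewrite big_ord_recr/= mulrDr.
have a4 : a k ^+ 4 <= a k.+1 ^+ 4 by rewrite lerXn2r ?nnegrE// nda.
have [sk|ks] := lerP s (a k).
  have sk1 : s <= a k.+1 by rewrite (le_trans sk)// nda.
  move: IH; rewrite (min_idPr sk) (min_idPr sk1) => /le_trans; apply.
  by rewrite lerDl mulr_ge0// mulr_ge0 ?sqr_ge0 ?subr_ge0.
have a3s : a k ^+ 3 <= s ^+ 3 by rewrite lerXn2r ?nnegrE// ltW.
rewrite (max_idPl _) ?subr_ge0//.
move: IH; rewrite (min_idPl (ltW ks)) => IH.
have ak1 : a k <= Num.min (a k.+1) s by rewrite le_min nda//= ltW.
have m0 : 0 <= Num.min (a k.+1) s by rewrite (le_trans (age0 k)).
have m3 : Num.min (a k.+1) s ^+ 3 <= s ^+ 3 by rewrite lerXn2r ?nnegrE// ge_min lexx orbT.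
have m4 : Num.min (a k.+1) s ^+ 4 <= a k.+1 ^+ 4.
  by rewrite lerXn2r ?nnegrE// ge_min lexx.
rewrite -[leLHS](subrK (rumin_primitive (s ^+ 3) (a k))) addrC lerD//.
rewrite (le_trans (rumin_increment (age0 k) ak1 m3))// ler_wpM2l//.
by rewrite ler_wpM2r ?sqr_ge0// lerB.
Qed.

(** From the sum of the squares of the components of A p - X a, which is nonnegative. *)
Lemma cauchy_schwarz_sum N (a b p q : 'I_N -> R) :
  (\sum_j (a j * p j + b j * q j)) ^+ 2 <=
  (\sum_j (a j ^+ 2 + b j ^+ 2)) * \sum_j (p j ^+ 2 + q j ^+ 2).
Proof.
set X := \sum_j _; set A := \sum_j _; set B := \sum_j _.
have A0 : 0 <= A by apply: sumr_ge0 => j _; rewrite addr_ge0 ?sqr_ge0.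
have [A_eq0|A_neq0] := eqVneq A 0.
  have ab j : a j ^+ 2 + b j ^+ 2 = 0.
    by apply: (psumr_eq0P _ A_eq0) => // k _; rewrite addr_ge0 ?sqr_ge0.
  rewrite A_eq0 mul0r /X big1 ?expr0n// => j _.
  have /eqP := ab j; rewrite paddr_eq0 ?sqr_ge0// !sqrf_eq0 => /andP[/eqP-> /eqP->].
  by rewrite !mul0r addr0.
have A_gt0 : 0 < A by rewrite lt_neqAle eq_sym A_neq0.
have : 0 <= \sum_j ((A * p j - X * a j) ^+ 2 + (A * q j - X * b j) ^+ 2).
  by apply: sumr_ge0 => j _; rewrite addr_ge0 ?sqr_ge0.
rewrite (_ : \sum_j _ = A * (A * B - X ^+ 2)).
  by rewrite pmulr_rge0// subr_ge0.
transitivity (A ^+ 2 * (\sum_j (p j ^+ 2 + q j ^+ 2)) -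
  2 * A * X * (\sum_j (a j * p j + b j * q j)) +
  X ^+ 2 * (\sum_j (a j ^+ 2 + b j ^+ 2))); last by rewrite -/A -/B -/X; ring.
rewrite [A ^+ 2 * _]mulr_sumr [2 * A * X * _]mulr_sumr [X ^+ 2 * _]mulr_sumr.
by rewrite -sumrB -big_split/=; apply: eq_bigr => j _; ring.
Qed.

Lemma minkowski_tail N (a b p q : 'I_N -> R) r t : 0 <= r -> 0 <= t ->
  \sum_j (a j ^+ 2 + b j ^+ 2) = r ^+ 2 -> \sum_j (p j ^+ 2 + q j ^+ 2) <= t ^+ 2 ->
  Num.max (r - t) 0 ^+ 2 <= \sum_j ((a j - p j) ^+ 2 + (b j - q j) ^+ 2).
Proof.
move=> r0 t0 ab pq; have [rt|tr] := lerP r t.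
  rewrite (max_idPr _) ?subr_le0// expr0n/=.
  by apply: sumr_ge0 => j _; rewrite addr_ge0 ?sqr_ge0.
rewrite (max_idPl _) ?subr_ge0 ?(ltW tr)//.
have := cauchy_schwarz_sum a b p q; rewrite ab.
have -> : \sum_j ((a j - p j) ^+ 2 + (b j - q j) ^+ 2) =
    r ^+ 2 - 2 * \sum_j (a j * p j + b j * q j) + \sum_j (p j ^+ 2 + q j ^+ 2).
  rewrite -ab mulr_sumr -sumrB -big_split/=.
  by apply: eq_bigr => j _; ring.
have : 0 <= \sum_j (p j ^+ 2 + q j ^+ 2).
  by apply: sumr_ge0 => j _; rewrite addr_ge0 ?sqr_ge0.
move: pq; move: (\sum_j _) (\sum_j _) => X S St S0 XS.
have [s s0 sS] : exists2 s, 0 <= s & s ^+ 2 = S.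
  by exists (Num.sqrt S); rewrite ?sqrtr_ge0 ?sqr_sqrtr.
have st : s <= t by rewrite -(ler_pXn2r (n := 2))// ?nnegrE// sS.
have Xrs : X <= r * s.
  have [X0|X0] := lerP X 0; first by rewrite (le_trans X0)// mulr_ge0.
  by rewrite -(ler_pXn2r (n := 2))// ?nnegrE ?(ltW X0) ?mulr_ge0// exprMn sS.
nra.
Qed.

End rumin_inequalities.

(** * The diagonal of the spectral projections *)

Section bessel.
Context {R : realType}.
Notation S3 := (SU2 R).
Implicit Types (x y z w : R4 R) (f : R4 R -> R).

(** The squared norm of the residue of [f] after projecting to the complex span
    of the [u j + i v j], written with real and imaginary parts. *)
Lemma bessel N (u v : 'I_N -> R4 R -> R) f :
  (forall j, sphere_sqint (u j)) -> (forall j, sphere_sqint (v j)) ->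
  (forall j k, ip (u j) (u k) + ip (v j) (v k) = (j == k)%:R) ->
  (forall j k, ip (v j) (u k) = ip (u j) (v k)) -> sphere_sqint f ->
  \sum_j (ip f (u j) ^+ 2 + ip f (v j) ^+ 2) <= ip f f.
Proof.
move=> su sv uv vu sf.
pose a j := ip f (u j); pose b j := ip f (v j).
pose P x := \sum_j (a j * u j x + b j * v j x).
pose Q x := \sum_j (a j * v j x - b j * u j x).
have sPj j : sphere_sqint (fun x => a j * u j x + b j * v j x).
  by apply: sphere_sqintD; exact: sphere_sqintZ.
have sQj j : sphere_sqint (fun x => a j * v j x - b j * u j x).
  by apply: sphere_sqintB; exact: sphere_sqintZ.
have sP : sphere_sqint P by apply: sphere_sqint_sum.
have sQ : sphere_sqint Q by apply: sphere_sqint_sum.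
have ipP h : sphere_sqint h -> ip h P = \sum_j (a j * ip h (u j) + b j * ip h (v j)).
  move=> sh; rewrite ip_sumr//; apply: eq_bigr => j _.
  by rewrite ipDr ?ipZr//; exact: sphere_sqintZ.
have ipQ h : sphere_sqint h -> ip h Q = \sum_j (a j * ip h (v j) - b j * ip h (u j)).
  move=> sh; rewrite ip_sumr//; apply: eq_bigr => j _.
  rewrite -[in RHS]mulNr -!ipZr// -ipDr//; try exact: sphere_sqintZ.
  by apply: eq_ip => // x _; rewrite mulNr.
have delta (c : 'I_N -> R) j : \sum_k c k * (j == k)%:R = c j.
  rewrite (bigD1 j)//= eqxx mulr1 big1 ?addr0// => k kj.
  by rewrite eq_sym (negbTE kj) mulr0.
have uvP j : ip (u j) P + ip (v j) Q = a j.
  rewrite ipP// ipQ// -big_split/= -(delta a j); apply: eq_bigr => k _.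
  by rewrite vu -uv; ring.
have vuP j : ip (v j) P - ip (u j) Q = b j.
  rewrite ipP// ipQ// -sumrB/= -(delta b j); apply: eq_bigr => k _.
  by rewrite vu -uv; ring.
have PQ : ip P P + ip Q Q = \sum_j (a j ^+ 2 + b j ^+ 2).
  rewrite {1}ipP// {1}ipQ// -big_split/=; apply: eq_bigr => j _.
  transitivity (a j * (ip (u j) P + ip (v j) Q) + b j * (ip (v j) P - ip (u j) Q)).
    by rewrite !(ipC P) !(ipC Q); ring.
  by rewrite uvP vuP !expr2.
have fP : ip f P = \sum_j (a j ^+ 2 + b j ^+ 2).
  by rewrite ipP//; apply: eq_bigr => j _; rewrite !expr2.
have := ip_ge0 (fun x => f x - P x); rewrite ip_sqrB// fP.
have := ip_ge0 Q; rewrite -/a -/b.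
by move: PQ; rewrite -/(a _); lra.
Qed.

Lemma cheb1 n : (cheb n : {poly R}).[1] = n.+1%:R.
Proof.
suff [] : (cheb n : {poly R}).[1] = n.+1%:R /\ (cheb n.+1 : {poly R}).[1] = n.+2%:R by [].
elim: n => [|n [IH0 IH1]].
  by rewrite /= hornerZ hornerX hornerC mulr1.
split=> //; rewrite chebSS hornerD hornerN hornerM hornerZ hornerX IH0 IH1.
by rewrite -!natr1; ring.
Qed.

Definition zonal_density n : R := \sum_(1 <= k < n.+1) (zpoly k).[1].

Lemma ip_ridge_sum n x : S3 x ->
  ip (fun y => (\sum_(1 <= k < n.+1) zpoly k).[dot x y])
     (fun y => (\sum_(1 <= k < n.+1) zpoly k).[dot x y]) = zonal_density n.
Proof.
move=> Sx; rewrite -/(bil x x _ _) bil_suml /zonal_density.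
rewrite big_seq [RHS]big_seq; apply: eq_bigr => k kn.
rewrite bilC bil_suml (bigD1_seq k)//= ?iota_uniq// bil_zpoly// eqxx mul1r.
rewrite dotxx (proj1 (SU2P _) Sx) big1 ?addr0// => m mk.
by rewrite bil_zpoly// (negbTE mk) mul0r.
Qed.

(** At a fixed x the values of the partial sums are the coefficients of the
    kernel, as a function of y, along the orthonormal family. *)
Lemma psum_density N (u v : 'I_N -> R4 R -> R) n x :
  (forall j, sphere_sqint (u j)) -> (forall j, sphere_sqint (v j)) ->
  (forall j k, ip (u j) (u k) + ip (v j) (v k) = (j == k)%:R) ->
  (forall j k, ip (v j) (u k) = ip (u j) (v k)) -> S3 x ->
  \sum_j (psum 1 n.+1 (u j) x ^+ 2 + psum 1 n.+1 (v j) x ^+ 2) <= zonal_density n.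
Proof.
move=> su sv uv vu Sx; rewrite -(ip_ridge_sum n Sx).
have E f : sphere_sqint f -> psum 1 n.+1 f x =
    ip (fun y => (\sum_(1 <= k < n.+1) zpoly k).[dot x y]) f.
  move=> sf; rewrite /psum -ip_suml//; last by move=> k _; exact: sqint_ridge.
  by apply: eq_ip => // y _; rewrite horner_sum.
under eq_bigr do rewrite !E//.
by apply: bessel => //; exact: sqint_ridge.
Qed.

Lemma zonal_densityE n : zonal_density n =
  (n * (2 * n ^ 2 + 9 * n + 13))%:R / 6 / (2 * pi ^+ 2).
Proof.
have pi0 : pi != 0 :> R by rewrite lt0r_neq0// pi_gt0.
have zE k : (zpoly k : {poly R}).[1] = k.+1%:R ^+ 2 / (2 * pi ^+ 2).
  by rewrite /zpoly hornerZ cheb1 expr2 mulrAC.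
rewrite /zonal_density; elim: n => [|n IH]; first by rewrite big_geq// !mul0r.
rewrite big_nat_recr//= IH zE -mulrDl; congr (_ / _).
by rewrite !(natrM, natrD, natrX) -!natr1; field.
Qed.

(** After division by n^2, the difference of the two sides has nonnegative
    coefficients as a polynomial in n - 1. *)
Lemma zonal_density_le n :
  zonal_density n ^+ 2 <= 25 / (48 * pi ^+ 4) * (n * n.+2)%:R ^+ 3.
Proof.
have pi0 : 0 < pi :> R by exact: pi_gt0.
rewrite zonal_densityE; move: (@pi R) pi0 => c c0.
have -> : 25 / (48 * c ^+ 4) * (n * n.+2)%:R ^+ 3 =
   (75 * (n * n.+2) ^ 3)%:R * (144 * c ^+ 4)^-1.
  by rewrite [(75 * _)%:R]natrM natrX; move: (n * n.+2)%:R => m; field; rewrite lt0r_neq0.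
have -> : ((n * (2 * n ^ 2 + 9 * n + 13))%:R / 6 / (2 * c ^+ 2)) ^+ 2 =
   ((n * (2 * n ^ 2 + 9 * n + 13)) ^ 2)%:R * (144 * c ^+ 4)^-1.
  by rewrite natrX; move: (_ * _)%:R => m; field; rewrite lt0r_neq0.
rewrite ler_wpM2r ?invr_ge0 ?mulr_ge0 ?exprn_ge0 ?(ltW c0)// ler_nat.
case: n => // n.
have -> : (75 * (n.+1 * n.+3) ^ 3 = (n.+1 * (2 * n.+1 ^ 2 + 9 * n.+1 + 13)) ^ 2 +
    n.+1 ^ 2 * (71 * n ^ 4 + 698 * n ^ 3 + 2435 * n ^ 2 + 3426 * n + 1449))%N by ring.
exact: leq_addr.
Qed.

End bessel.

(** * Complex-valued functions and weak gradients *)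

Section gradients.
Context {R : realType}.
Local Open Scope complex_scope.
Notation S3 := (SU2 R).
Notation sigma := (surface R).
Implicit Types (x y z w : R4 R) (f : R4 R -> R) (psi : R4 R -> R[i]).

Let mS3 : measurable S3 := measurable_SU2.

Lemma integrable_sum_mul (I : Type) (r : seq I) (f g : I -> R4 R -> R) :
  (forall i, sphere_sqint (f i)) -> (forall i, sphere_sqint (g i)) ->
  sigma.-integrable S3 (EFin \o (fun x => \sum_(i <- r) f i x * g i x)).
Proof.
move=> sf sg; rewrite (_ : EFin \o _ = fun x => (\sum_(i <- r) (f i x * g i x)%:E)%E); last first.
  by apply/funext => x; rewrite /= sumEFin.
by apply: (integrable_sum mS3) => k _; exact: sphere_sqint_integrable.
Qed.

Lemma sum_ip (I : Type) (r : seq I) (f g : I -> R4 R -> R) :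
  (forall i, sphere_sqint (f i)) -> (forall i, sphere_sqint (g i)) ->
  \int[sigma]_(x in S3) (\sum_(i <- r) f i x * g i x) = \sum_(i <- r) ip (f i) (g i).
Proof.
move=> sf sg; elim: r => [|i r IH].
  by rewrite big_nil; under eq_Rintegral do rewrite big_nil; rewrite Rintegral_cst// mul0r.
rewrite big_cons -IH /ip -RintegralD//; last 2 first.
- exact: sphere_sqint_integrable.
- exact: integrable_sum_mul.
by apply: eq_Rintegral => x _; rewrite big_cons.
Qed.

Lemma integral_sum_sqr (I : Type) (r : seq I) (f : I -> R4 R -> R) :
  (forall i, sphere_sqint (f i)) ->
  (\int[sigma]_(x in S3) (\sum_(i <- r) f i x ^+ 2)%:E)%E = (\sum_(i <- r) ip (f i) (f i))%:E.
Proof.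
move=> sf; rewrite -sum_ip// /Rintegral fineK.
  by apply: eq_integral => x _; congr (_%:E); apply: eq_bigr => i _; rewrite expr2.
by apply: integrable_fin_num => //; exact: integrable_sum_mul.
Qed.

Lemma integral_sum_sqr2 (I : Type) (r : seq I) (f g : I -> R4 R -> R) :
  (forall i, sphere_sqint (f i)) -> (forall i, sphere_sqint (g i)) ->
  (\int[sigma]_(x in S3) (\sum_(i <- r) (f i x ^+ 2 + g i x ^+ 2))%:E)%E =
  (\sum_(i <- r) ip (f i) (f i) + \sum_(i <- r) ip (g i) (g i))%:E.
Proof.
move=> sf sg; rewrite EFinD -!integral_sum_sqr// -ge0_integralD//.
- by apply: eq_integral => x _; rewrite -EFinD -big_split.
- by move=> x _; rewrite lee_fin sumr_ge0// => i _; exact: sqr_ge0.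
- apply/measurable_EFinP; apply: measurable_sum => i.
  by apply: measurable_funX; case: (sf i).
- by move=> x _; rewrite lee_fin sumr_ge0// => i _; exact: sqr_ge0.
- apply/measurable_EFinP; apply: measurable_sum => i.
  by apply: measurable_funX; case: (sg i).
Qed.

Lemma L2_sqint psi : L2 psi -> sphere_sqint (fun x => complex.Re (psi x)) /\
  sphere_sqint (fun x => complex.Im (psi x)).
Proof.
move=> [mr mi p2]; split; split=> //; apply: le_lt_trans p2; apply: ge0_le_integral => //=.
- by move=> x _; rewrite lee_fin sqr_ge0.
- by apply/measurable_EFinP; exact: measurable_funX.
- by apply/measurable_EFinP; apply: measurable_funD; exact: measurable_funX.
- by move=> x _; rewrite lee_fin /sqmod lerDl sqr_ge0.
- by move=> x _; rewrite lee_fin sqr_ge0.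
- by apply/measurable_EFinP; exact: measurable_funX.
- by apply/measurable_EFinP; apply: measurable_funD; exact: measurable_funX.
- by move=> x _; rewrite lee_fin /sqmod lerDr sqr_ge0.
Qed.

Lemma is_gradient_grad psi : H1 psi -> is_gradient psi (grad psi).
Proof. by move=> [_ [G pG]]; rewrite /grad; case: xgetP => [G' -> //|/(_ G)]. Qed.

Lemma Re_mulr (z : R[i]) (t : R) : complex.Re (z * t%:C) = complex.Re z * t.
Proof. by case: z => a b; rewrite /= mulr0 subr0. Qed.

Lemma Im_mulr (z : R[i]) (t : R) : complex.Im (z * t%:C) = complex.Im z * t.
Proof. by case: z => a b; rewrite /= mulr0 add0r. Qed.

Lemma Re_sum (I : Type) (r : seq I) (F : I -> R[i]) :
  complex.Re (\sum_(i <- r) F i) = \sum_(i <- r) complex.Re (F i).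
Proof.
elim: r => [|i r IH]; first by rewrite !big_nil.
by rewrite !big_cons -IH; case: (F i) => a b; case: (\sum_(_ <- _) _).
Qed.

Lemma Im_sum (I : Type) (r : seq I) (F : I -> R[i]) :
  complex.Im (\sum_(i <- r) F i) = \sum_(i <- r) complex.Im (F i).
Proof.
elim: r => [|i r IH]; first by rewrite !big_nil.
by rewrite !big_cons -IH; case: (F i) => a b; case: (\sum_(_ <- _) _).
Qed.

(** The divergence of the gradient of a ridge function is again a ridge function
    ([divergence_ridge]), so that the weak equation becomes one between inner
    products of real functions. *)
Lemma weak_ridge psi G (w : R4 R) (p : {poly R}) : is_gradient psi G -> L2 psi -> S3 w ->
  \sum_i ip (fun x => complex.Re (G x i)) (fun y => ridge_field p^`() w y i) =
    - ip (fun x => complex.Re (psi x)) (fun y => (lap p).[dot w y]) /\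
  \sum_i ip (fun x => complex.Im (G x i)) (fun y => ridge_field p^`() w y i) =
    - ip (fun x => complex.Im (psi x)) (fun y => (lap p).[dot w y]).
Proof.
move=> [LG _ wG] Lpsi Sw; have /SU2P w1 := Sw.
have sX i : sphere_sqint (fun y => ridge_field p^`() w y i).
  exact/sphere_bounded_sqint/(separable_boundedr (separable_ridge_field _ i) Sw).
have := wG _ (smooth_ridge_field p^`() w); rewrite /cint => -[eRe eIm].
split.
- rewrite -sum_ip//; last by move=> i; exact: (L2_sqint (LG i)).1.
  transitivity (\int[sigma]_(x in S3) complex.Re (\sum_i G x i * (ridge_field p^`() w x i)%:C)).
    by apply: eq_Rintegral => x _; rewrite Re_sum; apply: eq_bigr => i _; rewrite Re_mulr.
  rewrite eRe; congr (- _); apply: eq_Rintegral => x /set_mem/SU2P x1.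
  by rewrite Re_mulr divergence_ridge.
- rewrite -sum_ip//; last by move=> i; exact: (L2_sqint (LG i)).2.
  transitivity (\int[sigma]_(x in S3) complex.Im (\sum_i G x i * (ridge_field p^`() w x i)%:C)).
    by apply: eq_Rintegral => x _; rewrite Im_sum; apply: eq_bigr => i _; rewrite Im_mulr.
  rewrite eIm; congr (- _); apply: eq_Rintegral => x /set_mem/SU2P x1.
  by rewrite Im_mulr divergence_ridge.
Qed.

Lemma norm2_gradE psi : H1 psi -> norm2_grad psi =
  (\sum_i ip (fun x => complex.Re (grad psi x i)) (fun x => complex.Re (grad psi x i)) +
   \sum_i ip (fun x => complex.Im (grad psi x i)) (fun x => complex.Im (grad psi x i)))%:E.
Proof.
move=> H1psi; have [LG _ _] := is_gradient_grad H1psi.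
exact: (integral_sum_sqr2 _ (fun i => (L2_sqint (LG i)).1) (fun i => (L2_sqint (LG i)).2)).
Qed.

Lemma inner2_ip psi phi : L2 psi -> L2 phi ->
  complex.Re (inner2 psi phi) = ip (fun x => complex.Re (psi x)) (fun x => complex.Re (phi x)) +
    ip (fun x => complex.Im (psi x)) (fun x => complex.Im (phi x)) /\
  complex.Im (inner2 psi phi) = ip (fun x => complex.Im (psi x)) (fun x => complex.Re (phi x)) -
    ip (fun x => complex.Re (psi x)) (fun x => complex.Im (phi x)).
Proof.
move=> /L2_sqint[pr pi] /L2_sqint[qr qi]; split; rewrite /inner2 /cint /=.
  rewrite /ip -RintegralD//; try exact: sphere_sqint_integrable.
  by apply: eq_Rintegral => x _; case: (psi x) => a b; case: (phi x) => c d /=; ring.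
rewrite /ip -RintegralB//; try exact: sphere_sqint_integrable.
by apply: eq_Rintegral => x _; case: (psi x) => a b; case: (phi x) => c d /=; ring.
Qed.

End gradients.

(** * The pointwise bound on the density *)

Section rumin_pointwise.
Context {R : realType}.
Local Open Scope complex_scope.
Notation S3 := (SU2 R).
Notation sigma := (surface R).
Implicit Types (x y z w : R4 R) (f : R4 R -> R) (psi : R4 R -> R[i]).

(** The squared modulus of what S_n leaves of u + i v. *)
Definition residual (u v : R4 R -> R) n x : R :=
  (u x - psum 1 n.+1 u x) ^+ 2 + (v x - psum 1 n.+1 v x) ^+ 2.

Definition eigengap n : R := (n.+1 * n.+3)%:R - (n * n.+2)%:R.

Lemma eigengap_ge0 n : 0 <= eigengap n.
Proof. by rewrite subr_ge0 ler_nat leq_mul. Qed.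

(** The sixth root of c, where c^2 = 25 / (48 pi^4). With rho = s^6 all the
    exponents become integers: the comparison is between s^3 and the cubes of
    a n = c^(1/6) L_n^(1/4). *)
Definition rumin_scale : R := (25 / (48 * pi ^+ 4)) `^ 12^-1.

Lemma rumin_scale12 : rumin_scale ^+ 12 = 25 / (48 * pi ^+ 4).
Proof.
rewrite /rumin_scale -powR_mulrn ?powR_ge0// -powRrM mulVf// powRr1//.
by rewrite divr_ge0// mulr_ge0// exprn_ge0// pi_ge0.
Qed.

Lemma rumin_scale_gt0 : 0 < rumin_scale.
Proof. by rewrite powR_gt0// divr_gt0// mulr_gt0// exprn_gt0// pi_gt0. Qed.

Lemma constantE : 35 / 18 * (25 / (6 * pi ^+ 4)) `^ (1 / 3) = 35 / 9 * rumin_scale ^+ 4.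
Proof.
have -> : 25 / (6 * pi ^+ 4) = (2 * rumin_scale ^+ 4) ^+ 3.
  rewrite exprMn -exprM rumin_scale12; have := @pi_gt0 R; move: (@pi R) => c c0.
  by field; rewrite lt0r_neq0.
have s0 : 0 <= 2 * rumin_scale ^+ 4 by rewrite mulr_ge0// exprn_ge0// ltW// rumin_scale_gt0.
rewrite -powR_mulrn// -powRrM mul1r divff// powRr1//.
by field.
Qed.

(** The sum may stop at any a M above s, since the positive parts vanish beyond. *)
Lemma density_le_residual N (u v : 'I_N -> R4 R -> R) x :
  (forall j, sphere_sqint (u j)) -> (forall j, sphere_sqint (v j)) ->
  (forall j k, ip (u j) (u k) + ip (v j) (v k) = (j == k)%:R) ->
  (forall j k, ip (v j) (u k) = ip (u j) (v k)) -> S3 x ->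
  exists M, (\sum_j (u j x ^+ 2 + v j x ^+ 2)) `^ (5 / 3) <=
    35 / 9 * rumin_scale ^+ 4 * \sum_(n < M) eigengap n * \sum_j residual (u j) (v j) n x.
Proof.
move=> su sv uv vu Sx; set rho := \sum_j _.
have rho0 : 0 <= rho by apply: sumr_ge0 => j _; rewrite addr_ge0 ?sqr_ge0.
pose s := rho `^ 6^-1; have s0 : 0 <= s by exact: powR_ge0.
have s6 : (s ^+ 3) ^+ 2 = rho by rewrite -exprM -powR_mulrn// -powRrM mulVf// powRr1.
have s10 : rho `^ (5 / 3) = s ^+ 10.
  by rewrite -[RHS]powR_mulrn// -powRrM; congr (_ `^ _); field.
have g0 := rumin_scale_gt0.
pose lam n : R := (n * n.+2)%:R.
have lam0 n : 0 <= lam n by exact: ler0n.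
have lamS m n : (m <= n)%N -> lam m <= lam n by move=> mn; rewrite ler_nat leq_mul.
pose a n := rumin_scale * Num.sqrt (Num.sqrt (lam n)).
have a4 n : a n ^+ 4 = rumin_scale ^+ 4 * lam n.
  by rewrite exprMn (exprM (Num.sqrt _) 2 2) !sqr_sqrtr// sqrtr_ge0.
have age0 n : 0 <= a n by rewrite mulr_ge0 ?sqrtr_ge0// ltW.
(* a M >= s as soon as L_M >= M exceeds s^4 / c^(2/3) *)
pose M := Num.bound (s ^+ 4 / rumin_scale ^+ 4).
have sM : s <= a M.
  rewrite -(ler_pXn2r (n := 4))// ?nnegrE// a4 mulrC -ler_pdivrMr ?exprn_gt0//.
  have : s ^+ 4 / rumin_scale ^+ 4 < M%:R.
    by apply: archi_boundP; rewrite divr_ge0// exprn_ge0// ltW.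
  move=> /ltW/le_trans; apply; rewrite ler_nat; exact: leq_pmulr.
exists M; rewrite s10.
have H : 9 * s ^+ 10 <= 35 * \sum_(n < M) (a n.+1 ^+ 4 - a n ^+ 4) * Num.max (s ^+ 3 - a n ^+ 3) 0 ^+ 2.
  apply: rumin_sum => //; first by rewrite /a /lam mul0n !sqrtr0 mulr0.
  by move=> m n mn; rewrite ler_pM2l// ler_wsqrtr// ler_wsqrtr// lamS.
have H2 : \sum_(n < M) (a n.+1 ^+ 4 - a n ^+ 4) * Num.max (s ^+ 3 - a n ^+ 3) 0 ^+ 2 <=
    rumin_scale ^+ 4 * \sum_(n < M) eigengap n * \sum_j residual (u j) (v j) n x.
  rewrite mulr_sumr; apply: ler_sum => n _.
  rewrite !a4 -mulrBr -mulrA ler_wpM2l ?exprn_ge0 ?(ltW g0)//.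
  rewrite ler_wpM2l ?eigengap_ge0//; apply: minkowski_tail => //; rewrite ?exprn_ge0//.
  apply: (le_trans (psum_density n su sv uv vu Sx)).
  have : zonal_density n ^+ 2 <= rumin_scale ^+ 12 * (n * n.+2)%:R ^+ 3.
    by rewrite rumin_scale12; exact: zonal_density_le.
  have -> : rumin_scale ^+ 12 * (n * n.+2)%:R ^+ 3 = ((a n ^+ 3) ^+ 2) ^+ 2.
    by transitivity ((a n ^+ 4) ^+ 3); [rewrite a4 exprMn -exprM|rewrite -!exprM].
  move=> h; have [z0|z0] := lerP (@zonal_density R n) 0; first by rewrite (le_trans z0)// sqr_ge0.
  by rewrite -ler_sqr ?nnegrE ?sqr_ge0 ?(ltW z0).
by move: H H2; rewrite -[35 / 9 * _ * _]mulrA; lra.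
Qed.

End rumin_pointwise.

(** * Integration over the sphere *)

Section kinetic_energy.
Context {R : realType}.
Local Open Scope complex_scope.
Notation S3 := (SU2 R).
Notation sigma := (surface R).
Implicit Types (x y z w : R4 R) (f : R4 R -> R) (psi : R4 R -> R[i]).

Let mS3 : measurable S3 := measurable_SU2.

Lemma residual_sqint f n : sphere_sqint f -> sphere_sqint (fun x => f x - psum 1 n.+1 f x).
Proof. by move=> sf; apply: sphere_sqintB => //; exact: psum_sqint. Qed.

Lemma measurable_residual N (u v : 'I_N -> R4 R -> R) n :
  (forall j, sphere_sqint (u j)) -> (forall j, sphere_sqint (v j)) ->
  measurable_fun S3 (fun x => \sum_j residual (u j) (v j) n x).
Proof.
move=> su sv; apply: measurable_sum => j; apply: measurable_funD.
- by apply: measurable_funX; case: (residual_sqint n (su j)).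
- by apply: measurable_funX; case: (residual_sqint n (sv j)).
Qed.

Lemma residual_ge0 (u v : R4 R -> R) n x : 0 <= residual u v n x.
Proof. by rewrite addr_ge0 ?sqr_ge0. Qed.

Lemma integral_residual N (u v : 'I_N -> R4 R -> R) n :
  (forall j, sphere_sqint (u j)) -> (forall j, sphere_sqint (v j)) ->
  (\int[sigma]_(x in S3) (\sum_j residual (u j) (v j) n x)%:E)%E =
  (\sum_j ip (fun x => u j x - psum 1 n.+1 (u j) x) (fun x => u j x - psum 1 n.+1 (u j) x) +
   \sum_j ip (fun x => v j x - psum 1 n.+1 (v j) x) (fun x => v j x - psum 1 n.+1 (v j) x))%:E.
Proof.
move=> su sv.
exact: (integral_sum_sqr2 _ (fun j => residual_sqint n (su j)) (fun j => residual_sqint n (sv j))).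
Qed.

Lemma weighted_exchange M N (c : 'I_M -> R) (a b : 'I_M -> 'I_N -> R) :
  \sum_n c n * (\sum_j a n j + \sum_j b n j) =
  \sum_j \sum_n c n * a n j + \sum_j \sum_n c n * b n j.
Proof.
rewrite exchange_big [X in _ = _ + X]exchange_big -big_split/=.
by apply: eq_bigr => n _; rewrite mulrDr !mulr_sumr.
Qed.

Lemma kinetic_partial N (psi : 'I_N -> R4 R -> R[i]) M :
  (forall j, H1 (psi j)) -> (forall j, cint (psi j) = 0) ->
  (\sum_(n < M) \int[sigma]_(x in S3) (eigengap n * \sum_j residual
     (fun x => complex.Re (psi j x)) (fun x => complex.Im (psi j x)) n x)%:E
   <= \sum_(j < N) norm2_grad (psi j))%E.
Proof.
move=> H1psi mean0.
pose u j x := complex.Re (psi j x); pose v j x := complex.Im (psi j x).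
have su j : sphere_sqint (u j) := (L2_sqint (H1psi j).1).1.
have sv j : sphere_sqint (v j) := (L2_sqint (H1psi j).1).2.
have u0 j : ip (u j) (fun=> 1) = 0.
  by have [+ _] := mean0 j; rewrite /ip => <-; apply: eq_Rintegral => x _; rewrite mulr1.
have v0 j : ip (v j) (fun=> 1) = 0.
  by have [_ +] := mean0 j; rewrite /ip => <-; apply: eq_Rintegral => x _; rewrite mulr1.
under eq_bigr do under eq_integral do rewrite EFinM.
under eq_bigr => n _.
  rewrite ge0_integralZl//; [|exact: measurableT_comp (measurable_residual n su sv)
    | by move=> x _; rewrite lee_fin sumr_ge0// => j _; exact: residual_ge0
    | by rewrite lee_fin eigengap_ge0].
  rewrite integral_residual// -EFinM.
  over.
rewrite sumEFin; under [in leRHS]eq_bigr do rewrite norm2_gradE//.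
rewrite sumEFin lee_fin.
rewrite weighted_exchange big_split/=.
have W j w p Sw := @weak_ridge R _ _ w p (is_gradient_grad (H1psi j)) (H1psi j).1 Sw.
have sG j i := L2_sqint ((let: And3 LG _ _ := is_gradient_grad (H1psi j) in LG) i).
rewrite lerD// ler_sum// => j _; apply: energy_tail.
- exact: su.
- by move=> i; exact: (sG j i).1.
- exact: u0.
- by move=> w p Sw; exact: (W j w p Sw).1.
- exact: sv.
- by move=> i; exact: (sG j i).2.
- exact: v0.
- by move=> w p Sw; exact: (W j w p Sw).2.
Qed.

End kinetic_energy.

Local Open Scope complex_scope.

Theorem corollary1p2 (R : realType) (N : nat) (psi : 'I_N -> R4 R -> R[i])
  (N_gt0 : (0 < N)%N)
  (psi_H1 : forall j, H1 (psi j))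
  (psi_orthonormal : forall j k, inner2 (psi j) (psi k) = (j == k)%:R)
  (psi_mean0 : forall j, cint (psi j) = 0) :
  (\int[surface R]_(x in SU2 R) (density psi x `^ (5 / 3))%:E <=
   (35 / 18 * (25 / (6 * pi ^+ 4)) `^ (1 / 3))%:E *
     \sum_(j < N) norm2_grad (psi j))%E.
Proof.
rewrite constantE.
pose u j x := complex.Re (psi j x); pose v j x := complex.Im (psi j x).
have su j : sphere_sqint (u j) := (L2_sqint (psi_H1 j).1).1.
have sv j : sphere_sqint (v j) := (L2_sqint (psi_H1 j).1).2.
have uv j k : ip (u j) (u k) + ip (v j) (v k) = (j == k)%:R.
  have [<- _] := inner2_ip (psi_H1 j).1 (psi_H1 k).1.
  by rewrite psi_orthonormal; case: eqP.
have vu j k : ip (v j) (u k) = ip (u j) (v k).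
  have [_ E] := inner2_ip (psi_H1 j).1 (psi_H1 k).1.
  apply: subr0_eq; transitivity (complex.Im ((j == k)%:R : R[i])); last by case: eqP.
  by rewrite -psi_orthonormal E.
have mS3 : measurable (SU2 R) := measurable_SU2.
pose K := 35 / 9 * rumin_scale ^+ 4 : R.
have K0 : 0 <= K by rewrite mulr_ge0// exprn_ge0// ltW// rumin_scale_gt0.
pose r n x := eigengap n * \sum_j residual (u j) (v j) n x.
have r0 n x : 0 <= r n x.
  by rewrite mulr_ge0 ?eigengap_ge0// sumr_ge0// => j _; exact: residual_ge0.
have mr n : measurable_fun (SU2 R) (EFin \o r n).
  by apply/measurable_EFinP; apply: measurable_funM => //; exact: measurable_residual.
have mser : measurable_fun (SU2 R) (fun x => \sum_(n <oo) (r n x)%:E)%E.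
  apply: (@ge0_emeasurable_sum _ _ _ _ (fun n x => (r n x)%:E) xpredT).
    by move=> n x _ _; rewrite lee_fin.
  by move=> n _; exact: mr.
apply: (@le_trans _ _ (\int[surface R]_(x in SU2 R) (K%:E * \sum_(n <oo) (r n x)%:E))%E).
  apply: ge0_le_integral => //=.
  - by move=> x _; rewrite lee_fin powR_ge0.
  - apply/measurable_EFinP; apply: (measurableT_comp (measurable_powR _)).
    apply: measurable_sum => j; apply: measurable_funD; apply: measurable_funX.
      by case: (su j).
    by case: (sv j).
  - exact: measurable_funeM.
  - move=> x Sx; have [M hM] := density_le_residual su sv uv vu Sx.
    apply: (@le_trans _ _ (K%:E * \sum_(0 <= n < M) (r n x)%:E)%E).
      by rewrite big_mkord sumEFin -EFinM lee_fin.
    apply: lee_wpmul2l; first by rewrite lee_fin.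
    apply: (@nneseries_lim_ge R (fun n => (r n x)%:E) xpredT 0 M) => n _ _.
    by rewrite lee_fin.
have r0E n x : SU2 R x -> (0 <= (r n x)%:E)%E by rewrite lee_fin.
rewrite ge0_integralZl//; last first.
  by move=> x _; rewrite nneseries_ge0// => n _ _; rewrite lee_fin.
rewrite integral_nneseries//.
apply: lee_wpmul2l; first by rewrite lee_fin.
apply: lime_le.
  by apply: is_cvg_nneseries => n _ _; apply: integral_ge0 => x _; rewrite lee_fin.
by apply: nearW => M; rewrite big_mkord; exact: kinetic_partial.
Qed.
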